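(* Let $H:\mathbb{R}\to\mathbb{R}^{2\times 2}$ be a measurable function with $H(x)$ symmetric, $H(x)\ge 0$ and $\operatorname{tr}H(x)=1$ for almost every $x\in\mathbb{R}$. Then the whole line canonical system $Ju'=-zHu$ on $\mathbb{R}$ has non-negative spectrum, i.e. $\sigma(H)\subseteq[0,\infty)$, if and only if $H(x)=P_{\varphi(x)}$ for almost every $x\in\mathbb{R}$ for some decreasing function $\varphi:\mathbb{R}\to\mathbb{R}$ with $\varphi(-\infty)-\varphi(\infty)\le\pi$.
   Context: $J=\begin{pmatrix}0&-1\\1&0\end{pmatrix}$. For $\alpha\in\mathbb{R}$, $e_\alpha=(\cos\alpha,\sin\alpha)^t$ and $P_\alpha=e_\alpha e_\alpha^*=\begin{pmatrix}\cos^2\alpha&\sin\alpha\cos\alpha\\ \sin\alpha\cos\alpha&\sin^2\alpha\end{pmatrix}$. ''Decreasing'' means non-increasing, and $\varphi(\pm\infty)=\lim_{x\to\pm\infty}\varphi(x)$. $L^2_H(\mathbb{R})$ is the Hilbert space of measurable $f:\mathbb{R}\to\mathbb{C}^2$ with $\int_{\mathbb{R}} f^*Hf\,dx<\infty$, modulo functions with $\int f^*Hf\,dx=0$, with scalar product $\langle f,g\rangle=\int f^*Hg\,dx$. The whole line system generates the self-adjoint relation $\mathcal S$ on $L^2_H(\mathbb{R})$ consisting of all pairs $(f,g)\in L^2_H(\mathbb{R})\times L^2_H(\mathbb{R})$ such that $f$ has a locally absolutely continuous representative $f_0$ with $Jf_0'=-Hg$ almost everywhere. Its multi-valued part is $\mathcal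 S(0)=\{g:(0,g)\in\mathcal S\}$, and $\overline{D(\mathcal S)}=\mathcal S(0)^\perp$. The self-adjoint operator $S$ of the system is the operator on $\overline{D(\mathcal S)}$ with graph $\mathcal S\cap(\overline{D(\mathcal S)}\times\overline{D(\mathcal S)})$, and $\sigma(H)$ denotes the spectrum of $S$ (empty if $\overline{D(\mathcal S)}=0$). *)

(* Defs.v *)
From HB Require Import structures.
From mathcomp Require Import all_boot all_order all_algebra.
From mathcomp Require Import all_classical all_reals all_analysis.
From mathcomp.real_closed Require Import complex.
Set Implicit Arguments.
Unset Strict Implicit.
Unset Printing Implicit Defensive.
Import Order.TTheory GRing.Theory Num.Theory.
Import numFieldNormedType.Exports.
Local Open Scope classical_set_scope.
Local Open Scope complex_scope.
Local Open Scope ring_scope.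

Section CanonicalSystem.
Context {R : realType}.

(* "Measurable" and "almost everywhere" are in the sense of Lebesgue: the      *)
(* canonical measurable sets of R are the Borel sets, so we work instead on    *)
(* the domain of the completed measure, which is convertible to R.             *)
Local Notation leb := (@completed_lebesgue_measure R).
Local Notation lebR := (caratheodory_type (wlength (@idfun R))^*%mu).

Definition lebesgue_measurable (f : R -> R) : Prop :=
  measurable_fun [set: lebR] (f : lebR -> R).

Definition Jmx : 'M[R[i]]_2 :=
  \matrix_(i, j) (if (i < j)%N then -1 else if (j < i)%N then 1 else 0).

Definition evec (a : R) : 'cV[R]_2 :=
  \col_i (if i == 0 then cos a else sin a).

Definition Pmx (a : R) : 'M[R]_2 := evec a *m (evec a)^T.

Definition psd2 (A : 'M[R]_2) : Prop :=
  forall v : 'cV[R]_2, 0 <= (v^T *m A *m v) 0 0.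

Definition coefficient_fun (H : R -> 'M[R]_2) : Prop :=
  (forall i j, lebesgue_measurable (fun x => H x i j)) /\
  {ae leb, forall x, [/\ (H x)^T = H x, psd2 (H x) & \tr (H x) = 1]}.

Definition abs_continuous (a b : R) (f : R -> R) : Prop :=
  forall e : R, 0 < e -> exists2 d : R, 0 < d &
    forall (n : nat) (s t : 'I_n -> R),
      (forall k, a <= s k /\ s k < t k /\ t k <= b) ->
      trivIset [set: 'I_n] (fun k => `]s k, t k[%classic) ->
      \sum_(k < n) (t k - s k) < d ->
      \sum_(k < n) `|f (t k) - f (s k)| < e.

Definition vmeasurable (f : R -> 'cV[R[i]]_2) : Prop :=
  forall k, lebesgue_measurable (fun x => complex.Re (f x k 0)) /\
            lebesgue_measurable (fun x => complex.Im (f x k 0)).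

Definition vlocally_AC (f : R -> 'cV[R[i]]_2) : Prop :=
  forall k (a b : R),
    abs_continuous a b (fun x => complex.Re (f x k 0)) /\
    abs_continuous a b (fun x => complex.Im (f x k 0)).

Definition vis_derive (x : R) (f : R -> 'cV[R[i]]_2) (v : 'cV[R[i]]_2) : Prop :=
  forall k,
    is_derive x (1 : R) (fun t => complex.Re (f t k 0)) (complex.Re (v k 0)) /\
    is_derive x (1 : R) (fun t => complex.Im (f t k 0)) (complex.Im (v k 0)).

Variable H : R -> 'M[R]_2.
Implicit Types f g u : R -> 'cV[R[i]]_2.

Definition cplxH (x : R) : 'M[R[i]]_2 := map_mx (real_complex R) (H x).

Definition formH f g (x : R) : R[i] :=
  ((map_mx (@conjc R) (f x))^T *m cplxH x *m g x) 0 0.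

(* Elements of L^2_H are handled through representatives: L2H is membership,   *)
(* eqH is equality of classes. The form is real and nonnegative a.e. on the    *)
(* diagonal when H is a coefficient function, so taking Re there loses nothing. *)
Definition sqnormH f : \bar R :=
  (\int[leb]_x (complex.Re (formH f f x))%:E)%E.

Definition L2H f : Prop := vmeasurable f /\ (sqnormH f < +oo)%E.

Definition eqH f g : Prop := sqnormH (f \- g) = 0%E.

Definition innerH f g : R[i] :=
  (\int[leb]_x complex.Re (formH f g x))%R +i*
  (\int[leb]_x complex.Im (formH f g x))%R.

Definition normH f : R := Num.sqrt (complex.Re (innerH f f)).

Definition relS f g : Prop :=
  [/\ L2H f, L2H g &
    exists f0, [/\ vmeasurable f0, eqH f f0, vlocally_AC f0 &
      {ae leb, forall x, exists2 v, vis_derive x f0 v &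
                           Jmx *m v = - (cplxH x *m g x)}]].

Definition domS f : Prop := exists g, relS f g.

Definition closure_domS f : Prop :=
  L2H f /\
  forall e : R, 0 < e -> exists2 d, domS d & normH (f \- d) < e.

Definition opS f g : Prop :=
  [/\ relS f g, closure_domS f & closure_domS g].

(* In use, (f, g) is in the graph of S, so that shift z f g is (S - z) f.       *)
Definition shift (z : R[i]) f g : R -> 'cV[R[i]]_2 :=
  fun x => g x - z *: f x.

(* S - z is a bijection from D(S) onto the Hilbert space closure_domS, with    *)
(* bounded inverse.                                                            *)
Definition resolvent_set : set R[i] :=
  [set z | [/\ forall u, closure_domS u ->
                 exists f g, opS f g /\ eqH (shift z f g) u,
               forall f1 g1 f2 g2, opS f1 g1 -> opS f2 g2 ->
                 eqH (shift z f1 g1) (shift z f2 g2) -> eqH f1 f2 &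
               exists C : R, forall f g, opS f g ->
                 normH f <= C * normH (shift z f g)]].

Definition spectrum : set R[i] := ~` resolvent_set.

End CanonicalSystem.

(* Submission.v *)
(* If the spectrum is in [0, oo), then every negative number is in the resolvent
   set, and this forces <f, g> >= 0 for all (f, g) in the relation. Test this on
   compactly supported f with J f' = - H g: f is a rotated closed planar path
   with velocity H g in the range of H, and <f, g> is twice its signed area. So
   all such closed paths have non-negative area. Near a Lebesgue point x of H
   the path can move in any direction of the range of H(x), so triangles and
   quadrilaterals with edges in the ranges of H(x1), H(x2), ... for
   x1 < x2 < ... have non-negative area. This leaves rank two at one point at
   most, and makes the direction of H turn clockwise by no more than pi in all.

   Conversely, if H = P_phi with phi decreasing from at most alpha + pi to
   alpha, then the form integral_s^t f* H g is bounded below by boundary terms: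
   split the line at a point with alpha < phi(c) < alpha + pi and integrate by
   parts on both sides, with the monotone functions cot (phi - alpha -/+ d). The
   boundary terms are negligible along suitable s -> -oo and t -> oo, as f grows
   at most like |x|^(1/2).
   Hence <f, g> >= 0 on the relation, and the a priori bounds this gives for
   z outside [0, oo) hold uniformly for the truncated boundary value problems;
   a compactness argument then yields surjectivity of S - z. If no such c exists,
   then H is a constant projection and the domain of S is trivial. *)
Require Import Defs.
From HB Require Import structures.
From mathcomp Require Import all_boot all_order all_algebra.
From mathcomp Require Import all_classical all_reals all_analysis measurable_realfun.
From mathcomp.real_closed Require Import complex.
From mathcomp Require Import ring lra.
Set Implicit Arguments.
Unset Strict Implicit.
Unset Printing Implicit Defensive.
Import Order.TTheory GRing.Theory Num.Theory.
Import numFieldNormedType.Exports.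
Local Open Scope classical_set_scope.
Local Open Scope complex_scope.
Local Open Scope ring_scope.

(** * Lebesgue measurability and Borel representatives *)

Section CompletedMeasure.
Context {R : realType}.
Local Notation mu := (@lebesgue_measure R).
Local Notation leb := (@completed_lebesgue_measure R).
Local Notation lebR := (caratheodory_type (wlength (@idfun R))^*%mu).

(** Borel functions, complex vectors split into real components, and primitives in place of
    absolutely continuous functions carry the argument; only the last part returns to classes and to
    the completed measure.

    Three obstacles shape it. No spectral theorem is used: a negative value of the form would make
    the infimum of the Rayleigh quotients of one resolvent an approximate eigenvalue. Since the
    relation may be multi-valued, this controls only its operator part, and a general pair is
    reached through the approximations [t (S + t)^-1 f] of [f].

    Triangles alone do not make the phase monotone: they allow the direction to pass through the
    limit direction and come back to its former line. Quadrilaterals exclude this.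

    In the converse the phase may attain both ends of its range, where the cotangent blows up. The
    reference angle is therefore moved by [d], in opposite senses on the two half-lines. This keeps
    the sine away from 0, and the mismatch at the splitting point vanishes with [d]. *)

Lemma completed_measurableP (E : set R) :
  measurable (E : set lebR) ->
  exists A N : set R, [/\ measurable A, mu.-negligible N & E = A `|` N].
Proof.
rewrite -completed_caratheodory_measurable.
rewrite g_sigma_completed_algebra_genE => -[A mA [N nN <-]].
by exists A, N.
Qed.

Lemma completed_measurable (A : set R) :
  measurable A -> measurable (A : set lebR).
Proof. exact: sub_caratheodory. Qed.

Lemma ae_completed (P : R -> Prop) :
  {ae mu, forall x, P x} <-> {ae leb, forall x, P x}.
Proof.
split=> -[A [mA A0 PA]].
  by exists A; split => //; exact: sub_caratheodory.
have [B [N [mB nN AE]]] := completed_measurableP mA.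
have B0 : mu B = 0%E.
  apply/eqP; rewrite eq_le measure_ge0 andbT -A0.
  apply: (@le_measure _ _ _ leb B A); rewrite ?inE//; last first.
    by rewrite AE; exact: subsetUl.
  exact: completed_measurable.
have nB : mu.-negligible B by exists B; split.
apply: negligibleS (negligibleU nB nN).
by apply: subset_trans PA _; rewrite AE.
Qed.

Lemma lebesgue_measurable_borel (f : R -> R) :
  measurable_fun [set: R] f -> lebesgue_measurable f.
Proof.
move=> mf _ Y mY; rewrite setTI; apply: completed_measurable.
by rewrite -[X in measurable X]setTI; apply: mf.
Qed.

(** Each sublevel set at a rational level is Borel up to a negligible set. Countably many negligible
    sets fit into one Borel null set [M], and [f] is overwritten there. *)
Lemma borel_representative (f : R -> R) : lebesgue_measurable f ->
  exists2 g : R -> R, measurable_fun [set: R] g & {ae mu, forall x, f x = g x}.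
Proof.
move=> mf.
have H (q : rat) : exists AN : set R * set R,
    [/\ measurable AN.1, mu.-negligible AN.2 &
        [set x | f x < ratr q] = AN.1 `|` AN.2].
  have mE : measurable ([set x | f x < ratr q] : set lebR).
    have -> : [set x | f x < ratr q] = f @^-1` `]-oo, ratr q[%classic.
      by apply/seteqP; split=> x /=; rewrite in_itv/=.
    rewrite -[X in measurable X]setTI.
    exact: mf measurableT _ (measurable_itv `]-oo, (ratr q : R)[).
  have [A [N [? ? ?]]] := completed_measurableP mE.
  by exists (A, N).
have {H}[AN HAN] := choice H.
pose unr (n : nat) : rat := odflt 0 (unpickle n).
have nM : mu.-negligible (\bigcup_n (AN (unr n)).2).
  by apply: negligible_bigcup => n; have [] := HAN (unr n).
have [M [mM M0 NM]] := nM.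
pose g x := if x \in M then 0 else f x.
exists g; last first.
  exists M; split => // x /= fg; apply: contrapT => xM; apply: fg.
  by rewrite /g memNset.
apply: (measurability _ (@RGenInftyO.measurableE R)) => /= _ -[_ [y ->] <-].
rewrite setTI.
have HM (x : R) (q : rat) : ~ M x -> (f x < ratr q) = (x \in (AN q).1) :> Prop.
  move=> Mx; have [_ _ E] := HAN q.
  apply/propext; split => h.
    have : [set x | f x < ratr q] x by [].
    rewrite E => -[/mem_set//|Nx].
    case: Mx; apply: NM; exists (pickle q) => //.
    by rewrite /unr pickleK.
  have : ((AN q).1 `|` (AN q).2) x by left; exact: set_mem.
  by rewrite -E.
(* Off [M], [f x < y] means [f x < q] for some rational [q <= y]; the points of [M] have the value 0
   and enter exactly when [0 < y]. *)
have -> : g @^-1` `]-oo, y[%classic =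
   (if 0 < y then M else set0) `|`
   (\bigcup_(q in [set q : rat | ratr q <= y]) ((AN q).1 `&` ~` M)).
  apply/seteqP; split => x /=; rewrite in_itv/= /g.
    case: ifPn => [xM ->|xM fy]; first by left; exact: set_mem.
    right; move: xM; rewrite notin_setE => xM.
    have [q /andP[fq qy]] := rat_in_itvoo fy.
    exists q; first by rewrite /= ltW.
    by split => //; apply: set_mem; rewrite -HM.
  move=> [|[q/= qy [Aq Mx]]].
    by case: ifPn => // y0 Mx; rewrite mem_set.
  rewrite memNset// (lt_le_trans _ qy)//.
  by rewrite HM//; exact: mem_set.
apply: measurableU; first by case: ifP.
rewrite bigcup_mkcond; apply: bigcupT_measurable_rat => q; case: ifP => // _.
apply: measurableI; last exact: measurableC.
by have [] := HAN q.
Qed.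

(** The identity is measurable from the completed structure to the Borel one and pushes the
    completed measure forward to [mu]. *)
Lemma integral_completed (f : R -> \bar R) : measurable_fun [set: R] f ->
  (\int[leb]_x f x = \int[mu]_x f x)%E.
Proof.
move=> mf.
have mid : measurable_fun [set: lebR] (idfun : lebR -> measurableTypeR R).
  by move=> _ Y mY; rewrite setTI; exact: completed_measurable.
rewrite integralE [RHS]integralE.
have E (h : R -> \bar R) : measurable_fun [set: R] h ->
    (forall x, (0 <= h x)%E) ->
    (\int[leb]_x h x = \int[mu]_x h x)%E.
  move=> mh h0.
  have := @ge0_integral_pushforward _ _ _ _ _ _ mid leb setT h measurableT.
  rewrite preimage_setT => <-//.
rewrite E//; last exact: measurable_funepos.
by rewrite E//; exact: measurable_funeneg.
Qed.

End CompletedMeasure.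

(** * Primitives and absolute continuity *)

Section IntervalIntegral.
Context {R : realType}.
Local Notation mu := (@lebesgue_measure R).
Implicit Types (F G : R -> R) (a b c : R).

Lemma aeS (P Q : R -> Prop) : (forall x, P x -> Q x) ->
  {ae mu, forall x : R, P x} -> {ae mu, forall x : R, Q x}.
Proof. exact: (@filterS _ _ (ae_filter_ringOfSetsType mu) P Q). Qed.

Lemma aeI (P Q : R -> Prop) : {ae mu, forall x : R, P x} ->
  {ae mu, forall x : R, Q x} -> {ae mu, forall x : R, P x /\ Q x}.
Proof. exact: (@filterI _ _ (ae_filter_ringOfSetsType mu) P Q). Qed.

Lemma aeT (P : R -> Prop) : (forall x, P x) -> {ae mu, forall x : R, P x}.
Proof. by move=> Px; apply: aeW. Qed.

Definition lint G := measurable_fun [set: R] G /\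
  forall a b, mu.-integrable `[a, b]%classic (EFin \o G).

(** An integral over a set: for [b < a] it is 0 and does not change sign. *)
Definition itg a b G : R := \int[mu]_(x in `[a, b]%classic) G x.

Lemma lint_cont F : continuous F -> lint F.
Proof.
move=> cF; split; first exact: continuous_measurable_fun.
move=> a b; apply: continuous_compact_integrable; first exact: segment_compact.
exact: continuous_subspaceT.
Qed.

Lemma lint_cst c : lint (fun=> c).
Proof. by apply: lint_cont => x; exact: cvg_cst. Qed.

Lemma lintD F G : lint F -> lint G -> lint (fun x => F x + G x).
Proof.
move=> [mF iF] [mG iG]; split; first exact: measurable_funD.
move=> a b; apply: eq_integrable (integrableD _ (iF a b) (iG a b)) => //.
Qed.

Lemma lintZ c G : lint G -> lint (fun x => c * G x).
Proof.
move=> [mG iG]; split; first exact: measurable_funM.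
move=> a b; apply: eq_integrable (integrableZl _ c (iG a b)) => //.
Qed.

Lemma lintN G : lint G -> lint (fun x => - G x).
Proof.
move=> /(lintZ (-1)); congr lint; apply/funext => x; by rewrite mulN1r.
Qed.

Lemma lintB F G : lint F -> lint G -> lint (fun x => F x - G x).
Proof. by move=> iF /lintN; exact: lintD. Qed.

Lemma lint_le F G : measurable_fun [set: R] F -> lint G ->
  (forall x, `|F x| <= G x) -> lint F.
Proof.
move=> mF [mG iG] FG; split => // a b.
apply: le_integrable (iG a b) => //.
  by apply/measurable_EFinP; exact: measurable_funTS.
by move=> x _ /=; rewrite lee_fin (le_trans (FG x))// ler_norm.
Qed.

Lemma lint_norm G : lint G -> lint (fun x => `|G x|).
Proof.
move=> [mG iG]; split; first exact: measurableT_comp.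
move=> a b; exact: integrable_norm.
Qed.

Lemma lint_bounded F G : measurable_fun [set: R] F ->
  (forall a b, exists M, forall x, a <= x <= b -> `|F x| <= M) ->
  lint G -> lint (fun x => F x * G x).
Proof.
move=> mF bF [mG iG]; split; first exact: measurable_funM.
move=> a b; have [M HM] := bF a b.
apply: (@le_integrable _ _ _ mu _ _ _ (fun x => (M * `|G x|)%:E)) => //.
- by apply/measurable_EFinP; apply: measurable_funTS; exact: measurable_funM.
- move=> x; rewrite /= in_itv/= => xab; rewrite lee_fin normrM.
  by rewrite (le_trans _ (ler_norm _))// ler_wpM2r// HM.
- by apply: eq_integrable (integrableZl _ M (integrable_norm (iG a b))).
Qed.

Lemma cont_bounded F : continuous F ->
  forall a b, exists M, forall x, a <= x <= b -> `|F x| <= M.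
Proof.
move=> cF a b; have [ab|ba] := leP a b; last first.
  by exists 0 => x /andP[ax xb]; have := lt_le_trans ba (le_trans ax xb); rewrite ltxx.
have cN : {within `[a, b]%classic, continuous (fun x => `|F x|)}.
  by apply: continuous_subspaceT => x; apply: cvg_norm; exact: cF.
have [c _ cM] := EVT_max ab cN.
by exists `|F c| => x xab; apply: cM; rewrite in_itv.
Qed.

Lemma lint_contM F G : continuous F -> lint G -> lint (fun x => F x * G x).
Proof.
move=> cF; apply: lint_bounded; first exact: continuous_measurable_fun.
exact: cont_bounded.
Qed.

Lemma lint_bounded_cst (f : R -> R) (K : R) : measurable_fun [set: R] f ->
  (forall x, `|f x| <= K) -> lint f.
Proof. by move=> mf fK; apply: (lint_le mf (lint_cst K)). Qed.

Lemma itgD a b F G : lint F -> lint G ->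
  itg a b (fun x => F x + G x) = itg a b F + itg a b G.
Proof. by move=> [_ iF] [_ iG]; rewrite /itg RintegralD. Qed.

Lemma itgZ a b c G : lint G -> itg a b (fun x => c * G x) = c * itg a b G.
Proof. by move=> [_ iG]; rewrite /itg RintegralZl. Qed.

Lemma itgN a b G : lint G -> itg a b (fun x => - G x) = - itg a b G.
Proof.
move=> iG; rewrite -mulN1r -itgZ//; congr itg.
by apply/funext => x; rewrite mulN1r.
Qed.

Lemma itgB a b F G : lint F -> lint G ->
  itg a b (fun x => F x - G x) = itg a b F - itg a b G.
Proof. by move=> iF iG; rewrite itgD ?itgN//; exact: lintN. Qed.

Lemma eq_itg a b F G : (forall x, a <= x <= b -> F x = G x) ->
  itg a b F = itg a b G.
Proof.
by move=> FG; apply: eq_Rintegral => x; rewrite inE/= in_itv/=; exact: FG.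
Qed.

Lemma le_itg a b F G : lint F -> lint G ->
  (forall x, a <= x <= b -> F x <= G x) -> itg a b F <= itg a b G.
Proof.
move=> [_ iF] [_ iG] FG; apply: le_Rintegral => // x.
Qed.

Lemma itg_ge0 a b F : (forall x, a <= x <= b -> 0 <= F x) -> 0 <= itg a b F.
Proof.
by move=> F0; apply: Rintegral_ge0 => x; rewrite /= in_itv/=; exact: F0.
Qed.

Lemma itg_norm a b F : lint F -> `|itg a b F| <= itg a b (fun x => `|F x|).
Proof. by move=> [_ iF]; exact: le_normr_Rintegral. Qed.

Lemma itg_cst a b c : a <= b -> itg a b (fun=> c) = c * (b - a).
Proof.
move=> ab; rewrite /itg Rintegral_cst//= lebesgue_measure_itv/= lte_fin.
case: ltP => // ba.
have -> : b = a by apply/eqP; rewrite eq_le ab ba.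
by rewrite subrr mulr0.
Qed.

Lemma itg_cat a b c G : lint G -> a <= b -> b <= c ->
  itg a c G = itg a b G + itg b c G.
Proof.
move=> [_ iG] ab bc; have := iG a c => i.
have := @Rintegral_itvB R G (BLeft a) (BRight c) b i.
rewrite !bnd_simp ab bc => /(_ erefl erefl) h.
rewrite {1}/itg -[LHS](subrK (\int[mu]_(t in `[a, b]%classic) G t)) h addrC.
congr (_ + _); rewrite Rintegral_itv_obnd_cbnd//.
by apply: integrableS (iG b c) => // x; rewrite /= !in_itv/= => /andP[/ltW -> ->].
Qed.

Lemma itg_pt a G : itg a a G = 0.
Proof. by rewrite /itg set_itv1 Rintegral_set1. Qed.

Lemma ae_itg a b F G : measurable_fun [set: R] F -> measurable_fun [set: R] G ->
  {ae mu, forall x : R, F x = G x} -> itg a b F = itg a b G.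
Proof.
move=> mF mG FG; rewrite /itg /Rintegral; congr fine.
apply: ae_eq_integral => //.
- by apply/measurable_EFinP; exact: measurable_funTS.
- by apply/measurable_EFinP; exact: measurable_funTS.
- by apply: aeS FG => x /= -> _.
Qed.

Lemma itg_small G : lint G -> forall a b (e : R), 0 < e -> exists2 d : R, 0 < d &
  forall D : set R, measurable D -> D `<=` `[a, b] -> (mu D < d%:E)%E ->
  \int[mu]_(x in D) `|G x| < e.
Proof.
move=> [mG iG] a b e e0.
have iGab : mu.-integrable setT (EFin \o (G \_ `[a, b])).
  by rewrite -restrict_EFin; apply/integrable_restrict => //=; rewrite setTI.
have [d [d0 Hd]] := integral_normr_continuous iGab e0.
exists d => // D mD Dab muD.
rewrite (le_lt_trans _ (Hd _ mD muD))// le_eqVlt; apply/orP; left; apply/eqP.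
apply: eq_Rintegral => x; rewrite inE => Dx.
by rewrite patchE mem_set//; exact: Dab.
Qed.

End IntervalIntegral.

Section Primitive.
Context {R : realType}.
Local Notation mu := (@lebesgue_measure R).
Implicit Types (F G : R -> R) (a b c : R).

(** The working form of local absolute continuity with derivative [G]. [prim_AC] and
    [prim_ae_derive] lead to the notions of the statement, [AC_prim] leads back. *)
Definition prim F G := lint G /\ forall a b, a <= b -> F b - F a = itg a b G.

Lemma prim_exists G (x0 c : R) : lint G -> exists2 F, prim F G & F x0 = c.
Proof.
move=> iG.
exists (fun x => c + if x0 <= x then itg x0 x G else - itg x x0 G); last first.
  by rewrite lexx itg_pt addr0.
split => // a b ab.
case: (leP x0 a) => x0a.
  rewrite (le_trans x0a ab) (@itg_cat _ x0 a b)//; ring.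
case: (leP x0 b) => x0b.
  rewrite (@itg_cat _ a x0 b)// ?ltW//; ring.
rewrite (@itg_cat _ a b x0)// ?(ltW x0b)//; ring.
Qed.

Lemma primD F1 G1 F2 G2 : prim F1 G1 -> prim F2 G2 ->
  prim (fun x => F1 x + F2 x) (fun x => G1 x + G2 x).
Proof.
move=> [i1 h1] [i2 h2]; split; first exact: lintD.
by move=> a b ab; rewrite itgD// -(h1 _ _ ab) -(h2 _ _ ab); ring.
Qed.

Lemma primZ F G c : prim F G -> prim (fun x => c * F x) (fun x => c * G x).
Proof.
move=> [i1 h1]; split; first exact: lintZ.
by move=> a b ab; rewrite itgZ// -(h1 _ _ ab); ring.
Qed.

Lemma primN F G : prim F G -> prim (fun x => - F x) (fun x => - G x).
Proof.
move=> [i1 h1]; split; first exact: lintN.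
by move=> a b ab; rewrite itgN// -(h1 _ _ ab); ring.
Qed.

Lemma primB F1 G1 F2 G2 : prim F1 G1 -> prim F2 G2 ->
  prim (fun x => F1 x - F2 x) (fun x => G1 x - G2 x).
Proof. by move=> p1 /primN; exact: primD. Qed.

Lemma prim_cst c : prim (fun=> c) (fun=> 0).
Proof.
split; first exact: lint_cst.
by move=> a b ab; rewrite subrr itg_cst// mul0r.
Qed.

Lemma eq_prim F1 G1 F2 G2 : prim F1 G1 -> F1 =1 F2 -> G1 =1 G2 -> prim F2 G2.
Proof. by move=> p /funext <- /funext <-. Qed.

Lemma prim_dist F G a b : prim F G -> a <= b ->
  `|F b - F a| <= itg a b (fun x => `|G x|).
Proof. by move=> [iG h] ab; rewrite h//; exact: itg_norm. Qed.

Lemma prim_small F G : prim F G -> forall a b (e : R), 0 < e ->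
  exists2 d : R, 0 < d & forall s t, a <= s -> s <= t -> t <= b -> t - s < d ->
    itg s t (fun x => `|G x|) < e.
Proof.
move=> [iG h] a b e e0; have [d d0 Hd] := itg_small iG a b e0.
exists d => // s t as_ st tb std.
apply: Hd => //.
  by move=> x; rewrite /= !in_itv/= => /andP[sx xt];
    rewrite (le_trans as_ sx) (le_trans xt tb).
rewrite lebesgue_measure_itv/= -EFinB; case: ifP => _; last by rewrite lte_fin.
by rewrite lte_fin.
Qed.

Lemma prim_cont F G : prim F G -> continuous F.
Proof.
move=> pF x; apply/cvgrPdist_lt => e e0.
have [d d0 Hd] := prim_small pF (x - 1) (x + 1) e0.
near=> t.
have [tx1 tx2] : `|x - t| < d /\ `|x - t| < 1.
  split; near: t.
    exact: (@nbhsx_ballx _ R).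
  exact: (@nbhsx_ballx _ R).
have [tx|xt] := leP t x.
  rewrite (le_lt_trans (prim_dist pF tx))// Hd//.
  - by move: tx2; rewrite ltr_norml => /andP[? ?]; lra.
  - by lra.
  - by move: tx1; rewrite ltr_norml => /andP[? ?]; lra.
rewrite distrC (le_lt_trans (prim_dist pF (ltW xt)))// Hd//.
- lra.
- exact: ltW.
- by move: tx2; rewrite ltr_norml => /andP[? ?]; lra.
- by move: tx1; rewrite ltr_norml => /andP[? ?]; lra.
Unshelve. all: by end_near. Qed.

Lemma prim_bounded F G : prim F G ->
  forall a b, exists M, forall x, a <= x <= b -> `|F x| <= M.
Proof. by move=> /prim_cont; exact: cont_bounded. Qed.

(** The fundamental theorem of calculus wants an integrable function, so it is applied to [G] cut
    off outside [[-n, n]]; the exceptional sets are countably many. *)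
Lemma prim_ae_derive F G : prim F G -> {ae mu, forall x : R, is_derive x (1 : R) F (G x)}.
Proof.
move=> [iG h].
have H (n : nat) : {ae mu, forall x : R, - n%:R < x < n%:R -> is_derive x (1 : R) F (G x)}.
  have iGn : mu.-integrable setT (EFin \o (G \_ `[- n%:R, n%:R])).
    by rewrite -restrict_EFin; apply/integrable_restrict => //=; rewrite setTI; exact: iG.2.
  have iGy y : mu.-integrable `[- n%:R, y]%classic (EFin \o (G \_ `[- n%:R, n%:R])).
    exact: integrableS iGn.
  have lG : locally_integrable [set: R] (G \_ `[- n%:R, n%:R]).
    by apply: integrable_locally => //; exact: iG.2.
  have := FTC1 iGy lG; apply: aeS => x /= Hx /andP[nx xn].
  have ax : ((- n%:R)%:E < x%:E :> \bar R)%E by rewrite lte_fin.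
  have [] := Hx ax.
  set F1 := fun y => _; move=> dF1 eF1.
  have nF : \forall t \near x, F1 t + F (- n%:R) = F t.
    near=> t.
    have tn : - n%:R <= t <= n%:R.
      by apply/andP; split; near: t; [exact: lt_le_nbhsr|exact: lt_le_nbhsl].
    move/andP: tn => [nt tn].
    have -> : F t = F (- n%:R) + itg (- n%:R) t G by rewrite -h//; ring.
    rewrite addrC; congr (_ + _); apply: eq_Rintegral => y.
    rewrite inE/= in_itv/= => /andP[ny yt].
    by rewrite patchE mem_set//= in_itv/= ny (le_trans yt tn).
  have : is_derive x (1 : R) (fun t => F1 t + F (- n%:R)) (G x).
    have -> : G x = (G \_ `[- n%:R, n%:R]) x + 0.
      by rewrite addr0 patchE mem_set//= in_itv/= !ltW.
    rewrite -eF1; apply: is_deriveD.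
    split; [exact: dF1|by rewrite derive1E].
  apply: near_eq_is_derive => //.
have : {ae mu, forall x : R, forall n : nat, - n%:R < x < n%:R -> is_derive x (1 : R) F (G x)}.
  by apply/ae_foralln => n; exact: H.
apply: aeS => x Hx; apply: (Hx (Num.truncn `|x|).+1).
by rewrite -ltr_norml; exact: Num.Theory.truncnS_gt.
Unshelve. all: by end_near. Qed.

End Primitive.

(** * From absolute continuity to the integral of the derivative *)

Section AbsoluteContinuity.
Context {R : realType}.
Local Notation mu := (@lebesgue_measure R).
Implicit Types (F G : R -> R) (a b c : R).

Lemma measure_disjoint_itvs n (s t : 'I_n -> R) :
  (forall k, s k < t k) ->
  trivIset [set: 'I_n] (fun k => `]s k, t k[%classic) ->
  mu (\big[setU/set0]_(k < n) `]s k, t k[%classic) = (\sum_(k < n) (t k - s k))%:E.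
Proof.
move=> st tst; rewrite measure_bigsetU_ord//= -sumEFin.
by apply: eq_bigr => k _; rewrite lebesgue_measure_itv/= lte_fin st EFinB.
Qed.

Lemma prim_AC F G a b : prim F G -> abs_continuous a b F.
Proof.
move=> pF; have [iG hG] := pF; have iN := lint_norm iG.
move=> e e0; have [d d0 Hd] := itg_small iG a b e0; exists d => // n s t st tst sd.
pose D := \big[setU/set0]_(k < n) `]s k, t k[%classic.
have mD : measurable D by apply: bigsetU_measurable => k _.
have Dab : D `<=` `[a, b].
  rewrite /D -bigcup_seq; apply: bigcup_sub => k _ x /=.
  have [? [? ?]] := st k.
  by rewrite !in_itv/= => /andP[? ?]; apply/andP; split; lra.
have muD : (mu D < d%:E)%E.
  by rewrite /D measure_disjoint_itvs// => k; have [_ []] := st k.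
apply: le_lt_trans (Hd D mD Dab muD).
rewrite -lee_fin /Rintegral fineK; last first.
  apply: integrable_fin_num => //.
  exact: integrableS (iN.2 a b).
have -> : (\int[mu]_(x in D) `|G x|%:E =
    \sum_(k < n) \int[mu]_(x in `]s k, t k[) `|G x|%:E)%E.
  apply: (@ge0_integral_bigsetU _ _ _ mu _ (fun k : 'I_n => `]s k, t k[%classic)) => //.
  - by rewrite /index_enum -enumT; exact: enum_uniq.
  - exact: sub_trivIset tst.
  - by apply/measurable_EFinP; apply: measurable_funTS; exact: iN.1.
rewrite -sumEFin; apply: lee_sum => k _; have [ask [stk tbk]] := st k.
apply: (@le_trans _ _ (itg (s k) (t k) (fun x => `|G x|))%:E).
  by rewrite lee_fin; apply: prim_dist => //; exact: ltW.
rewrite /itg /Rintegral fineK; last by apply: integrable_fin_num => //; exact: iN.2.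
rewrite -integral_itv_bndo_bndc; last first.
  by apply/measurable_EFinP; apply: measurable_funTS; exact: iN.1.
rewrite -integral_itv_obnd_cbnd//.
by apply/measurable_EFinP; apply: measurable_funTS; exact: iN.1.
Qed.

(** Real induction: the supremum of the [t] with [P a t] is attained and cannot lie before [b]. It
    replaces covering arguments in [AC_derive0] and [itg_monotone_parts]. *)
Lemma cousin (P : R -> R -> Prop) a b : a <= b ->
  (forall s t u, P s t -> P t u -> P s u) ->
  (forall x, a <= x <= b -> exists2 d, 0 < d & forall s t, a <= s -> s <= x ->
     x <= t -> t <= b -> t - s < d -> P s t) ->
  P a b.
Proof.
move=> ab Pcat Ploc.
pose S := [set t | a <= t <= b /\ P a t].
have Sa : S a.
  split; first by rewrite lexx.
  have [|d d0 Hd] := Ploc a; first by rewrite lexx.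
  by apply: Hd => //; rewrite subrr.
have hS : has_sup S by split; [exists a|exists b => x [/andP[]]].
set c := sup S.
have ac : a <= c by apply: sup_upper_bound.
have cb : c <= b by apply: ge_sup; [exists a|move=> x [/andP[]]].
have [|d d0 Hd] := Ploc c; first by rewrite ac cb.
have Pac : P a c.
  have [t St tc] := sup_adherent d0 hS.
  have [/andP[at_ tb] Pat] := St.
  apply: Pcat Pat _; have tlec : t <= c by apply: sup_upper_bound.
  by apply: Hd => //; rewrite -/c in tc; lra.
have [<-//|cltb] := eqVneq c b.
have {}cltb : c < b by rewrite lt_neqAle cltb.
pose u := Num.min b (c + d / 2).
have cu : c < u by rewrite lt_min cltb ltrDl divr_gt0.
have ub : u <= b by rewrite ge_min lexx.
have ucd : u <= c + d / 2 by rewrite ge_min lexx orbT.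
have Su : S u.
  split; first by rewrite ub andbT ltW// (le_lt_trans ac).
  by apply: Pcat Pac _; apply: Hd => //; [exact: ltW|lra].
have : u <= c by apply: sup_upper_bound.
by move=> /(lt_le_trans cu); rewrite ltxx.
Qed.

Lemma derive0_local F x (e : R) : 0 < e -> is_derive x (1 : R) F 0 ->
  exists2 d, 0 < d & forall y, `|y - x| < d -> `|F y - F x| <= e * `|y - x|.
Proof.
move=> e0 [dF dF0].
have : h^-1 *: (F (h *: (1 : R) + x) - F x) @[h --> (0:R)^'] --> ('D_1 F x : R).
  exact: dF.
rewrite dF0 => /cvgrPdist_lt/(_ e e0).
rewrite near_withinE => /nbhs_ballP[d /= d0 Hd].
exists d => // y yx; have [->|yneqx] := eqVneq y x; first by rewrite !subrr normr0 mulr0.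
have yx0 : y - x != 0 by rewrite subr_eq0.
have := Hd (y - x); rewrite /ball/= sub0r normrN => /(_ yx yx0).
rewrite sub0r normrN scaler1 subrK normrZ normfV.
by rewrite mulrC ltr_pdivrMr ?normr_gt0// => /ltW.
Qed.

(** Near a point of zero derivative, increments are at most [e] times the length. The other points
    form a null set inside an open [U] of small measure; intervals around them lie in [U], and
    absolute continuity bounds the sum of their increments. [cousin] glues the local estimates, the
    predicate carrying the list of intervals spent in [U]. *)
Lemma AC_derive0 F a b : a <= b -> abs_continuous a b F ->
  {ae mu, forall x : R, is_derive x (1 : R) F 0} -> F b = F a.
Proof.
move=> ab acF [N [mN N0 NF]].
apply/eqP; rewrite -subr_eq0 -normr_le0; apply/ler_addgt0Pl => e0 e0_gt0; rewrite addr0.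
(* Makes the two errors [e * (b - a)] and [e] add up to [e0]. *)
pose e := e0 / (b - a + 1).
have e_gt0 : 0 < e by rewrite divr_gt0//; lra.
have [d d_gt0 Hd] := acF _ e_gt0.
have [U [oU NU UN]] : exists U : set R, [/\ open U, N `<=` U & (mu (U `\` N) < d%:E)%E].
  by apply: lebesgue_regularity_outer => //; move: N0 => /= ->.
have muU : (mu U < d%:E)%E.
  rewrite (_ : U = N `|` (U `\` N)); last by rewrite setDUK.
  have mUN : measurable (U `\` N) by apply: measurableD => //; exact: open_measurable.
  by rewrite (le_lt_trans (measureU2 _ _ _))//=; move: N0 => /= ->; rewrite add0e.
pose P s t := a <= s -> t <= b -> s <= t /\ exists l : seq (R * R),
  [/\ pairwise (fun p q => p.2 <= q.1) l,
      forall p, p \in l -> [/\ s <= p.1, p.1 < p.2, p.2 <= t & `]p.1, p.2[ `<=` U] &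
      `|F t - F s| <= e * (t - s) + \sum_(p <- l) `|F p.2 - F p.1|].
pose Q s t := s <= t /\ P s t.
have : Q a b.
  apply: cousin => //.
  - move=> s t u [st Pst] [tu Ptu]; split; first exact: le_trans tu.
    move=> as_ ub; split; first exact: le_trans tu.
    have [_ [l [pl ll Fl]]] := Pst as_ (le_trans tu ub).
    have [_ [r [pr rr Fr]]] := Ptu (le_trans as_ st) ub.
    exists (l ++ r); split.
    - rewrite pairwise_cat pl pr !andbT; apply/allrelP => p q /ll[_ _ pt _] /rr[tq _ _ _].
      exact: le_trans tq.
    - move=> p; rewrite mem_cat => /orP[/ll[? ? pt ?]|/rr[tp ? ? ?]]; split => //.
        exact: le_trans tu.
      exact: le_trans tp.
    - rewrite big_cat/= -(subrK (F t) (F u)) -addrA (le_trans (ler_normD _ _))//.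
      apply: le_trans (lerD Fr Fl) _; rewrite le_eqVlt; apply/orP; left; apply/eqP; ring.
  - move=> x xab.
    have [xN|xN] := pselect (N x).
      have [r /= r0 Hr] : exists2 r : R, 0 < r & ball x r `<=` U.
        by apply/nbhs_ballP; apply: open_nbhs_nbhs; split => //; exact: NU.
      exists r => // s t as_ sx xt tb str; split; first exact: le_trans xt.
      move=> _ _; split; first exact: le_trans xt.
      have [->|st] := eqVneq s t.
        by exists [::]; split => //; rewrite big_nil !subrr normr0 mulr0 addr0.
      have {}st : s < t by rewrite lt_neqAle st (le_trans sx).
      exists [:: (s, t)]; split => //.
        move=> p; rewrite inE => /eqP ->/=; split => // y; rewrite /= in_itv/= => /andP[sy yt].
        by apply: Hr; rewrite /ball/= ltr_norml; apply/andP; split; lra.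
      by rewrite big_seq1/= lerDr mulr_ge0// ?subr_ge0 ltW.
    have dF0 : is_derive x (1 : R) F 0.
      by apply: contrapT => h; apply: xN; exact: NF.
    have [r r0 Hr] := derive0_local e_gt0 dF0.
    exists r => // s t as_ sx xt tb str; split; first exact: le_trans xt.
    move=> _ _; split; first exact: le_trans xt.
    exists [::]; split => //; rewrite big_nil addr0.
    have h1 : `|F t - F x| <= e * `|t - x|.
      by apply: Hr; rewrite ger0_norm ?subr_ge0//; lra.
    have h2 : `|F x - F s| <= e * `|x - s|.
      by rewrite distrC (distrC x); apply: Hr; rewrite distrC ger0_norm ?subr_ge0//; lra.
    rewrite -(subrK (F x) (F t)) -addrA (le_trans (ler_normD _ _))//.
    apply: le_trans (lerD h1 h2) _; rewrite !ger0_norm ?subr_ge0//.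
    rewrite le_eqVlt; apply/orP; left; apply/eqP; ring.
move=> [_ /(_ (lexx a) (lexx b))[_ [l [pl ll Fl]]]].
apply: (le_trans Fl).
have He : e0 = e * (b - a) + e by rewrite -[X in _ + X]mulr1 -mulrDr /e divfK//; lra.
rewrite He lerD2l.
pose s (k : 'I_(size l)) := (nth (0, 0) l k).1.
pose t (k : 'I_(size l)) := (nth (0, 0) l k).2.
have Hk k : [/\ a <= s k, s k < t k, t k <= b & `]s k, t k[ `<=` U].
  by apply: ll; exact: mem_nth.
rewrite (big_nth (0, 0)) big_mkord ltW//.
have tst : trivIset [set: 'I_(size l)] (fun k => `]s k, t k[%classic).
  have disj (i j : 'I_(size l)) : (i < j)%N -> `]s i, t i[ `&` `]s j, t j[ = set0.
    move=> ij; apply/seteqP; split => // x /=; rewrite !in_itv/= => -[/andP[_ xi] /andP[jx _]].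
    have /pairwiseP/(_ i j (ltn_ord i) (ltn_ord j) ij) := pl => /(_ (0, 0)).
    by rewrite leNgt (lt_trans jx xi).
  apply/trivIsetP => i j _ _ ij.
  by case: (ltngtP i j) => [/disj//|/disj|/val_inj/eqP]; [rewrite setIC|rewrite (negbTE ij)].
apply: (Hd _ s t) => //; first by move=> k; have [? ? ?] := Hk k.
rewrite -lte_fin -measure_disjoint_itvs//; last by move=> k; have [] := Hk k.
apply: le_lt_trans muU; apply: le_measure; rewrite ?inE//.
- by apply: bigsetU_measurable.
- exact: open_measurable.
- by rewrite -bigcup_seq; apply: bigcup_sub => k _; have [] := Hk k.
Qed.

Lemma AC_le F F1 F2 M a b : 0 < M -> abs_continuous a b F1 -> abs_continuous a b F2 ->
  (forall s t, a <= s <= b -> a <= t <= b ->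
    `|F t - F s| <= M * (`|F1 t - F1 s| + `|F2 t - F2 s|)) ->
  abs_continuous a b F.
Proof.
move=> M0 ac1 ac2 FM e e0.
have e'0 : 0 < e / (2 * M) by rewrite divr_gt0// mulr_gt0.
have [d1 d10 H1] := ac1 _ e'0; have [d2 d20 H2] := ac2 _ e'0.
exists (Num.min d1 d2); first by rewrite lt_min d10.
move=> n s t st tst; rewrite lt_min => /andP[l1 l2].
have := H1 n s t st tst l1; have := H2 n s t st tst l2 => h2 h1.
apply: (@le_lt_trans _ _ (M * (\sum_(k < n) `|F1 (t k) - F1 (s k)| + \sum_(k < n) `|F2 (t k) - F2 (s k)|))).
  rewrite -big_split/= mulr_sumr; apply: ler_sum => k _.
  by have [? [? ?]] := st k; apply: FM; apply/andP; split; lra.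
have -> : e = M * (e / (2 * M) + e / (2 * M)) by field; rewrite gt_eqF.
by rewrite ltr_pM2l// ltrD.
Qed.

Lemma AC_sub F1 F2 a b : abs_continuous a b F1 -> abs_continuous a b F2 ->
  abs_continuous a b (fun x => F1 x - F2 x).
Proof.
move=> h1 h2; apply: (AC_le ltr01 h1 h2) => s t _ _; rewrite mul1r.
by rewrite (_ : _ - _ = (F1 t - F1 s) - (F2 t - F2 s)) ?ler_normB//; ring.
Qed.

(** [F] minus a primitive of [G] is absolutely continuous with derivative zero almost everywhere,
    hence constant. *)
Lemma AC_prim F G : (forall a b, abs_continuous a b F) -> lint G ->
  {ae mu, forall x : R, is_derive x (1 : R) F (G x)} -> prim F G.
Proof.
move=> acF iG dF; split => // a b ab.
have [F0 pF0 _] := prim_exists 0 0 iG.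
rewrite -(pF0.2 _ _ ab); apply/eqP; rewrite -subr_eq0; apply/eqP.
have := @AC_derive0 (fun x => F x - F0 x) a b ab.
move=> h; have : F b - F0 b = F a - F0 a; last by lra.
apply: h; first by apply: AC_sub => //; exact: (prim_AC _ _ pF0).
apply: aeS (aeI dF (prim_ae_derive pF0)) => x [d1 d2].
by rewrite -(subrr (G x)); exact: is_deriveB.
Qed.

(** The product rule holds almost everywhere and is integrated by [AC_prim]. This is the integration
    by parts behind the identities for the form. *)
Lemma primM F1 G1 F2 G2 : prim F1 G1 -> prim F2 G2 ->
  prim (fun x => F1 x * F2 x) (fun x => F1 x * G2 x + F2 x * G1 x).
Proof.
move=> p1 p2; apply: AC_prim.
- move=> a b.
  have [M1 H1] := prim_bounded p1 a b; have [M2 H2] := prim_bounded p2 a b.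
  pose M := 1 + `|M1| + `|M2|.
  have M0 : 0 < M by rewrite /M; have := normr_ge0 M1; have := normr_ge0 M2; lra.
  apply: (AC_le M0 (prim_AC a b p1) (prim_AC a b p2)) => s t sab tab.
  rewrite (_ : _ - _ = F2 t * (F1 t - F1 s) + F1 s * (F2 t - F2 s)); last by ring.
  rewrite (le_trans (ler_normD _ _))// !normrM mulrDr lerD// ler_wpM2r//.
    rewrite (le_trans (H2 _ tab))// (le_trans (ler_norm _))// /M.
    by have := normr_ge0 M1; lra.
  rewrite (le_trans (H1 _ sab))// (le_trans (ler_norm _))// /M.
  by have := normr_ge0 M2; lra.
- by apply: lintD; apply: lint_contM; (exact: prim_cont p1 || exact: prim_cont p2 || exact: p1.1 || exact: p2.1).
- apply: aeS (aeI (prim_ae_derive p1) (prim_ae_derive p2)) => x [d1 d2].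
  exact: is_deriveM.
Qed.

End AbsoluteContinuity.

(** * Linear systems with locally integrable coefficients *)

Section LinearODE.
Context {R : realType}.
Local Notation mu := (@lebesgue_measure R).

Lemma le0_geometric (z D : R) : (forall k, z <= D * 2^-1 ^+ k) -> z <= 0.
Proof.
move=> H; apply/ler_addgt0Pl => e e0; rewrite addr0.
have D0 : 0 < `|D| + 1 by have := normr_ge0 D; lra.
have : (fun k => (2^-1 : R) ^+ k) @ \oo --> (0 : R).
  by apply: cvg_expr; rewrite ger0_norm ?invr_ge0// invf_lt1// ltr1n.
move=> /cvgrPdist_lt/(_ (e / (`|D| + 1)) (divr_gt0 e0 D0))[k _ /(_ k (leqnn k))].
rewrite sub0r normrN ger0_norm ?exprn_ge0// ?invr_ge0// ltr_pdivlMr// => h.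
apply: le_trans (H k) _; rewrite -[X in _ <= X](addr0 e).
have := ler_norm D; have := exprn_ge0 k (_ : 0 <= (2^-1 : R)).
rewrite invr_ge0 => /(_ (ler0n _ _)) p0 Dn.
have : D * 2^-1 ^+ k <= `|D| * 2^-1 ^+ k by rewrite ler_wpM2r.
by nra.
Qed.

(** The limit is named before the constant: [linear_ode] chooses one limit function, whose rate of
    convergence has a different constant on each bounded interval. *)
Lemma geometric_limit (u : nat -> R) (C0 : R) :
  (forall k, `|u k.+1 - u k| <= C0 * 2^-1 ^+ k) ->
  exists l : R, forall C, (forall k, `|u k.+1 - u k| <= C * 2^-1 ^+ k) ->
    forall k, `|l - u k| <= 2 * C * 2^-1 ^+ k.
Proof.
move=> H0.
have p0 k : 0 < (2^-1 : R) ^+ k by rewrite exprn_gt0// invr_gt0.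
have pS k : (2^-1 : R) ^+ k = 2 * 2^-1 ^+ k.+1 by rewrite exprS mulrA divff// mul1r.
pose S := [set `|u k.+1 - u k| / 2^-1 ^+ k | k in [set: nat]].
have hS : has_sup S.
  split; first by exists (`|u 1%N - u 0%N| / 2^-1 ^+ 0), 0%N.
  by exists C0 => _ [k _ <-]; rewrite ler_pdivrMr.
(* The least admissible constant, so that a bound with [C] implies the bound with any other [D]. *)
pose C := sup S.
have HC k : `|u k.+1 - u k| <= C * 2^-1 ^+ k.
  by rewrite -ler_pdivrMr//; apply: sup_upper_bound => //; exists k.
have Cmin D : (forall k, `|u k.+1 - u k| <= D * 2^-1 ^+ k) -> C <= D.
  move=> HD; apply: ge_sup; first by case: hS.
  by move=> _ [k _ <-]; rewrite ler_pdivrMr.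
pose v k := u k + 2 * C * 2^-1 ^+ k.
pose w k := u k - 2 * C * 2^-1 ^+ k.
have vS k : v k.+1 <= v k.
  have := HC k; rewrite ler_norml pS /v (pS k) => /andP[_ ?]; lra.
have wS k : w k <= w k.+1.
  have := HC k; rewrite ler_norml pS /w (pS k) => /andP[? _]; lra.
have C0' : 0 <= C.
  by have := HC 0%N; rewrite expr0 mulr1; apply: le_trans.
have wv k : w k <= v k.
  by rewrite /w /v lerD2l ge0_cp// mulr_ge0// ?mulr_ge0// ltW.
have vmono j k : (j <= k)%N -> v k <= v j by exact: (nonincreasing_seqP v).1.
have wmono j k : (j <= k)%N -> w j <= w k by exact: (nondecreasing_seqP w).1.
have wlev j k : w j <= v k.
  have [jk|kj] := leqP j k; first exact: le_trans (wmono _ _ jk) (wv k).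
  exact: le_trans (wv j) (vmono _ _ (ltnW kj)).
pose T := range w.
have hT : has_sup T by split; [exists (w 0%N), 0%N|exists (v 0%N) => _ [j _ <-]].
exists (sup T) => D HD k.
have h1 : w k <= sup T by apply: sup_upper_bound => //; exists k.
have h2 : sup T <= v k by apply: ge_sup; [case: hT|move=> _ [j _ <-]].
have h3 : C * 2^-1 ^+ k <= D * 2^-1 ^+ k by rewrite ler_pM2r// Cmin.
rewrite ler_norml; move: h1 h2; rewrite /w /v => h1 h2; apply/andP; split; lra.
Qed.

Lemma lint_sum (I : Type) (s : seq I) (f : I -> R -> R) :
  (forall i, lint (f i)) -> lint (fun x => \sum_(i <- s) f i x).
Proof.
move=> If; elim: s => [|i s ih].
  have -> : (fun x => \sum_(i <- [::]) f i x) = fun=> 0.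
    by apply/funext => x; rewrite big_nil.
  exact: lint_cst.
have -> : (fun x => \sum_(j <- i :: s) f j x) = fun x => f i x + \sum_(j <- s) f j x.
  by apply/funext => x; rewrite big_cons.
exact: lintD.
Qed.

Lemma C1_prim (F G : R -> R) : continuous G ->
  (forall x, is_derive x (1 : R) F (G x)) -> prim F G.
Proof.
move=> cG dF; split; first exact: lint_cont.
move=> a b; rewrite le_eqVlt => /predU1P[<-|ab]; first by rewrite itg_pt subrr.
have cF : continuous F.
  by move=> x; apply: differentiable_continuous; apply/derivable1_diffP.
rewrite /itg /Rintegral (@continuous_FTC2 _ G F a b ab)//.
- exact: continuous_subspaceT.
- split.
  + by move=> x _; case: (dF x).
  + by apply: cvg_at_right_filter; exact: cF.
  + by apply: cvg_at_left_filter; exact: cF.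
- by move=> x _; rewrite derive1E derive_val.
Qed.

Lemma prim_expR (l : R) : prim (fun x => expR (l * x)) (fun x => l * expR (l * x)).
Proof.
have d x : is_derive x (1 : R) (fun x => expR (l * x)) (l * expR (l * x)).
  have dl : is_derive x (1 : R) (fun x : R => l * x) l.
    have := is_deriveZ l (is_derive_id x (1 : R)).
    by rewrite /GRing.scale/= mulr1.
  have := @is_derive1_comp _ expR (fun x => l * x) x _ _ (is_derive_expR (l * x)) dl.
  by rewrite mulrC.
apply: C1_prim => // x.
apply: cvgM; first exact: cvg_cst.
by apply: (@continuous_comp _ _ _ ( *%R l) expR);
  [exact: mulrl_continuous|exact: continuous_expR].
Qed.

Lemma itg_expR (l C a b : R) : l != 0 -> a <= b ->
  lint (fun y => C * expR (l * y)) /\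
  itg a b (fun y => C * expR (l * y)) = C / l * (expR (l * b) - expR (l * a)).
Proof.
move=> l0 ab; have pe := primZ (C / l) (prim_expR l).
have E : (fun y => C * expR (l * y)) = (fun x => C / l * (l * expR (l * x))).
  by apply/funext => y; rewrite mulrA divfK.
by rewrite E; split; [exact: pe.1|rewrite -(pe.2 a b ab) mulrBr].
Qed.

(** * Picard iteration with an exponential weight *)

Section Picard.
Context (T : finType) (A : T -> T -> R -> R) (b : T -> R -> R) (c : T -> R).
Context (K : R).
Context (mA : forall i j, measurable_fun [set: R] (A i j)).
Context (AK : forall i j x, `|A i j x| <= K).
Context (ib : forall i, lint (b i)).

Let K0 : forall i j : T, 0 <= K.
Proof. by move=> i j; exact: le_trans (AK i j 0). Qed.

Definition ode_rhs (F : T -> R -> R) i x := \sum_j A i j x * F j x + b i x.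

Let lint_AF (F : T -> R -> R) i : (forall j, continuous (F j)) ->
  lint (fun x => \sum_j A i j x * F j x).
Proof.
move=> cF; apply: lint_sum => j; apply: lint_bounded => //; last exact: lint_cont.
by move=> *; exists K => x _.
Qed.

Let lint_rhs (F : T -> R -> R) i : (forall j, continuous (F j)) ->
  lint (ode_rhs F i).
Proof. by move=> cF; apply: lintD => //; exact: lint_AF. Qed.

Let step (F : T -> R -> R) i x : R :=
  c i + if 0 <= x then itg 0 x (ode_rhs F i) else - itg x 0 (ode_rhs F i).

Let step_prim F i : (forall j, continuous (F j)) -> prim (step F i) (ode_rhs F i).
Proof.
move=> cF; have iG := lint_rhs i cF; split => // s t st; rewrite /step.
case: (leP 0 s) => s0; first by rewrite (le_trans s0 st) (@itg_cat _ 0 s t)//; ring.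
case: (leP 0 t) => t0; first by rewrite (@itg_cat _ s 0 t)// ?ltW//; ring.
by rewrite (@itg_cat _ s t 0)// ?(ltW t0)//; ring.
Qed.

Let it k : T -> R -> R := iter k step (fun i => fun=> c i).

Let it_cont k j : continuous (it k j).
Proof.
elim: k j => [|k ih] j; first by move=> x; exact: cvg_cst.
exact: prim_cont (step_prim j ih).
Qed.

Let kap : R := #|T|%:R * K.
(** With the weight [expR (L * |x|)] a Picard step contracts by [kap / L <= 1 / 2] on intervals of
    any length; the summand 1 keeps [L] positive. *)
Let L : R := 2 * kap + 1.

Let kap0 (i : T) : 0 <= kap.
Proof. by rewrite mulr_ge0// K0. Qed.

Let AF_bound (D : T -> R -> R) B i x : (forall j, `|D j x| <= B) ->
  `|\sum_j A i j x * D j x| <= kap * B.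
Proof.
move=> DB; apply: (le_trans (ler_norm_sum _ _ _)).
apply: (@le_trans _ _ (\sum_j K * B)).
  by apply: ler_sum => j _; rewrite normrM ler_pM.
by rewrite sumr_const -mulr_natl mulrA.
Qed.

Let it_diff k i x : it k.+2 i x - it k.+1 i x =
  let D x := \sum_j A i j x * (it k.+1 j x - it k j x) in
  if 0 <= x then itg 0 x D else - itg x 0 D.
Proof.
have cF m := it_cont m; rewrite /= /step.
have E : (fun x => \sum_j A i j x * (it k.+1 j x - it k j x)) =
         (fun x => ode_rhs (it k.+1) i x - ode_rhs (it k) i x).
  apply/funext => y; rewrite /ode_rhs opprD addrACA subrr addr0 -sumrB.
  by apply: eq_bigr => j _; rewrite mulrBr.
rewrite /= /step in E *; rewrite E.
have i1 := lint_rhs i (cF k.+1); have i0 := lint_rhs i (cF k).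
by case: ifP => _; rewrite itgB//=; ring.
Qed.

Let it_bound X M k i x : (forall i x, `|x| <= X -> `|it 1 i x - it 0 i x| <= M) ->
  `|x| <= X -> `|it k.+1 i x - it k i x| <= M * expR (L * `|x|) * 2^-1 ^+ k.
Proof.
move=> HM; elim: k i x => [|k ih] i x xX.
  have M0 : 0 <= M by exact: le_trans (HM i x xX).
  rewrite expr0 mulr1 (le_trans (HM i x xX))// ler_peMr// -expR0 ler_expR mulr_ge0//.
  by have := kap0 i; rewrite /L; lra.
have k0 := kap0 i.
have M0 : 0 <= M by exact: le_trans (HM i x xX).
have p0 : 0 <= (2^-1 : R) ^+ k by rewrite exprn_ge0// invr_ge0.
have L0 : 0 < L by rewrite /L; lra.
pose D x := \sum_j A i j x * (it k.+1 j x - it k j x).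
have cD j : continuous (fun x => it k.+1 j x - it k j x).
  by move=> y; apply: cvgB; exact: it_cont.
have iD : lint D by exact: lint_AF.
have DB y : `|y| <= X -> `|D y| <= kap * M * 2^-1 ^+ k * expR (L * `|y|).
  move=> yX.
  have h := @AF_bound (fun j x => it k.+1 j x - it k j x) _ i y (fun j => ih j y yX).
  apply: le_trans h _.
  by rewrite le_eqVlt; apply/orP; left; apply/eqP; ring.
have fin : kap * M * 2^-1 ^+ k * (expR (L * `|x|) - 1) / L <=
    M * expR (L * `|x|) * 2^-1 ^+ k.+1.
  rewrite ler_pdivrMr// exprS.
  have e1 : 1 <= expR (L * `|x|) by rewrite -expR0 ler_expR mulr_ge0// ltW.
  have h : kap * (expR (L * `|x|) - 1) <= expR (L * `|x|) * 2^-1 * L.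
    by rewrite /L; nra.
  have := ler_wpM2l (mulr_ge0 M0 p0) h.
  by move=> h'; apply: le_trans (le_trans _ h') _;
    rewrite le_eqVlt; apply/orP; left; apply/eqP; ring.
have iN := lint_norm iD.
pose C := kap * M * 2^-1 ^+ k.
rewrite it_diff /= -/D; case: (leP 0 x) => x0.
  rewrite (le_trans (itg_norm _ _ iD))// (le_trans _ fin)//.
  have [ie ee] := itg_expR C (lt0r_neq0 L0) x0.
  rewrite (@le_trans _ _ (itg 0 x (fun y => C * expR (L * y))))//.
    apply: le_itg => // y /andP[y0 yx]; rewrite -{2}(ger0_norm y0).
    by apply: DB; rewrite ger0_norm// (le_trans yx)// (le_trans (ler_norm _) xX).
  by rewrite ee mulr0 expR0 ger0_norm// /C le_eqVlt; apply/orP; left; apply/eqP; ring.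
rewrite normrN (le_trans (itg_norm _ _ iD))// (le_trans _ fin)//.
have NL0 : - L != 0 by rewrite oppr_eq0 lt0r_neq0.
have [ie ee] := itg_expR C NL0 (ltW x0).
rewrite (@le_trans _ _ (itg x 0 (fun y => C * expR (- L * y))))//.
  apply: le_itg => // y /andP[xy y0].
  rewrite mulNr -mulrN -(ler0_norm y0).
  by apply: DB; rewrite (le_trans _ xX)// ler0_norm// ltr0_norm// lerN2.
rewrite ee mulr0 expR0 ltr0_norm// mulNr -mulrN invrN /C.
by rewrite le_eqVlt; apply/orP; left; apply/eqP; ring.
Qed.

Lemma linear_ode : exists F : T -> R -> R,
  forall i, prim (F i) (ode_rhs F i) /\ F i 0 = c i.
Proof.
have p0 k : 0 < (2^-1 : R) ^+ k by rewrite exprn_gt0// invr_gt0.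
have HM X : exists2 M, 0 <= M & forall i x, `|x| <= X -> `|it 1 i x - it 0 i x| <= M.
  have H i : exists M, forall x, - X <= x <= X -> `|it 1 i x - it 0 i x| <= M.
    apply: (@cont_bounded _ (fun x => it 1 i x - it 0 i x)) => y.
    by apply: cvgB; exact: it_cont.
  have [M HM] := choice H.
  exists (\sum_i `|M i|); first exact: sumr_ge0.
  move=> i x; rewrite ler_norml => /(HM i) /le_trans; apply.
  rewrite (bigD1 i)//= (le_trans (ler_norm _))// lerDl; exact: sumr_ge0.
have HC (Y : R) : exists2 C, 0 <= C & forall k i x, `|x| <= Y ->
    `|it k.+1 i x - it k i x| <= C * 2^-1 ^+ k.
  have [M M0 H] := HM Y; exists (M * expR (`|L| * `|Y|)).
    by rewrite mulr_ge0// expR_ge0.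
  move=> k i x xX; apply: le_trans (it_bound k i H xX) _.
  rewrite ler_pM2r// ler_wpM2l// ler_expR (le_trans (ler_norm _))// normrM.
  by rewrite ler_pM// normr_id (le_trans xX)// ler_norm.
have H (ix : T * R) : exists l : R, forall C,
    (forall k, `|it k.+1 ix.1 ix.2 - it k ix.1 ix.2| <= C * 2^-1 ^+ k) ->
    forall k, `|l - it k ix.1 ix.2| <= 2 * C * 2^-1 ^+ k.
  have [C _ Hk] := HC `|ix.2|.
  exact: (@geometric_limit (fun k => it k ix.1 ix.2) C (fun k => Hk k ix.1 ix.2 (lexx _))).
have [f Hf] := choice H; pose F i x := f (i, x).
have HF X : exists2 C, 0 <= C & forall k i x, `|x| <= X ->
    `|F i x - it k i x| <= C * 2^-1 ^+ k.
  have [C C0 Hk] := HC X; exists (2 * C); first by rewrite mulr_ge0.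
  by move=> k i x xX; apply: (Hf (i, x) C) => m; exact: Hk.
have cF i : continuous (F i).
  move=> x; apply/cvgrPdist_lt => e e0.
  have [C C0 Hk] := HF (`|x| + 1).
  have [k Ck] : exists k, C * 2^-1 ^+ k < e / 3.
    apply: contrapT => h.
    have : e / 3 <= 0 by apply: (@le0_geometric _ C) => k; rewrite leNgt; apply/negP => h'; apply: h; exists k.
    by lra.
  have e3 : 0 < e / 3 by lra.
  have /cvgrPdist_lt/(_ _ e3) ck := @it_cont k i x.
  near=> y.
  have xy1 : `|x - y| < 1 by near: y; exact: (@nbhsx_ballx _ R).
  have h1 : `|it k i x - it k i y| < e / 3 by near: y.
  have h2 : `|F i x - it k i x| <= C * 2^-1 ^+ k by apply: Hk; rewrite lerDl.
  have h3 : `|F i y - it k i y| <= C * 2^-1 ^+ k.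
    apply: Hk; rewrite -{1}(subrK x y) (le_trans (ler_normD _ _))// addrC lerD2l distrC ltW//.
  have -> : F i x - F i y = (F i x - it k i x) + (it k i x - it k i y) - (F i y - it k i y) by ring.
  apply: le_lt_trans (ler_normB _ _) _.
  have := ler_normD (F i x - it k i x) (it k i x - it k i y).
  by lra.
have iG i := lint_rhs i cF.
exists F => i; split.
  split => // s t st.
  pose X := Num.max `|s| `|t|.
  have Xx x : s <= x <= t -> `|x| <= X.
    move=> /andP[sx xt]; rewrite ler_norml /X; apply/andP; split.
      by rewrite lerNl (le_trans (_ : _ <= - s)) ?lerN2// le_max ler_normr lexx orbT.
    by rewrite (le_trans xt)// le_max ler_norm orbT.
  have [C C0 Hk] := HF X.
  apply/eqP; rewrite -subr_eq0 -normr_le0.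
  apply: (@le0_geometric _ (C + C + kap * C * (t - s))) => k.
  have hs : `|F i s - it k.+1 i s| <= C * 2^-1 ^+ k.+1 by apply: Hk; apply: Xx; rewrite lexx.
  have ht : `|F i t - it k.+1 i t| <= C * 2^-1 ^+ k.+1 by apply: Hk; apply: Xx; rewrite lexx andbT.
  have pk := (step_prim i (@it_cont k)).2 s t st.
  have hp : C * 2^-1 ^+ k.+1 <= C * 2^-1 ^+ k.
    by rewrite ler_wpM2l// exprS ler_piMl// ?(ltW (p0 _))// invf_le1// ler1n.
  have E : F i t - F i s - itg s t (ode_rhs F i) =
     (F i t - it k.+1 i t) - (F i s - it k.+1 i s)
       - itg s t (fun x => \sum_j A i j x * (F j x - it k j x)).
    have -> : (fun x => \sum_j A i j x * (F j x - it k j x)) =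
         (fun x => ode_rhs F i x - ode_rhs (it k) i x).
      apply/funext => y; rewrite /ode_rhs opprD addrACA subrr addr0 -sumrB.
      by apply: eq_bigr => j _; rewrite mulrBr.
    rewrite itgB//; last exact: (lint_rhs i (@it_cont k)).
    by rewrite -pk /=; ring.
  have hi : `|itg s t (fun x => \sum_j A i j x * (F j x - it k j x))| <=
      kap * (C * 2^-1 ^+ k) * (t - s).
    have iAF : lint (fun x => \sum_j A i j x * (F j x - it k j x)).
      by apply: (@lint_AF (fun j x => F j x - it k j x)) => j y; apply: cvgB; [exact: cF|exact: it_cont].
    rewrite (le_trans (itg_norm _ _ iAF))// -itg_cst//.
    apply: le_itg; [exact: lint_norm|exact: lint_cst|move=> x xst].
    by apply: (@AF_bound (fun j x => F j x - it k j x)) => j; apply: Hk; exact: Xx.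
  rewrite E (le_trans (ler_normB _ _))//.
  have := ler_normB (F i t - it k.+1 i t) (F i s - it k.+1 i s).
  have -> : (C + C + kap * C * (t - s)) * 2^-1 ^+ k =
    C * 2^-1 ^+ k + C * 2^-1 ^+ k + kap * (C * 2^-1 ^+ k) * (t - s) by ring.
  by move=> h; apply: lerD => //; apply: (le_trans h); apply: lerD; apply: le_trans hp.
have it0 k : it k i 0 = c i.
  by case: k => // k; rewrite /= /step lexx itg_pt addr0.
have [C C0 Hk] := HF 0.
apply/eqP; rewrite -subr_eq0 -normr_le0; apply: (@le0_geometric _ C) => k.
by rewrite -(it0 k); apply: Hk; rewrite normr0.
Unshelve. all: by end_near. Qed.

End Picard.

End LinearODE.

(** * Canonical systems *)

Section LineIntegral.
Context {R : realType}.
Local Notation mu := (@lebesgue_measure R).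
Implicit Types (F G Z : R -> R) (a b c : R).

Definition iR G := measurable_fun [set: R] G /\ mu.-integrable [set: R] (EFin \o G).
Definition IR G : R := \int[mu]_x G x.

Lemma iR_lint G : iR G -> lint G.
Proof. by move=> [mG iG]; split => // a b; exact: integrableS iG. Qed.

Lemma iRD F G : iR F -> iR G -> iR (fun x => F x + G x).
Proof.
move=> [mF iF] [mG iG]; split; first exact: measurable_funD.
by apply: eq_integrable (integrableD _ iF iG).
Qed.

Lemma iRZ c G : iR G -> iR (fun x => c * G x).
Proof.
move=> [mG iG]; split; first exact: measurable_funM.
by apply: eq_integrable (integrableZl _ c iG).
Qed.

Lemma iRN G : iR G -> iR (fun x => - G x).
Proof.
by move=> /(iRZ (-1)); congr iR; apply/funext => x; rewrite mulN1r.
Qed.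

Lemma iRB F G : iR F -> iR G -> iR (fun x => F x - G x).
Proof. by move=> iF /iRN; exact: iRD. Qed.

Lemma iR_norm G : iR G -> iR (fun x => `|G x|).
Proof.
move=> [mG iG]; split; first exact: measurableT_comp.
exact: integrable_norm.
Qed.

Lemma iR_le F G : measurable_fun [set: R] F -> iR G ->
  (forall x, `|F x| <= G x) -> iR F.
Proof.
move=> mF [mG iG] FG; split => //.
apply: le_integrable iG => //; first exact/measurable_EFinP.
by move=> x _ /=; rewrite lee_fin (le_trans (FG x))// ler_norm.
Qed.

Lemma IRD F G : iR F -> iR G -> IR (fun x => F x + G x) = IR F + IR G.
Proof. by move=> [_ iF] [_ iG]; rewrite /IR RintegralD. Qed.

Lemma IRZ c G : iR G -> IR (fun x => c * G x) = c * IR G.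
Proof. by move=> [_ iG]; rewrite /IR RintegralZl. Qed.

Lemma IRN G : iR G -> IR (fun x => - G x) = - IR G.
Proof.
move=> iG; rewrite -mulN1r -IRZ//; congr IR.
by apply/funext => x; rewrite mulN1r.
Qed.

Lemma IRB F G : iR F -> iR G -> IR (fun x => F x - G x) = IR F - IR G.
Proof. by move=> iF iG; rewrite IRD ?IRN//; exact: iRN. Qed.

Lemma IR_ge0 G : (forall x, 0 <= G x) -> 0 <= IR G.
Proof. by move=> G0; apply: Rintegral_ge0 => x _; exact: G0. Qed.

Lemma IR_le F G : iR F -> iR G -> (forall x, F x <= G x) -> IR F <= IR G.
Proof. by move=> iF iG FG; rewrite -subr_ge0 -IRB// IR_ge0// => x; rewrite subr_ge0. Qed.

Lemma ae_IR F G : measurable_fun [set: R] F -> measurable_fun [set: R] G ->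
  {ae mu, forall x : R, F x = G x} -> IR F = IR G.
Proof.
move=> mF mG FG; rewrite /IR /Rintegral; congr fine.
apply: ae_eq_integral => //; [exact/measurable_EFinP|exact/measurable_EFinP|].
by apply: aeS FG => x /= -> _.
Qed.

Lemma ae_iR F G : measurable_fun [set: R] F -> iR G ->
  {ae mu, forall x : R, F x = G x} -> iR F.
Proof.
move=> mF [mG iG] FG; split => //.
apply/integrableP; split; first exact/measurable_EFinP.
have /integrableP[_] := iG; apply: le_lt_trans.
rewrite le_eqVlt; apply/orP; left; apply/eqP; apply: ae_eq_integral => //.
- by apply: measurableT_comp => //; exact/measurable_EFinP.
- by apply: measurableT_comp => //; exact/measurable_EFinP.
- by apply: aeS FG => x /= -> _.
Qed.

Lemma IR_fin G : iR G -> (\int[mu]_x (G x)%:E = (IR G)%:E)%E.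
Proof. by move=> [_ iG]; rewrite /IR /Rintegral fineK//; exact: integrable_fin_num. Qed.

Lemma IR_eq0 G : iR G -> (forall x, 0 <= G x) -> IR G = 0 ->
  {ae mu, forall x : R, G x = 0}.
Proof.
move=> iG G0 IG0; have mG := iG.1.
have : (\int[mu]_x `|(G x)%:E|)%E = 0%E.
  under eq_integral => x _ do rewrite gee0_abs ?lee_fin//.
  by rewrite IR_fin// IG0.
have mE : measurable_fun [set: R] (EFin \o G) by exact/measurable_EFinP.
move=> /(ae_eq_integral_abs mu measurableT mE); apply: aeS => x /(_ Logic.I)/=.
by case.
Qed.

Lemma IR_abs_tail G : iR G -> (forall x, 0 <= G x) -> forall e, 0 < e ->
  exists2 N, 0 <= N & forall a b, a <= - N -> N <= b -> IR G - e <= itg a b G <= IR G.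
Proof.
move=> [mG iG] G0 e e0.
have mE : measurable_fun [set: R] (EFin \o G) by exact/measurable_EFinP.
pose S (n : nat) : set R := `[- n%:R, n%:R]%classic.
have US : \bigcup_n S n = setT.
  apply/seteqP; split => // x _; exists (Num.truncn `|x|).+1 => //.
  rewrite /S/= in_itv/= -ler_norml; apply/ltW; exact: Num.Theory.truncnS_gt.
have cv : (\int[mu]_(x in S i) (G x)%:E @[i --> \oo] --> \int[mu]_(x in \bigcup_i S i) (G x)%:E)%E.
  apply: ge0_nondecreasing_set_cvg_integral.
  - apply/nondecreasing_seqP => n; rewrite subsetEset => x; rewrite /S/= !in_itv/= => /andP[h1 h2].
    by rewrite (le_trans _ h1) ?(le_trans h2)// ?lerN2 ler_nat.
  - by move=> i; exact: measurable_itv.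
  - by move=> i; apply: measurable_funTS.
  - by move=> i x _; rewrite lee_fin.
have leI a b : itg a b G <= IR G.
  rewrite -lee_fin /itg /IR /Rintegral !fineK; last 2 first.
  - exact: integrable_fin_num.
  - by apply: integrable_fin_num => //; exact: integrableS iG.
  by apply: ge0_subset_integral => // x _; rewrite lee_fin.
rewrite US in cv.
rewrite IR_fin// in cv.
have cv' : itg (- n%:R) n%:R G @[n --> \oo] --> IR G by exact: (fine_cvg cv).
move/cvgrPdist_le: cv' => /(_ _ e0)[n _ /(_ n (leqnn n))].
move=> /= Hn.
exists n%:R => // a b an nb; rewrite leI andbT.
have iL : lint G by apply: iR_lint.
have nn : (- n%:R : R) <= n%:R by rewrite lerNl (le_trans _ (ler0n _ _))// lerNl oppr0.
have := itg_cat iL an (le_trans nn nb); have := itg_cat iL nn nb.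
have h1 : 0 <= itg a (- n%:R) G by apply: itg_ge0.
have h2 : 0 <= itg n%:R b G by apply: itg_ge0.
move: Hn; rewrite ler_norml => /andP[_ +]; move: h1 h2; clear; lra.
Qed.

(** [G] is the difference of the non-negative functions [|G| + G] and [|G|], to which monotone
    convergence applies. *)
Lemma IR_tail G : iR G -> forall e, 0 < e ->
  exists2 N, 0 <= N & forall a b, a <= - N -> N <= b -> `|IR G - itg a b G| <= e.
Proof.
move=> iG e e0; have iN := iR_norm iG; have iA := iRD iN iG.
have A0 x : 0 <= `|G x| + G x by have := ler_norm (- G x); rewrite normrN; lra.
have [N N0 HN] := IR_abs_tail iN (fun x => normr_ge0 _) e0.
have [M M0 HM] := IR_abs_tail iA A0 e0.
exists (Num.max N M); first by rewrite le_max N0.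
move=> a b; rewrite lerNr !ge_max lerNr => /andP[aN aM] /andP[Nb Mb].
rewrite lerNr in aM.
have := HN a b aN Nb; have := HM a b aM Mb.
rewrite IRD// itgD; try exact: iR_lint.
by move=> /andP[? ?] /andP[? ?]; rewrite ler_norml; apply/andP; split; lra.
Qed.

Lemma iR_itg G C : lint G -> (forall x, 0 <= G x) ->
  (forall n : nat, itg (- n%:R) n%:R G <= C) -> iR G /\ IR G <= C.
Proof.
move=> [mG iG] G0 GC.
have mE : measurable_fun [set: R] (EFin \o G) by exact/measurable_EFinP.
pose S (n : nat) : set R := `[- n%:R, n%:R]%classic.
have US : \bigcup_n S n = setT.
  apply/seteqP; split => // x _; exists (Num.truncn `|x|).+1 => //.
  rewrite /S/= in_itv/= -ler_norml; apply/ltW; exact: Num.Theory.truncnS_gt.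
have cv : (\int[mu]_(x in S i) (G x)%:E @[i --> \oo] --> \int[mu]_(x in \bigcup_i S i) (G x)%:E)%E.
  apply: ge0_nondecreasing_set_cvg_integral.
  - apply/nondecreasing_seqP => n; rewrite subsetEset => x; rewrite /S/= !in_itv/= => /andP[h1 h2].
    by rewrite (le_trans _ h1) ?(le_trans h2)// ?lerN2 ler_nat.
  - by move=> i; exact: measurable_itv.
  - by move=> i; apply: measurable_funTS.
  - by move=> i x _; rewrite lee_fin.
rewrite US in cv.
have IC : (\int[mu]_x (G x)%:E <= C%:E)%E.
  rewrite -(cvg_lim _ cv)//; apply: lime_le; first exact: (cvgP _ cv).
  apply: nearW => n.
  by rewrite -[X in (X <= _)%E]fineK ?lee_fin; [exact: GC|
    by apply: integrable_fin_num; [exact: measurable_itv|exact: iG]].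
have iRG : iR G.
  split => //; apply/integrableP; split => //.
  under eq_integral => x _ do rewrite /= ger0_norm//.
  exact: le_lt_trans IC (ltry _).
by split => //; rewrite -lee_fin -IR_fin.
Qed.

(** If [(1 + 2 X) * Z x >= e] held at all distances from [X] to [2 X] on one side, the integral
    there would be at least [e X / (1 + 2 X) >= e / 3], more than the [e / 4] left by the tail. The
    weight [1 + |x|] is the growth rate of squared solutions. *)
Lemma iR_decay Z : iR Z -> (forall x, 0 <= Z x) -> forall N e, 0 < e ->
  exists a b, [/\ a <= - N, N <= b, (1 - a) * Z a < e & (1 + b) * Z b < e].
Proof.
move=> iZ Z0 N e e0; have iL := iR_lint iZ.
have e8 : 0 < e / 8 by lra.
have [M M0 HM] := IR_tail iZ e8.
pose X := 1 + `|N| + M.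
have X1 : 1 <= X by rewrite /X; have := normr_ge0 N; lra.
have MX : M <= X by rewrite /X; have := normr_ge0 N; lra.
have NX : N <= X by rewrite /X; have := ler_norm N; lra.
clearbody X; have MX2 : M <= 2 * X by lra.
have lX1 : - (2 * X) <= - X by lra.
have lX2 : - X <= X by lra.
have lX3 : X <= 2 * X by lra.
have lM1 : - X <= - M by lra.
have lM2 : - (2 * X) <= - M by lra.
have small s t : `|itg s t Z| <= e / 4 -> t = s + X ->
    exists2 x, s <= x <= t & (1 + 2 * X) * Z x < e.
  move=> + ts; rewrite {t}ts => sm; apply: contrapT => h.
  have h' x : s <= x <= s + X -> e / (1 + 2 * X) <= Z x.
    move=> xs; rewrite ler_pdivrMr; last by lra.
    by rewrite mulrC leNgt; apply/negP => h''; apply: h; exists x.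
  have sX : s <= s + X by lra.
  have := le_itg (lint_cst (e / (1 + 2 * X))) iL h'.
  rewrite itg_cst// => h2.
  have : e / 3 <= e / (1 + 2 * X) * (s + X - s).
    have -> : s + X - s = X by ring.
    rewrite mulrAC ler_pdivlMr; last by lra.
    by nra.
  move=> /le_trans/(_ h2) h3.
  by move: sm; rewrite ler_norml => /andP[_ sm]; have := le_trans h3 sm; clear -e0; lra.
have hL : itg (- (2 * X)) X Z = itg (- (2 * X)) (- X) Z + itg (- X) X Z by exact: itg_cat.
have hR : itg (- X) (2 * X) Z = itg (- X) X Z + itg X (2 * X) Z by exact: itg_cat.
have H1 := HM _ _ lM1 MX; have H2 := HM _ _ lM2 MX; have H3 := HM _ _ lM1 MX2.
move: H1 H2 H3; rewrite hL hR !ler_norml => /andP[l1 u1] /andP[l2 u2] /andP[l3 u3].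
have [a /andP[a1 a2] Ha] : exists2 x, - (2 * X) <= x <= - X & (1 + 2 * X) * Z x < e.
  by apply: small; [rewrite ler_norml; apply/andP; clear -l1 u1 l2 u2 l3 u3; split; lra|ring].
have [b /andP[b1 b2] Hb] : exists2 x, X <= x <= 2 * X & (1 + 2 * X) * Z x < e.
  by apply: small; [rewrite ler_norml; apply/andP; clear -l1 u1 l2 u2 l3 u3; split; lra|ring].
clear -lM1 NX a1 a2 b1 b2 Ha Hb Z0; exists a, b; split; [lra|lra| |].
  by apply: le_lt_trans Ha; rewrite ler_wpM2r//; lra.
by apply: le_lt_trans Hb; rewrite ler_wpM2r//; lra.
Qed.

(** Cauchy-Schwarz as positivity of a variance: [(Y - t)^2 >= 0] is integrated with [t] the mean of
    [Y]. *)
Lemma itg_sqr Y Z a b : a <= b -> lint Y -> lint Z ->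
  (forall x, a <= x <= b -> Y x ^+ 2 <= Z x) ->
  itg a b Y ^+ 2 <= (b - a) * itg a b Z.
Proof.
move=> ab iY iZ YZ.
have [->|nab] := eqVneq a b; first by rewrite itg_pt expr0n subrr mul0r.
have ba : 0 < b - a by rewrite subr_gt0 lt_neqAle nab.
pose t := itg a b Y / (b - a).
have : 0 <= itg a b (fun x => Z x - 2 * t * Y x + t ^+ 2).
  by apply: itg_ge0 => x /YZ; have := sqr_ge0 (Y x - t); lra.
have i1 := lintZ (2 * t) iY.
rewrite itgD; [|exact: lintB|exact: lint_cst].
rewrite itgB// itgZ// itg_cst// => h.
have -> : itg a b Y = t * (b - a) by rewrite /t divfK// lt0r_neq0.
have e1 : itg a b Y = t * (b - a) by rewrite /t divfK// lt0r_neq0.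
by rewrite e1 in h; nra.
Qed.

Lemma itg_le_IR (Z : R -> R) a b : iR Z -> (forall x, 0 <= Z x) -> itg a b Z <= IR Z.
Proof.
move=> iZ Z0; apply/ler_addgt0Pl => e e0.
have [N N0 HN] := IR_tail iZ e0.
have [ab|ba] := leP a b; last first.
  rewrite [X in X <= _](_ : _ = 0); first by rewrite addr_ge0 ?IR_ge0// ltW.
  by rewrite /itg set_itv_ge ?Rintegral_set0// bnd_simp -ltNge.
have iL := iR_lint iZ.
pose a' := Num.min a (- N); pose b' := Num.max b N.
have a'a : a' <= a by rewrite ge_min lexx.
have a'N : a' <= - N by rewrite ge_min lexx orbT.
have bb' : b <= b' by rewrite le_max lexx.
have Nb' : N <= b' by rewrite le_max lexx orbT.
have := HN a' b' a'N Nb'.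
rewrite (itg_cat iL a'a (le_trans ab bb')) (itg_cat iL ab bb').
have h1 : 0 <= itg a' a Z by apply: itg_ge0.
have h2 : 0 <= itg b b' Z by apply: itg_ge0.
by rewrite ler_norml => /andP[? _]; lra.
Qed.

End LineIntegral.

(** * The real system: form, Wronskian and behaviour at infinity *)

Section System.
Context {R : realType}.
Local Notation mu := (@lebesgue_measure R).

(* In [rvec] the index [false] is the upper component; in [cvec] the outer index
   [false] is the real part and [true] the imaginary part. *)
Definition rvec := bool -> R -> R.
Definition cvec := bool -> rvec.

Definition rlin (t : R) (f g : rvec) : rvec := fun c x => f c x + t * g c x.
Definition clin (t : R) (F G : cvec) : cvec := fun k => rlin t (F k) (G k).

Context (p q r : R -> R).
Implicit Types (f g h k : rvec) (F G : cvec).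

(* [p], [q], [r] are the entries of [H = [[p, q], [q, r]]]. *)
Definition Q f g (x : R) : R :=
  p x * (f false x * g false x) +
  q x * (f false x * g true x + f true x * g false x) +
  r x * (f true x * g true x).

(* [J f' = - H g] solved for [f']. *)
Definition solves f g :=
  prim (f false) (fun x => - (q x * g false x + r x * g true x)) /\
  prim (f true) (fun x => p x * g false x + q x * g true x).

Definition L2r f := (forall c, measurable_fun [set: R] (f c)) /\ iR (Q f f).

Lemma Q_lin t f g h x : Q (rlin t f g) h x = Q f h x + t * Q g h x.
Proof. by rewrite /Q /rlin; ring. Qed.

Lemma Q_sym f g x : Q f g x = Q g f x.
Proof. by rewrite /Q; ring. Qed.

Lemma Q_lin2 t f g x :
  Q (rlin t f g) (rlin t f g) x = Q f f x + 2 * t * Q f g x + t ^+ 2 * Q g g x.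
Proof. by rewrite /Q /rlin; ring. Qed.

Lemma solves_lin t f g h k : solves f g -> solves h k ->
  solves (rlin t f h) (rlin t g k).
Proof.
move=> [f0 f1] [h0 h1]; split.
  apply: (eq_prim (primD f0 (primZ t h0))) => x //; rewrite /rlin; ring.
apply: (eq_prim (primD f1 (primZ t h1))) => x //; rewrite /rlin; ring.
Qed.

Definition wronskian f h (x : R) := f false x * h true x - f true x * h false x.

(** Lagrange's identity: the boundary values of the Wronskian measure the failure of symmetry. *)
Lemma prim_wronskian f g h k : solves f g -> solves h k ->
  prim (wronskian f h) (fun x => Q f k x - Q g h x).
Proof.
move=> [f0 f1] [h0 h1].
apply: (eq_prim (primB (primM f0 h1) (primM f1 h0))) => x //.
by rewrite /Q; ring.
Qed.

(** The conditions hold at every point and not only almost everywhere; [coefficient_representative]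
    arranges this by changing [H] on a null set. *)
Record coeff : Prop := Coeff {
  coeff_mp : measurable_fun [set: R] p;
  coeff_mq : measurable_fun [set: R] q;
  coeff_mr : measurable_fun [set: R] r;
  coeff_p : forall x, 0 <= p x;
  coeff_r : forall x, 0 <= r x;
  coeff_tr : forall x, p x + r x = 1;
  coeff_det : forall x, q x ^+ 2 <= p x * r x }.

Context (Hc : coeff).
Let mp := coeff_mp Hc.
Let mq := coeff_mq Hc.
Let mr := coeff_mr Hc.
Let p_ge0 := coeff_p Hc.
Let r_ge0 := coeff_r Hc.
Let tr1 := coeff_tr Hc.
Let det_ge0 := coeff_det Hc.

Lemma q_bound x : `|q x| <= 1.
Proof.
have := det_ge0 x; have := tr1 x; have := p_ge0 x; have := r_ge0 x => r0 p0 t d.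
have : q x ^+ 2 <= 1 by nra.
by rewrite -real_normK ?num_real// expr_le1.
Qed.

Lemma p_bound x : `|p x| <= 1.
Proof. by rewrite ger0_norm//; have := tr1 x; have := r_ge0 x; lra. Qed.

Lemma r_bound x : `|r x| <= 1.
Proof. by rewrite ger0_norm//; have := tr1 x; have := p_ge0 x; lra. Qed.

(** With trace 1, Cayley-Hamilton reads [H = H^2 + det H], so the form at [v] is
    [|H v|^2 + det H |v|^2]. [Hg_bound] rests on the same identity. *)
Lemma form_ge0 x (a b : R) : 0 <= p x * a ^+ 2 + 2 * q x * a * b + r x * b ^+ 2.
Proof.
have d := det_ge0 x; have p0 := p_ge0 x; have r0 := r_ge0 x; have t := tr1 x.
have -> : p x * a ^+ 2 + 2 * q x * a * b + r x * b ^+ 2 =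
  (p x * a + q x * b) ^+ 2 + (q x * a + r x * b) ^+ 2 +
  (p x * r x - q x ^+ 2) * (a ^+ 2 + b ^+ 2).
  have -> : r x = 1 - p x by lra.
  by ring.
have : 0 <= (p x * r x - q x ^+ 2) * (a ^+ 2 + b ^+ 2).
  by rewrite mulr_ge0 ?subr_ge0// addr_ge0// sqr_ge0.
by have := sqr_ge0 (p x * a + q x * b); have := sqr_ge0 (q x * a + r x * b); lra.
Qed.

Lemma Q_ge0 f x : 0 <= Q f f x.
Proof.
have := form_ge0 x (f false x) (f true x); rewrite /Q => h.
by apply: le_trans h _; rewrite le_eqVlt; apply/orP; left; apply/eqP; ring.
Qed.

Lemma Q_norm f g x : `|Q f g x| <= Q f f x + Q g g x.
Proof.
have h1 := Q_ge0 (rlin 1 f g) x; have h2 := Q_ge0 (rlin (-1) f g) x.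
rewrite !Q_lin2 in h1 h2; have := Q_ge0 f x; have := Q_ge0 g x.
by rewrite ler_norml => ? ?; apply/andP; split; lra.
Qed.

(** Cauchy-Schwarz for a possibly degenerate form; the defect is [det H] times the squared
    Wronskian. *)
Lemma Q_zero f g x : Q f f x = 0 -> Q f g x = 0.
Proof.
move=> f0; have : Q f g x ^+ 2 <= Q f f x * Q g g x.
  rewrite -subr_ge0 (_ : _ - _ = (p x * r x - q x ^+ 2) *
     (f false x * g true x - f true x * g false x) ^+ 2); last by rewrite /Q; ring.
  by rewrite mulr_ge0 ?sqr_ge0// subr_ge0.
by rewrite f0 mul0r => h; apply/eqP; rewrite -sqrf_eq0 eq_le h sqr_ge0.
Qed.

Lemma Hg_bound g x :
  (q x * g false x + r x * g true x) ^+ 2 + (p x * g false x + q x * g true x) ^+ 2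
    <= Q g g x.
Proof.
rewrite -subr_ge0; have d := det_ge0 x; have t := tr1 x.
rewrite (_ : _ - _ = (p x * r x - q x ^+ 2) * (g false x ^+ 2 + g true x ^+ 2)).
  by rewrite mulr_ge0 ?subr_ge0// addr_ge0// sqr_ge0.
rewrite /Q; have -> : r x = 1 - p x by lra.
by ring.
Qed.

(** The two combinations of [f] and [h] that cancel one component have the other equal to plus or
    minus the Wronskian [W]. Their forms are [p W^2] and [r W^2], and sum to [W^2] by trace 1. Thus
    small forms make [W] small even where [H] is singular. *)
Lemma wronskian_bound f h x :
  wronskian f h x ^+ 2 <=
  (f false x ^+ 2 + f true x ^+ 2 + h false x ^+ 2 + h true x ^+ 2) * (Q f f x + Q h h x).
Proof.
have key (a b : R) : let u : rvec := fun c x => a * f c x + b * h c x in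
    Q u u x <= (a ^+ 2 + b ^+ 2) * (Q f f x + Q h h x).
  have /= h0 := Q_ge0 (fun c x => b * f c x - a * h c x) x.
  rewrite /= -subr_ge0; apply: le_trans h0 _.
  by rewrite le_eqVlt; apply/orP; left; apply/eqP; rewrite /Q; ring.
have k1 := key (h true x) (- f true x); have k2 := key (h false x) (- f false x).
have : wronskian f h x ^+ 2 = Q (fun c y => h true x * f c y + - f true x * h c y)
     (fun c y => h true x * f c y + - f true x * h c y) x +
   Q (fun c y => h false x * f c y + - f false x * h c y)
     (fun c y => h false x * f c y + - f false x * h c y) x.
  rewrite /Q /wronskian.
  rewrite -[LHS]mul1r -(tr1 x); ring.
move=> ->; apply: le_trans (lerD k1 k2) _.
by rewrite le_eqVlt; apply/orP; left; apply/eqP; ring.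
Qed.

Lemma measurable_Q f g : (forall c, measurable_fun [set: R] (f c)) ->
  (forall c, measurable_fun [set: R] (g c)) -> measurable_fun [set: R] (Q f g).
Proof.
move=> mf mg; rewrite /Q.
by repeat apply: measurable_funD || apply: measurable_funM => //.
Qed.

Lemma iR_Q f g : L2r f -> L2r g -> iR (Q f g).
Proof.
move=> [mf iF] [mg iG]; apply: (iR_le _ (iRD iF iG)); first exact: measurable_Q.
exact: Q_norm.
Qed.

Lemma L2r_lin t f g : L2r f -> L2r g -> L2r (rlin t f g).
Proof.
move=> lf lg; have iFG := iR_Q lf lg; split.
  by move=> c; apply: measurable_funD; [exact: lf.1|apply: measurable_funM => //; exact: lg.1].
have -> : Q (rlin t f g) (rlin t f g) =
  (fun x => Q f f x + 2 * t * Q f g x + t ^+ 2 * Q g g x).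
  by apply/funext => x; exact: Q_lin2.
by apply: iRD; [apply: iRD; [exact: lf.2|exact: iRZ]|apply: iRZ; exact: lg.2].
Qed.

Lemma lint_Hg g : (forall c, measurable_fun [set: R] (g c)) -> lint (Q g g) ->
  lint (fun x => q x * g false x + r x * g true x) /\
  lint (fun x => p x * g false x + q x * g true x).
Proof.
move=> mg iG; have i1 := lintD (lint_cst (1 : R)) iG.
have aux (y z : R) : y ^+ 2 <= z -> `|y| <= 1 + z.
  move=> yz; rewrite ler_norml.
  have := sqr_ge0 (y - 1); have := sqr_ge0 (y + 1); have := sqr_ge0 y => h1 h2 h3.
  by apply/andP; split; nra.
split; apply: (lint_le _ i1).
- by apply: measurable_funD; apply: measurable_funM.
- move=> x; apply: aux; apply: le_trans (Hg_bound g x); rewrite lerDl; exact: sqr_ge0.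
- by apply: measurable_funD; apply: measurable_funM.
- move=> x; apply: aux; apply: le_trans (Hg_bound g x); rewrite lerDr; exact: sqr_ge0.
Qed.

Lemma solves_dist f g (a b : R) : (forall c, measurable_fun [set: R] (g c)) ->
  lint (Q g g) -> solves f g -> a <= b ->
  (f false b - f false a) ^+ 2 + (f true b - f true a) ^+ 2 <=
    2 * (b - a) * itg a b (Q g g).
Proof.
move=> mg iG [f0 f1] ab.
have [i0 i1] := lint_Hg mg iG.
rewrite (f0.2 _ _ ab) (f1.2 _ _ ab).
have h0 : itg a b (fun x => - (q x * g false x + r x * g true x)) ^+ 2 <= (b - a) * itg a b (Q g g).
  apply: itg_sqr => //; first exact: lintN.
  by move=> x _; rewrite sqrrN; apply: le_trans (Hg_bound g x); rewrite lerDl; exact: sqr_ge0.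
have h1 : itg a b (fun x => p x * g false x + q x * g true x) ^+ 2 <= (b - a) * itg a b (Q g g).
  apply: itg_sqr => //.
  by move=> x _; apply: le_trans (Hg_bound g x); rewrite lerDr; exact: sqr_ge0.
lra.
Qed.

Lemma solves_growth f g : L2r g -> solves f g -> exists2 C, 0 <= C &
  forall x, f false x ^+ 2 + f true x ^+ 2 <= C * (1 + `|x|).
Proof.
move=> lg sf; have iG := iR_lint lg.2.
have I0 : 0 <= IR (Q g g) by apply: IR_ge0 => x; exact: Q_ge0.
pose c := f false 0 ^+ 2 + f true 0 ^+ 2.
have c0 : 0 <= c by rewrite addr_ge0// sqr_ge0.
exists (2 * c + 4 * IR (Q g g)); first by lra.
move=> x.
have D : (f false x - f false 0) ^+ 2 + (f true x - f true 0) ^+ 2 <= 2 * `|x| * IR (Q g g).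
  have [x0|x0] := leP 0 x.
    have := solves_dist lg.1 iG sf x0; rewrite subr0 ger0_norm// => h.
    apply: (le_trans h); rewrite ler_wpM2l ?mulr_ge0//.
    apply: itg_le_IR => //; [exact: lg.2|by move=> y; exact: Q_ge0].
  have := solves_dist lg.1 iG sf (ltW x0); rewrite sub0r ltr0_norm// => h.
  rewrite -(sqrrN (f false x - _)) -(sqrrN (f true x - _)) !opprB.
  apply: (le_trans h); rewrite ler_wpM2l ?mulr_ge0//; first by lra.
  apply: itg_le_IR => //; [exact: lg.2|by move=> y; exact: Q_ge0].
have h (u v : R) : u ^+ 2 <= 2 * v ^+ 2 + 2 * (u - v) ^+ 2.
  by have := sqr_ge0 (u - 2 * v); nra.
have := h (f false x) (f false 0); have := h (f true x) (f true 0).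
have x0 := normr_ge0 x; rewrite /c.
have cx : 0 <= c * `|x| by rewrite mulr_ge0.
move: cx I0; rewrite /c; nra.
Qed.

(** The limit point case at both ends: the squared Wronskian is at most [(C + D) (1 + |x|)] times an
    integrable function, hence small at suitable points far out on either side. *)
Lemma solves_symmetric f g h k : L2r f -> L2r g -> L2r h -> L2r k ->
  solves f g -> solves h k -> IR (Q f k) = IR (Q g h).
Proof.
move=> lf lg lh lk sf sh.
have pW := prim_wronskian sf sh.
have iD := iRB (iR_Q lf lk) (iR_Q lg lh).
apply/eqP; rewrite -subr_eq0 -normr_le0 -(IRB (iR_Q lf lk) (iR_Q lg lh)).
apply/ler_addgt0Pl => e e0; rewrite addr0.
have [C C0 HC] := solves_growth lg sf; have [D D0 HD] := solves_growth lk sh.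
have e4 : 0 < e / 4 by lra.
have [N N0 HN] := IR_tail iD e4.
pose Z x := Q f f x + Q h h x.
have iZ : iR Z by apply: iRD; [exact: lf.2|exact: lh.2].
have Z0 x : 0 <= Z x by rewrite addr_ge0// Q_ge0.
pose e' := (e / 4) ^+ 2 / (C + D + 1).
have e'0 : 0 < e' by rewrite divr_gt0// ?exprn_gt0//; lra.
have [a [b [aN Nb Ha Hb]]] := iR_decay iZ Z0 N e'0.
have W x : (1 + `|x|) * Z x < e' -> `|wronskian f h x| <= e / 4.
  move=> Hx; rewrite -ler_sqr ?nnegrE ?normr_ge0 ?(ltW e4)// real_normK ?num_real//.
  apply: le_trans (wronskian_bound f h x) _.
  apply: (@le_trans _ _ ((C + D) * ((1 + `|x|) * Z x))).
    rewrite mulrA; apply: ler_wpM2r; first exact: Z0.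
    by have := HC x; have := HD x; lra.
  apply: (@le_trans _ _ ((C + D) * e')).
    by rewrite ler_wpM2l ?(ltW Hx)// addr_ge0.
  by rewrite /e' mulrA ler_pdivrMr; [have := sqr_ge0 (e / 4); nra|lra].
have := HN a b aN Nb.
have ab : a <= b by lra.
rewrite -(pW.2 a b ab).
have a0 : a <= 0 by lra.
have := W a; have := W b; rewrite (ger0_norm (le_trans N0 Nb)) (ler0_norm a0).
move=> /(_ Hb) Wb /(_ Ha) Wa H.
apply: le_trans (_ : _ <= `|IR (fun x => Q f k x - Q g h x) -
  (wronskian f h b - wronskian f h a)| + `|wronskian f h b - wronskian f h a|) _.
  by rewrite -{1}(subrK (wronskian f h b - wronskian f h a) (IR _)); exact: ler_normD.
have := ler_normB (wronskian f h b) (wronskian f h a); lra.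
Qed.

End System.

(** * The relation, with real and imaginary parts separated *)

Section ComplexLevel.
Context {R : realType}.
Local Notation mu := (@lebesgue_measure R).
Context (p q r : R -> R).
Context (Hc : coeff p q r).
Local Notation Q := (Q p q r).
Local Notation solves := (solves p q r).
Local Notation L2r := (L2r p q r).
Implicit Types (f g h : @rvec R) (F G U K : @cvec R).

(** The real part of the Hermitian form; the imaginary part is [Q (F false) (G true) - Q (F true) (G
    false)]. *)
Definition QQ F G x := Q (F false) (G false) x + Q (F true) (G true) x.
Definition L2c F := forall k, L2r (F k).
Definition ip F G := IR (QQ F G).
Definition csolves F G := forall k, solves (F k) (G k).

Definition relR F G := [/\ L2c F, L2c G & exists F0, csolves F0 G /\
  {ae mu, forall x : R, QQ (clin (-1) F F0) (clin (-1) F F0) x = 0}].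

(* Multiplication by the scalar [x + i y]. *)
Definition zmul (x y : R) F : cvec :=
  fun k c t => if k then x * F true c t + y * F false c t
               else x * F false c t - y * F true c t.

Lemma solves_cont f g c : solves f g -> continuous (f c).
Proof. by move=> [h0 h1]; case: c; [exact: prim_cont h1|exact: prim_cont h0]. Qed.

(** The form pairs the continuous [f] with [H g], so the local integrability of [H g] suffices. *)
Lemma lint_Q_solves f g : solves f g -> lint (Q f g).
Proof.
move=> sf.
have -> : Q f g = fun x => f false x * (p x * g false x + q x * g true x)
     - f true x * (- (q x * g false x + r x * g true x)).
  by apply/funext => x; rewrite /Submission.Q; ring.
apply: lintB; apply: lint_contM.
- exact: solves_cont sf.
- exact: sf.2.1.
- exact: solves_cont sf.
- exact: sf.1.1.
Qed.

Lemma QQ_ge0 F x : 0 <= QQ F F x.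
Proof. by rewrite addr_ge0// Q_ge0. Qed.

Lemma iR_QQ F G : L2c F -> L2c G -> iR (QQ F G).
Proof. by move=> lF lG; apply: iRD; apply: iR_Q. Qed.

Lemma L2c_lin t F G : L2c F -> L2c G -> L2c (clin t F G).
Proof. by move=> lF lG k; apply: L2r_lin. Qed.

Lemma ip_lin t F G K : L2c F -> L2c G -> L2c K ->
  ip (clin t F G) K = ip F K + t * ip G K.
Proof.
move=> lF lG lK; rewrite /ip -IRZ -?IRD; try exact: iR_QQ.
  by congr IR; apply/funext => x; rewrite /QQ /clin !Q_lin; ring.
by apply: iRZ; exact: iR_QQ.
Qed.

Lemma ip_sym F G : ip F G = ip G F.
Proof. by congr IR; apply/funext => x; rewrite /QQ !(@Q_sym _ _ _ _ (F _)). Qed.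

Lemma ip_ge0 F : 0 <= ip F F.
Proof. by apply: IR_ge0 => x; exact: QQ_ge0. Qed.

Lemma ip_lin2 t F G : L2c F -> L2c G ->
  ip (clin t F G) (clin t F G) = ip F F + 2 * t * ip F G + t ^+ 2 * ip G G.
Proof.
move=> lF lG; have lFG := L2c_lin t lF lG.
by rewrite ip_lin// !(ip_sym _ (clin _ _ _)) !ip_lin// (ip_sym G F); ring.
Qed.

Lemma ip_amgm F G : L2c F -> L2c G -> `|2 * ip F G| <= ip F F + ip G G.
Proof.
move=> lF lG; have := ip_ge0 (clin 1 F G); have := ip_ge0 (clin (-1) F G).
by rewrite !ip_lin2// ler_norml => ? ?; apply/andP; split; lra.
Qed.

Lemma ip_zero F G : L2c F -> L2c G -> ip F F = 0 -> ip F G = 0.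
Proof.
move=> lF lG F0; pose t := (ip G G + 1).
have t0 : 0 < t by have := ip_ge0 G; rewrite /t; lra.
have aux (s : R) : 0 <= 2 * s * ip F G + ip G G.
  have := ip_ge0 (clin s G F); rewrite ip_lin2// (ip_sym G F) F0; lra.
apply/eqP; apply: contraT => n0.
(* The lower bound [aux] is affine in [s]; this value brings it down to [-1]. *)
have := aux (- t / (2 * ip F G)).
have -> : 2 * (- t / (2 * ip F G)) * ip F G = - t by field.
by rewrite /t; lra.
Qed.

Lemma csolves_lin t F G F' G' : csolves F G -> csolves F' G' ->
  csolves (clin t F F') (clin t G G').
Proof. by move=> s1 s2 k; exact: solves_lin. Qed.

Lemma QQ_lin2 t F G x : QQ (clin t F G) (clin t F G) x =
  QQ F F x + 2 * t * QQ F G x + t ^+ 2 * QQ G G x.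
Proof. by rewrite /QQ /clin !Q_lin2; ring. Qed.

Lemma QQ_null F k : forall x, QQ F F x = 0 -> Q (F k) (F k) x = 0.
Proof.
move=> x; rewrite /QQ => h; have := Q_ge0 Hc (F false) x; have := Q_ge0 Hc (F true) x.
by case: k; lra.
Qed.

Lemma relR_lin t F G F' G' : relR F G -> relR F' G' ->
  relR (clin t F F') (clin t G G').
Proof.
move=> [lF lG [F0 [s0 a0]]] [lF' lG' [F0' [s0' a0']]].
split; [exact: L2c_lin|exact: L2c_lin|exists (clin t F0 F0'); split].
  exact: csolves_lin.
apply: aeS (aeI a0 a0') => x [h h'].
set D := clin (-1) F F0 in h; set D' := clin (-1) F' F0' in h'.
have -> : clin (-1) (clin t F F') (clin t F0 F0') = clin t D D'.
  by rewrite /D /D' /clin /rlin; apply/funext => k; apply/funext => c;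
    apply/funext => y; ring.
have e k : Q (D k) (D' k) x = 0 by apply: (Q_zero Hc); exact: QQ_null.
by rewrite QQ_lin2 h h' /QQ !e; ring.
Qed.

(** By [Q_zero] pairings do not depend on the representative, so they can be computed with the
    absolutely continuous one. *)
Lemma relR_core F G : relR F G -> exists F0, [/\ L2c F0, csolves F0 G &
  forall k h, L2r h -> IR (Q (F k) h) = IR (Q (F0 k) h)].
Proof.
move=> [lF lG [F0 [s0 a0]]].
have mF0 k c : measurable_fun [set: R] (F0 k c).
  by apply: continuous_measurable_fun; exact: solves_cont (s0 k).
have a k : {ae mu, forall x : R, forall h, Q (F0 k) h x = Q (F k) h x}.
  apply: aeS a0 => x /(@QQ_null _ k) D0 h.
  have := Q_zero Hc h D0; rewrite /clin Q_lin; lra.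
have lF0 : L2c F0.
  move=> k; split; first exact: mF0.
  apply: ae_iR (lF k).2 _; first exact: measurable_Q.
  by apply: aeS (a k) => x e; rewrite e Q_sym e.
exists F0; split => // k h lh; apply: ae_IR.
- by apply: (measurable_Q Hc); [exact: (lF k).1|exact: lh.1].
- by apply: (measurable_Q Hc); [exact: (lF0 k).1|exact: lh.1].
- by apply: aeS (a k) => x ->.
Qed.

Lemma ip_split F G : L2c F -> L2c G ->
  ip F G = IR (Q (F false) (G false)) + IR (Q (F true) (G true)).
Proof. by move=> lF lG; rewrite /ip IRD//; apply: iR_Q. Qed.

(** [H] is real, so real and imaginary parts solve the system separately, and symmetry holds for any
    two of them. Applied to a pair and itself, it makes the pairing of [F] with [G] real. *)
Lemma relR_symr F G F' G' k l : relR F G -> relR F' G' ->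
  IR (Q (F k) (G' l)) = IR (Q (G k) (F' l)).
Proof.
move=> h h'; have [lF lG _] := h; have [lF' lG' _] := h'.
have [F0 [l0 s0 e0]] := relR_core h; have [F0' [l0' s0' e0']] := relR_core h'.
rewrite e0//.
have -> : Q (G k) (F' l) = Q (F' l) (G k) by apply/funext => x; exact: Q_sym.
rewrite e0'// (solves_symmetric Hc (l0 k) (lG k) (l0' l) (lG' l))//.
by congr IR; apply/funext => x; exact: Q_sym.
Qed.

Lemma relR_sym F G F' G' : relR F G -> relR F' G' -> ip F G' = ip G F'.
Proof.
move=> h h'; have [lF lG _] := h; have [lF' lG' _] := h'.
by rewrite !ip_split// !(relR_symr _ _ h h').
Qed.

Lemma relR_im F G : relR F G -> IR (Q (F true) (G false)) = IR (Q (F false) (G true)).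
Proof.
move=> h; rewrite (relR_symr _ _ h h); congr IR; apply/funext => x; exact: Q_sym.
Qed.

Lemma L2c_zmul x y F : L2c F -> L2c (zmul x y F).
Proof.
move=> lF.
have z f : L2r f -> L2r (fun c t => 0).
  move=> _; split; first by move=> c; exact: measurable_cst.
  have -> : Q (fun c t => 0) (fun c t => 0) = fun t => 0 * 0.
    by apply/funext => t; rewrite /Submission.Q; ring.
  apply: iRZ; split; first exact: measurable_cst.
  exact: integrable0.
have z0 := z _ (lF false).
move=> [].
- have := L2r_lin Hc y (L2r_lin Hc x z0 (lF true)) (lF false).
  by congr L2r; apply/funext => c; apply/funext => t; rewrite /rlin /=; ring.
- have := L2r_lin Hc (- y) (L2r_lin Hc x z0 (lF false)) (lF true).
  by congr L2r; apply/funext => c; apply/funext => t; rewrite /rlin /=; ring.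
Qed.

Lemma Q_amgm f g (s x : R) : 0 < s ->
  `|Q f g x| <= s / 2 * Q f f x + (2 * s)^-1 * Q g g x.
Proof.
move=> s0; have h1 := Q_ge0 Hc (rlin s^-1 f g) x; have h2 := Q_ge0 Hc (rlin (- s^-1) f g) x.
rewrite !Q_lin2 in h1 h2.
have e (u v w : R) : s / 2 * (u + 2 * s^-1 * v + s^-1 ^+ 2 * w) =
   s / 2 * u + v + (2 * s)^-1 * w by field; rewrite lt0r_neq0.
have e' (u v w : R) : s / 2 * (u + 2 * (- s^-1) * v + (- s^-1) ^+ 2 * w) =
   s / 2 * u - v + (2 * s)^-1 * w by field; rewrite lt0r_neq0.
have s2 : 0 <= s / 2 by rewrite divr_ge0// ltW.
have := mulr_ge0 s2 h1; have := mulr_ge0 s2 h2; rewrite e e' => ? ?.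
by rewrite ler_norml; apply/andP; split; lra.
Qed.

End ComplexLevel.

(** * Monotone phase implies non-negative form *)

Section MonotoneParts.
Context {R : realType}.

Lemma lint_monoM (k m : R -> R) : {homo k : x y / x <= y} -> lint m ->
  lint (fun x => k x * m x).
Proof.
move=> kmono; apply: lint_bounded.
  by apply: nondecreasing_measurable.
move=> a b; exists (`|k a| + `|k b|) => x /andP[ax xb].
have h1 := kmono _ _ ax; have h2 := kmono _ _ xb.
have := ler_norm (k b); have := ler_norm (- k a); rewrite normrN.
have := normr_ge0 (k a); have := normr_ge0 (k b).
by rewrite ler_norml => *; apply/andP; split; lra.
Qed.

(** Integration by parts without a Stieltjes integral: the dropped term, [m] against the increments
    of [k], is non-negative. On a short interval [k] is replaced by its right end value; the error
    is at most [e] times the increment of [k], which telescopes under [cousin]. *)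
Lemma itg_monotone_parts (k m m' : R -> R) a b : {homo k : x y / x <= y} ->
  prim m m' -> (forall x, 0 <= m x) -> a <= b ->
  itg a b (fun x => k x * m' x) <= k b * m b - k a * m a.
Proof.
move=> kmono pm m0 ab.
have ikm := lint_monoM kmono pm.1.
apply/ler_addgt0Pl => e0 e0_gt0.
pose e := e0 / (k b - k a + 1).
have kab := kmono _ _ ab.
have e_gt0 : 0 < e by rewrite divr_gt0//; lra.
have [d d0 Hd] := prim_small pm a b e_gt0.
pose P s t := a <= s -> t <= b -> s <= t /\
  itg s t (fun x => k x * m' x) <= k t * m t - k s * m s + e * (k t - k s).
pose Q s t := s <= t /\ P s t.
have : Q a b.
  apply: cousin => //.
    move=> s t u [st Pst] [tu Ptu]; split; first exact: le_trans tu.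
    move=> as_ ub; split; first exact: le_trans tu.
    have [_ h1] := Pst as_ (le_trans tu ub).
    have [_ h2] := Ptu (le_trans as_ st) ub.
    by rewrite (itg_cat ikm st tu); lra.
  move=> x xab; exists d => // s t as_ sx xt tb std.
  have st := le_trans sx xt; split => //; move=> _ _; split => //.
  have ktm : lint (fun y => k t * m' y) by exact: lintZ pm.1.
  have inm := lintZ (k t - k s) (lint_norm pm.1).
  have h : itg s t (fun y => k y * m' y) <=
      itg s t (fun y => k t * m' y + (k t - k s) * `|m' y|).
    apply: le_itg => //; first exact: lintD.
    move=> y /andP[sy yt]; have h1 := kmono _ _ sy; have h2 := kmono _ _ yt.
    have : (k y - k t) * m' y <= `|k y - k t| * `|m' y| by rewrite -normrM ler_norm.
    rewrite distrC ger0_norm ?subr_ge0//.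
    have : (k t - k y) * `|m' y| <= (k t - k s) * `|m' y| by rewrite ler_wpM2r// lerD2l lerN2.
    by rewrite mulrBl; lra.
  apply: (le_trans h).
  rewrite itgD// itgZ; last exact: pm.1.
  rewrite itgZ; last exact: lint_norm pm.1.
  rewrite -(pm.2 _ _ st).
  have hk := kmono _ _ st.
  have := Hd s t as_ st tb std => hs.
  have : (k t - k s) * itg s t (fun x => `|m' x|) <= (k t - k s) * e.
    by rewrite ler_wpM2l ?subr_ge0// ltW.
  have : 0 <= (k t - k s) * m s by rewrite mulr_ge0// subr_ge0.
  lra.
move=> [_ /(_ (lexx a) (lexx b))[_ h]].
apply: (le_trans h); rewrite addrC lerD2r /e mulrAC ler_pdivrMr; last by lra.
by rewrite ler_pM2l//; lra.
Qed.

End MonotoneParts.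

(** * Lower bounds for the form of a decreasing phase *)

Section Positivity.
Context {R : realType}.
Context (phi : R -> R).
Context (phi_mono : forall x y, x <= y -> phi y <= phi x).

Definition pP x := cos (phi x) ^+ 2.
Definition qP x := cos (phi x) * sin (phi x).
Definition rP x := sin (phi x) ^+ 2.

Lemma measurable_phi : measurable_fun [set: R] phi.
Proof. by apply: nonincreasing_measurable. Qed.

Lemma coeffP : coeff pP qP rP.
Proof.
have mc : measurable_fun [set: R] (fun x => cos (phi x)).
  apply: (measurableT_comp _ measurable_phi).
  by apply: continuous_measurable_fun; exact: continuous_cos.
have ms : measurable_fun [set: R] (fun x => sin (phi x)).
  apply: (measurableT_comp _ measurable_phi).
  by apply: continuous_measurable_fun; exact: continuous_sin.
split.
- exact: measurable_funX.
- exact: measurable_funM.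
- exact: measurable_funX.
- by move=> x; exact: sqr_ge0.
- by move=> x; exact: sqr_ge0.
- by move=> x; exact: cos2Dsin2.
- by move=> x; rewrite exprMn.
Qed.

(** [along] and [perp] are coordinates in the frame turned by [a]; [uphi] is the component of [f] in
    the range of [P_phi]. *)
Definition along (a : R) (f : @rvec R) (x : R) := f false x * cos a + f true x * sin a.
Definition perp (a : R) (f : @rvec R) (x : R) := - f false x * sin a + f true x * cos a.
Definition uphi (f : @rvec R) x := f false x * cos (phi x) + f true x * sin (phi x).
(** Equals [- perp * along - cot (phi - a) * along^2]. The factor [uphi], whose square is the form
    of [f], makes it small where the form is small and zero under the boundary condition
    [uphi = 0]. *)
Definition bdry (a : R) (f : @rvec R) x := - along a f x * uphi f x / sin (phi x - a).

Lemma Q_phi f g x : Q pP qP rP f g x = uphi f x * uphi g x.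
Proof. by rewrite /Q /pP /qP /rP /uphi; ring. Qed.

(* With [m = (along a f)^2] and [k = cot (phi - a)] on [[s, t]], the form is
   [- (perp a f * along a f)' - k m'], where [k] is nondecreasing; integrating
   [k m'] by parts against the monotone [k] only loses a term of the right sign. *)
Lemma half_line_bound a f g s t : s <= t -> solves pP qP rP f g ->
  (forall x, s <= x <= t -> 0 < phi x - a < pi) ->
  bdry a f t - bdry a f s <= itg s t (Q pP qP rP f g).
Proof.
move=> st [f0 f1] Hphi.
(* Clamping to [[s, t]] makes the cotangent monotone on the whole line, although the phase is only
   controlled on [[s, t]]. *)
pose cl x := Num.max s (Num.min x t).
have cl_in x : s <= cl x <= t by rewrite /cl le_max lexx/= ge_max st ge_min lexx orbT.
have cl_mono : {homo cl : x y / x <= y}.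
  move=> x y xy; rewrite /cl ge_max le_max lexx/= le_max; apply/orP; right.
  by rewrite le_min !ge_min xy/= lexx orbT.
have cl_id x : s <= x <= t -> cl x = x.
  move=> /andP[sx xt]; rewrite /cl min_l// max_r//.
pose S x := sin (phi (cl x) - a).
have S0 x : 0 < S x by apply: sin_gt0_pi; apply: Hphi.
pose k x := cos (phi (cl x) - a) / S x.
have kmono : {homo k : x y / x <= y}.
  move=> x y xy; rewrite /k ler_pdivrMr// mulrAC ler_pdivlMr// -subr_ge0.
  have hp := phi_mono (cl_mono _ _ xy).
  have /andP[h1 h2] := Hphi _ (cl_in x); have /andP[h3 h4] := Hphi _ (cl_in y).
  have -> : cos (phi (cl y) - a) * S x - cos (phi (cl x) - a) * S y =
     sin ((phi (cl x) - a) - (phi (cl y) - a)) by rewrite sinB /S; ring.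
  by apply: sin_ge0_pi; apply/andP; split; lra.
pose A' x := - uphi g x * sin (phi x - a).
pose B' x := uphi g x * cos (phi x - a).
have pa : prim (along a f) A'.
  apply: (eq_prim (primD (primZ (cos a) f0) (primZ (sin a) f1))) => x.
    by rewrite /along; ring.
  by rewrite /A' /qP /rP /pP /uphi sinB; ring.
have pb : prim (perp a f) B'.
  apply: (eq_prim (primB (primZ (cos a) f1) (primZ (sin a) f0))) => x.
    by rewrite /perp; ring.
  by rewrite /B' /qP /rP /pP /uphi cosB; ring.
have uE x : uphi f x = cos (phi x - a) * along a f x + sin (phi x - a) * perp a f x.
  have -> : uphi f x = (cos a ^+ 2 + sin a ^+ 2) * uphi f x by rewrite cos2Dsin2 mul1r.
  by rewrite /uphi /along /perp sinB cosB; ring.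
have pm := primM pa pa.
have pab := primM pb pa.
have m0 x : 0 <= along a f x * along a f x by rewrite -expr2 sqr_ge0.
have := itg_monotone_parts kmono pm m0 st => Hk.
have ikm := lint_monoM kmono pm.1.
have E : itg s t (Q pP qP rP f g) =
   - itg s t (fun x => perp a f x * A' x + along a f x * B' x)
   - itg s t (fun x => k x * (along a f x * A' x + along a f x * A' x)).
  rewrite -itgN; last exact: pab.1.
  rewrite -itgB//; last by apply: lintN; exact: pab.1.
  apply: eq_itg => x xst; rewrite Q_phi uE /k /S (cl_id x xst) /A' /B'.
  have := S0 x; rewrite /S (cl_id x xst) => /lt0r_neq0 Sn.
  by field.
rewrite E -(pab.2 _ _ st).
have bE x : s <= x <= t -> bdry a f x = - (perp a f x * along a f x) - k x * (along a f x * along a f x).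
  move=> xst; rewrite /bdry uE /k /S (cl_id x xst).
  have := S0 x; rewrite /S (cl_id x xst) => /lt0r_neq0 Sn.
  by field.
rewrite !bE ?lexx ?st//.
lra.
Qed.

Context (alpha : R).
Context (phi_range : forall x, alpha <= phi x <= alpha + pi).
Context (c : R).
Context (phi_c : alpha < phi c < alpha + pi).

Lemma bdry_cont f : {for alpha, continuous (fun t => bdry t f c)}.
Proof.
rewrite /bdry /along.
have cs : {for alpha, continuous (fun t : R => sin (phi c - t))}.
  apply: (@continuous_comp _ _ _ (fun t => phi c - t) sin).
    by apply: cvgB; [exact: cvg_cst|exact: cvg_id].
  exact: continuous_sin.
have sn : sin (phi c - alpha) != 0.
  by apply: lt0r_neq0; apply: sin_gt0_pi; apply/andP; split; move/andP: phi_c => [? ?]; lra.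
apply: cvgM; last exact: cvgV.
apply: cvgM; last exact: cvg_cst.
apply: cvgN; apply: cvgD; apply: cvgM; (exact: cvg_cst || exact: continuous_cos || exact: continuous_sin).
Qed.

(** Right of [c] the phase may reach [alpha] but stays below [phi c], so the reference angle is
    lowered; left of [c] it is raised. The boundary terms at [c] no longer cancel, and [e] is the
    price, small by [bdry_cont]. *)
Lemma split_bound f g (e : R) : solves pP qP rP f g -> 0 < e -> exists2 d, 0 < d &
  (forall x, c <= x -> d <= phi x - (alpha - d) <= pi - d) /\
  (forall x, x <= c -> d <= phi x - (alpha + d) <= pi - d) /\
  forall s t, s <= c -> c <= t ->
  bdry (alpha - d) f t - bdry (alpha + d) f s - e <= itg s t (Q pP qP rP f g).
Proof.
move=> sf e0; have e2 : 0 < e / 2 by lra.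
have /cvgrPdist_lt/(_ _ e2) := @bdry_cont f.
move=> /nbhs_ballP[h /= h0 Hh].
move/andP: phi_c => [c1 c2].
(* [h / 2] serves continuity at [c]; the quarters leave at least [2 d] between [phi c] and either
   end of the range. *)
pose d := Num.min (h / 2) (Num.min ((phi c - alpha) / 4) ((alpha + pi - phi c) / 4)).
have d0 : 0 < d by rewrite !lt_min; apply/andP; split; [|apply/andP; split]; lra.
have dh : d <= h / 2 by rewrite ge_min lexx.
have d1 : d <= (phi c - alpha) / 4 by rewrite !ge_min lexx orbT.
have d2 : d <= (alpha + pi - phi c) / 4 by rewrite !ge_min lexx !orbT.
have R1 x : c <= x -> d <= phi x - (alpha - d) <= pi - d.
  by move=> /phi_mono hx; have /andP[? ?] := phi_range x; apply/andP; split; lra.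
have R2 x : x <= c -> d <= phi x - (alpha + d) <= pi - d.
  by move=> /phi_mono hx; have /andP[? ?] := phi_range x; apply/andP; split; lra.
exists d => //; split => //; split => // s t sc ct.
have iQ := lint_Q_solves sf.
have H1 : bdry (alpha - d) f t - bdry (alpha - d) f c <= itg c t (Q pP qP rP f g).
  apply: half_line_bound => // x /andP[cx _].
  by have /andP[? ?] := R1 x cx; apply/andP; split; lra.
have H2 : bdry (alpha + d) f c - bdry (alpha + d) f s <= itg s c (Q pP qP rP f g).
  apply: half_line_bound => // x /andP[_ xc].
  by have /andP[? ?] := R2 x xc; apply/andP; split; lra.
rewrite (itg_cat iQ sc ct).
have := Hh (alpha - d); have := Hh (alpha + d); rewrite /ball/=.
have -> : alpha - (alpha + d) = - d by ring.
have -> : alpha - (alpha - d) = d by ring.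
rewrite normrN (gtr0_norm d0).
have dlth : d < h by lra.
by move=> /(_ dlth); rewrite ltr_norml => /andP[? ?] /(_ dlth); rewrite ltr_norml => /andP[? ?]; lra.
Qed.

Lemma positivity_bvp f g s t : solves pP qP rP f g -> s <= c -> c <= t ->
  uphi f s = 0 -> uphi f t = 0 -> 0 <= itg s t (Q pP qP rP f g).
Proof.
move=> sf sc ct us ut; apply/ler_addgt0Pl => e e0.
have [d d0 [_ [_ /(_ s t sc ct)]]] := split_bound sf e0.
by rewrite /bdry us ut !mulr0 !mul0r; lra.
Qed.

Lemma sin_lower (d : R) : 0 < d -> exists2 m, 0 < m &
  forall x : R, d <= x <= pi - d -> m <= sin x.
Proof.
move=> d0; have [dp|pd] := leP d (pi - d); last first.
  by exists 1 => // x /andP[? ?]; exfalso; lra.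
have [y /andP[dy yd] Hy] := EVT_min dp (continuous_subspaceT (@continuous_sin R)).
exists (sin y); first by apply: sin_gt0_pi; move: dy yd; rewrite !bnd_simp => *; apply/andP; split; lra.
by move=> x xd; apply: Hy; rewrite in_itv.
Qed.

(** With [m] a lower bound for the sine, the squared boundary terms are at most [C (1 + |x|) / m^2]
    times the form of [f], and [iR_decay] supplies points where this is small. *)
Lemma positivity_line f g : L2r pP qP rP f -> L2r pP qP rP g ->
  solves pP qP rP f g -> 0 <= IR (Q pP qP rP f g).
Proof.
move=> lf lg sf; have Hc := coeffP.
apply/ler_addgt0Pl => e e0; have e4 : 0 < e / 4 by lra.
have [d d0 [R1 [R2 Hd]]] := split_bound sf e4.
have [m m0 Hm] := sin_lower d0.
have iQ := iR_Q Hc lf lg.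
have [C C0 HC] := solves_growth Hc lg sf.
have [N N0 HN] := IR_tail iQ e4.
pose e' := (e / 4 * m) ^+ 2 / (2 * (C + 1)).
have e'0 : 0 < e' by rewrite divr_gt0// ?exprn_gt0 ?mulr_gt0//; lra.
pose M := N + `|c|.
have MN : N <= M by rewrite lerDl.
have Mc : c <= M by rewrite (le_trans (ler_norm c))// lerDr.
have Mc' : - M <= c by rewrite lerNl (le_trans (ler_norm _))// normrN lerDr.
have [a [b [aM Mb Ha Hb]]] := iR_decay lf.2 (Q_ge0 Hc f) M e'0.
have B t x : (1 + `|x|) * Q pP qP rP f f x < e' -> d <= phi x - t <= pi - d ->
    `|bdry t f x| <= e / 4.
  move=> Hx /Hm ms; rewrite /bdry normrM normfV (gtr0_norm (lt_le_trans m0 ms)).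
  rewrite ler_pdivrMr ?(lt_le_trans m0 ms)//.
  apply: (@le_trans _ _ (e / 4 * m)); last by rewrite ler_pM2l.
  have em0 : 0 <= e / 4 * m by rewrite mulr_ge0// ltW.
  rewrite -ler_sqr ?nnegrE ?normr_ge0// real_normK ?num_real// mulNr sqrrN exprMn.
  have a2 : along t f x ^+ 2 <= f false x ^+ 2 + f true x ^+ 2.
    have -> : f false x ^+ 2 + f true x ^+ 2 =
       (f false x ^+ 2 + f true x ^+ 2) * (cos t ^+ 2 + sin t ^+ 2) by rewrite cos2Dsin2 mulr1.
    by rewrite /along -subr_ge0; have := sqr_ge0 (f false x * sin t - f true x * cos t); nra.
  have u2 : uphi f x ^+ 2 = Q pP qP rP f f x by rewrite Q_phi.
  rewrite u2.
  apply: (@le_trans _ _ (C * ((1 + `|x|) * Q pP qP rP f f x))).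
    by rewrite mulrA ler_wpM2r ?Q_ge0// (le_trans a2).
  apply: (@le_trans _ _ (C * e')); first by rewrite ler_wpM2l// ltW.
  by rewrite /e' mulrA ler_pdivrMr; [have := sqr_ge0 (e / 4 * m); nra|lra].
have aM' : a <= - N by lra.
have bM' : N <= b by lra.
have a0 : a <= 0 by lra.
have := HN a b aM' bM'; rewrite ler_norml => /andP[h _].
have ac : a <= c by lra.
have cb : c <= b by lra.
have := Hd a b ac cb.
have := B (alpha - d) b; have := B (alpha + d) a.
rewrite (ger0_norm (le_trans N0 bM')) (ler0_norm a0).
move=> /(_ Ha (R2 a ac)) + /(_ Hb (R1 b cb)).
rewrite !ler_norml => /andP[? ?] /andP[? ?]; lra.
Qed.

End Positivity.

(** * Solvability off the half-line *)

Section FiniteDimension.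
Context {R : realType}.

Lemma linear_solvable (I : finType) (M : I -> I -> R) :
  (forall c : I -> R, (forall i, \sum_j M i j * c j = 0) -> forall j, c j = 0) ->
  forall d : I -> R, exists c : I -> R, forall i, \sum_j M i j * c j = d i.
Proof.
move=> inj d.
pose A : 'M[R]_#|I| := \matrix_(a, b) M (enum_val b) (enum_val a).
have mulE (c : I -> R) i :
    ((\row_a c (enum_val a)) *m A) 0 (enum_rank i) = \sum_j M i j * c j.
  rewrite mxE (reindex (@enum_val I predT)) /=; last exact/onW_bij/enum_val_bij.
  by apply: eq_bigr => a _; rewrite !mxE enum_rankK mulrC.
have uA : A \in unitmx.
  rewrite -row_free_unit; apply: inj_row_free => v vA.
  have h : forall j, v 0 (enum_rank j) = 0.
    apply: inj => i; rewrite -mulE.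
    have -> : \row_a v 0 (enum_rank (enum_val a)) = v.
      by apply/rowP => a; rewrite mxE enum_valK.
    by rewrite vA mxE.
  by apply/rowP => a; rewrite mxE -(enum_valK a) h.
pose w := (\row_a d (enum_val a)) *m invmx A.
exists (fun j => w 0 (enum_rank j)) => i; rewrite -mulE.
have -> : \row_a w 0 (enum_rank (enum_val a)) = w.
  by apply/rowP => a; rewrite mxE enum_valK.
by rewrite /w mulmxKV// mxE enum_rankK.
Qed.

Lemma bounded_cluster (I : finType) (u : nat -> I -> R) (B : R) :
  (forall n i, `|u n i| <= B) ->
  exists l : I -> R, forall e, 0 < e -> forall m, exists2 n, (m <= n)%N &
    forall i, `|l i - u n i| < e.
Proof.
move=> uB.
pose K : set 'rV[R]_#|I| := [set v | forall a, `[- B, B]%classic (v 0 a)].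
have cK : compact K.
  apply: (@rV_compact _ _ (fun=> `[- B, B]%classic)) => a; exact: segment_compact.
pose v n : 'rV[R]_#|I| := \row_a u n (enum_val a).
have vK : (v @ \oo) K.
  by exists 0%N => // n _ a; rewrite /v mxE /= in_itv/= -ler_norml.
have [l [Kl cl]] := cK _ _ vK.
exists (fun i => l 0 (enum_rank i)) => e e0 m.
have h1 : (v @ \oo) [set v n | n in [set n | (m <= n)%N]].
  by exists m => // n mn; exists n.
have [_ [[n mn <-] lv]] := cl _ _ h1 (nbhsx_ballx l e e0).
exists n => // i; have [_ /(_ 0 (enum_rank i))] := lv.
by rewrite /v mxE enum_rankK /ball/=.
Qed.

End FiniteDimension.

(** * Constant vectors and the degenerate case *)

Section General.
Context {R : realType}.
Local Notation mu := (@lebesgue_measure R).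
Context (p q r : R -> R).
Context (Hc : coeff p q r).
Local Notation Q := (Q p q r).
Local Notation QQ := (QQ p q r).
Local Notation solves := (solves p q r).
Local Notation csolves := (csolves p q r).
Local Notation L2r := (L2r p q r).
Local Notation L2c := (L2c p q r).
Local Notation relR := (relR p q r).
Local Notation ip := (ip p q r).

Definition rcst (v0 v1 : R) : @rvec R := fun c x => if c then v1 else v0.

(* A constant vector annihilated by [H] almost everywhere; the domain of the
   relation is then trivial. *)
Definition degenerate := exists v0 v1 : R, v0 ^+ 2 + v1 ^+ 2 != 0 /\
  {ae mu, forall x : R, Q (rcst v0 v1) (rcst v0 v1) x = 0}.

Lemma lint_pqr : [/\ lint p, lint q & lint r].
Proof.
split; apply: (@lint_bounded_cst _ _ 1).
- exact: coeff_mp Hc.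
- exact: p_bound Hc.
- exact: coeff_mq Hc.
- exact: q_bound Hc.
- exact: coeff_mr Hc.
- exact: r_bound Hc.
Qed.

Lemma Q_cst v0 v1 x : Q (rcst v0 v1) (rcst v0 v1) x =
  v0 ^+ 2 * p x + 2 * v0 * v1 * q x + v1 ^+ 2 * r x.
Proof. by rewrite /Submission.Q /rcst; ring. Qed.

Lemma lint_Qcst v0 v1 : lint (Q (rcst v0 v1) (rcst v0 v1)).
Proof.
have [ip_ iq ir] := lint_pqr.
have -> : Q (rcst v0 v1) (rcst v0 v1) = fun x => v0 ^+ 2 * p x + 2 * v0 * v1 * q x + v1 ^+ 2 * r x.
  by apply/funext => x; exact: Q_cst.
by apply: lintD; [apply: lintD|]; apply: lintZ.
Qed.

Lemma itg_Qcst v0 v1 a b : itg a b (Q (rcst v0 v1) (rcst v0 v1)) =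
  v0 ^+ 2 * itg a b p + 2 * v0 * v1 * itg a b q + v1 ^+ 2 * itg a b r.
Proof.
have [ip_ iq ir] := lint_pqr.
have -> : Q (rcst v0 v1) (rcst v0 v1) = fun x => v0 ^+ 2 * p x + 2 * v0 * v1 * q x + v1 ^+ 2 * r x.
  by apply/funext => x; exact: Q_cst.
rewrite itgD; [|by apply: lintD; apply: lintZ|exact: lintZ].
by rewrite itgD ?itgZ//; apply: lintZ.
Qed.

Lemma itg_mono (Z : R -> R) (X Y : R) : lint Z -> (forall x, 0 <= Z x) -> 0 <= X -> X <= Y ->
  itg (- X) X Z <= itg (- Y) Y Z.
Proof.
move=> iZ Z0 X0 XY.
have h1 : - Y <= - X by lra.
have h2 : - X <= Y by lra.
have h3 : - X <= X by lra.
rewrite (itg_cat iZ h1 h2) (itg_cat iZ h3 XY).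
have := itg_ge0 (fun x (_ : - Y <= x <= - X) => Z0 x).
have := itg_ge0 (fun x (_ : X <= x <= Y) => Z0 x).
lra.
Qed.

(** If some [v] is null on [[-1, 1]], enlarge the interval until [v] is not null there. A vector
    null on the larger interval is null on [[-1, 1]] too, hence parallel to [v] by the Wronskian
    bound, hence 0. The integrated form is then a positive definite matrix. *)
Lemma nondegenerate_pd : ~ degenerate -> exists X l, [/\ 0 < X, 0 < l &
  forall v0 v1, l * (v0 ^+ 2 + v1 ^+ 2) <= itg (- X) X (Q (rcst v0 v1) (rcst v0 v1))].
Proof.
move=> nd.
pose fm (n : nat) v0 v1 := itg (- n%:R) n%:R (Q (rcst v0 v1) (rcst v0 v1)).
have fm0 n v0 v1 : 0 <= fm n v0 v1 by apply: itg_ge0 => x _; exact: Q_ge0 Hc _ _.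
have sq0 (a b : R) : a ^+ 2 + b ^+ 2 <= 0 -> a = 0 /\ b = 0.
  move=> h; have := sqr_ge0 a; have := sqr_ge0 b => hb ha.
  by split; apply/eqP; rewrite -sqrf_eq0 eq_le; apply/andP; split => //; lra.
have [n [n0 inj]] : exists n, (0 < n)%N /\
    forall v0 v1, fm n v0 v1 = 0 -> v0 ^+ 2 + v1 ^+ 2 = 0.
  have [h|h] := pselect (forall v0 v1, fm 1%N v0 v1 = 0 -> v0 ^+ 2 + v1 ^+ 2 = 0).
    by exists 1%N.
  have [v0 [v1 [f1 v_n0]]] : exists v0 v1, fm 1%N v0 v1 = 0 /\ v0 ^+ 2 + v1 ^+ 2 != 0.
    apply: contrapT => h'; apply: h => v0 v1 e; apply/eqP; apply: contraT => e'.
    by case: h'; exists v0, v1.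
  have [n fn] : exists n, fm n v0 v1 != 0.
    apply: contrapT => h'; apply: nd; exists v0, v1; split => //.
    have [iQ IQ] : iR (Q (rcst v0 v1) (rcst v0 v1)) /\ IR (Q (rcst v0 v1) (rcst v0 v1)) <= 0.
      apply: iR_itg; [exact: lint_Qcst|exact: Q_ge0 Hc _|move=> n].
      by rewrite leNgt; apply/negP => fp; apply: h'; exists n; rewrite gt_eqF.
    apply: IR_eq0 => //; first exact: Q_ge0 Hc _.
    by apply/eqP; rewrite eq_le IQ IR_ge0//; exact: Q_ge0 Hc _.
  have n0 : (0 < n)%N by case: n fn => //; rewrite /fm oppr0 itg_pt eqxx.
  exists n; split => // w0 w1 fw.
  have w1z : fm 1%N w0 w1 = 0.
    apply/eqP; rewrite eq_le fm0 andbT -fw; apply: itg_mono => //.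
    - exact: lint_Qcst.
    - exact: Q_ge0 Hc _.
    - by rewrite ler_nat.
  pose W := v0 * w1 - v1 * w0; pose N := v0 ^+ 2 + v1 ^+ 2 + w0 ^+ 2 + w1 ^+ 2.
  have W0 : W = 0.
    have : itg (- 1) 1 (fun=> W ^+ 2) <=
       itg (- 1) 1 (fun x => N * (Q (rcst v0 v1) (rcst v0 v1) x + Q (rcst w0 w1) (rcst w0 w1) x)).
      apply: le_itg; first exact: lint_cst.
        by apply: lintZ; apply: lintD; exact: lint_Qcst.
      move=> x _; have := wronskian_bound Hc (rcst v0 v1) (rcst w0 w1) x.
      by rewrite /wronskian /rcst.
    rewrite itg_cst; last by lra.
    rewrite itgZ; last by apply: lintD; exact: lint_Qcst.
    rewrite itgD; try exact: lint_Qcst.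
    move: f1 w1z; rewrite /fm => -> ->; rewrite addr0 mulr0 => h'.
    by apply/eqP; rewrite -sqrf_eq0 eq_le sqr_ge0 andbT; lra.
  pose s := (v0 * w0 + v1 * w1) / (v0 ^+ 2 + v1 ^+ 2).
  have e0 : w0 = s * v0.
    apply: (mulfI v_n0); rewrite /s mulrA mulrCA mulfV// mulr1.
    by apply/eqP; rewrite -subr_eq0 (_ : _ - _ = - v1 * W); [rewrite W0 mulr0|rewrite /W; ring].
  have e1 : w1 = s * v1.
    apply: (mulfI v_n0); rewrite /s mulrA mulrCA mulfV// mulr1.
    by apply/eqP; rewrite -subr_eq0 (_ : _ - _ = v0 * W); [rewrite W0 mulr0|rewrite /W; ring].
  have fs : fm n w0 w1 = s ^+ 2 * fm n v0 v1.
    by rewrite /fm !itg_Qcst e0 e1; ring.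
  have : s ^+ 2 = 0.
    by apply/eqP; move/eqP: fw; rewrite fs mulf_eq0 (negbTE fn) orbF.
  move=> /eqP; rewrite sqrf_eq0 => /eqP s0.
  by rewrite e0 e1 s0 !mul0r expr0n addr0.
pose X : R := n%:R; have X0 : 0 < X by rewrite ltr0n.
pose P := itg (- X) X p; pose S := itg (- X) X q; pose T := itg (- X) X r.
have fE v0 v1 : fm n v0 v1 = v0 ^+ 2 * P + 2 * v0 * v1 * S + v1 ^+ 2 * T by exact: itg_Qcst.
have P0 : 0 <= P by apply: itg_ge0 => x _; exact: coeff_p Hc x.
have T0 : 0 <= T by apply: itg_ge0 => x _; exact: coeff_r Hc x.
have PT : 0 < P + T.
  have [ip_ iq ir] := lint_pqr.
  rewrite /P /T -itgD// (_ : (fun x => _) = fun=> 1).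
    by rewrite itg_cst; lra.
  by apply/funext => x; exact: coeff_tr Hc x.
(* The form takes the values [P] and [T] times the determinant at the vectors [(S, -P)] and
   [(-T, S)]. *)
have dge : 0 <= P * T - S ^+ 2.
  have h := fm0 n S (- P); rewrite fE in h.
  have h2 := fm0 n (- T) S; rewrite fE in h2.
  have : 0 <= (P + T) * (P * T - S ^+ 2) by lra.
  by rewrite pmulr_rge0.
have dn0 : P * T - S ^+ 2 != 0.
  apply/negP => /eqP d0.
  have := inj S (- P); rewrite fE => h.
  have := inj (- T) S; rewrite fE => h2.
  have e1 : S ^+ 2 * P + 2 * S * - P * S + (- P) ^+ 2 * T = P * (P * T - S ^+ 2) by ring.
  have e2 : (- T) ^+ 2 * P + 2 * - T * S * S + S ^+ 2 * T = T * (P * T - S ^+ 2) by ring.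
  rewrite e1 d0 mulr0 in h; rewrite e2 d0 mulr0 in h2.
  have := h erefl; have := h2 erefl; rewrite !sqrrN => h3 h4.
  have [_ ?] : S = 0 /\ P = 0 by apply: sq0; rewrite h4.
  have [? _] : T = 0 /\ S = 0 by apply: sq0; rewrite h3.
  lra.
(* Determinant over trace bounds the smaller eigenvalue from below: after multiplication by the
   trace, the defect is [|A v|^2] for the integrated matrix [A]. *)
exists X, ((P * T - S ^+ 2) / (P + T)); split => //.
  by rewrite divr_gt0// lt_neqAle eq_sym dn0.
move=> v0 v1; rewrite mulrAC ler_pdivrMr// itg_Qcst -/P -/S -/T.
rewrite -subr_ge0 (_ : _ - _ = (P * v0 + S * v1) ^+ 2 + (S * v0 + T * v1) ^+ 2); last by ring.
by rewrite addr_ge0// sqr_ge0.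
Qed.

(** The null vector [v] is a solution with right-hand side 0 and norm 0. Its Wronskian with any [f]
    of the domain is constant and small at suitable far points, so it is 0, and [f] is everywhere
    parallel to [v]. *)
Lemma degenerate_trivial F G : degenerate -> relR F G -> ip F F = 0.
Proof.
move=> [v0 [v1 [vn0 av]]] h; have [F0 [l0 s0 e0]] := relR_core Hc h.
have [lF lG _] := h.
suff E k : IR (Q (F0 k) (F0 k)) = 0.
  rewrite (ip_split Hc)//.
  have eF k : IR (Q (F k) (F k)) = 0.
    rewrite e0// -(E k).
    have -> : Q (F0 k) (F k) = Q (F k) (F0 k) by apply/funext => x; exact: Q_sym.
    by rewrite e0.
  by rewrite !eF addr0.
pose v := rcst v0 v1; pose f := F0 k.
have sv : solves v (rcst 0 0).
  split; [apply: (eq_prim (prim_cst v0)) => x //|apply: (eq_prim (prim_cst v1)) => x //];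
  by rewrite /rcst; ring.
have mQ : measurable_fun [set: R] (Q v v) by exact: (lint_Qcst v0 v1).1.
have iZero : iR (fun _ : R => 0 : R).
  by split; [exact: measurable_cst|exact: integrable0].
have iQv : iR (Q v v) by apply: (ae_iR mQ iZero).
have pW := prim_wronskian (s0 k) sv.
have Wc a b : a <= b -> wronskian f v b = wronskian f v a.
  move=> ab; apply/eqP; rewrite -subr_eq0 (pW.2 _ _ ab); apply/eqP.
  rewrite (_ : itg a b _ = itg a b (fun=> 0)); first by rewrite itg_cst// mul0r.
  apply: ae_itg; [exact: pW.1.1|exact: measurable_cst|].
  apply: aeS av => x qv.
  have -> : Q f (rcst 0 0) x = 0 by rewrite /Submission.Q /rcst; ring.
  by rewrite Q_sym (Q_zero Hc)// subrr.
have [C C0 HC] := solves_growth Hc (lG k) (s0 k).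
pose Z x := Q f f x + Q v v x.
have iZ : iR Z by apply: iRD => //; exact: (l0 k).2.
have Z0 x : 0 <= Z x by rewrite addr_ge0// Q_ge0.
have W0 x : wronskian f v x = 0.
  apply/eqP; rewrite -sqrf_eq0 eq_le sqr_ge0 andbT; apply/ler_addgt0Pl => e e_gt0.
  rewrite addr0; pose D := C + v0 ^+ 2 + v1 ^+ 2 + 1.
  have vv : 0 <= v0 ^+ 2 + v1 ^+ 2 by rewrite addr_ge0// sqr_ge0.
  have D0 : 0 < D by rewrite /D; lra.
  have eD : 0 < e / D by rewrite divr_gt0.
  have [_ [b [_ Nb _ Hb]]] := iR_decay iZ Z0 `|x| eD.
  have xb : x <= b by rewrite (le_trans (ler_norm x)).
  rewrite -(Wc _ _ xb); apply: le_trans (wronskian_bound Hc f v b) _.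
  have b0 : 0 <= b by rewrite (le_trans _ Nb).
  apply: (@le_trans _ _ (D * ((1 + b) * Z b))).
    rewrite mulrA; apply: ler_wpM2r; first exact: Z0.
    have := HC b; rewrite (ger0_norm b0) /D -/f /v /rcst /=.
    have : 0 <= (v0 ^+ 2 + v1 ^+ 2) * b by rewrite mulr_ge0.
    by lra.
  by rewrite -ler_pdivlMl// [leRHS]mulrC ltW.
rewrite (_ : 0 = IR (fun=> 0)); last first.
  have e := IRZ 0 iZero; rewrite (mul0r (IR _)) in e.
  transitivity (IR (fun _ : R => 0 * 0 : R)); first by rewrite e.
  by congr IR; apply/funext => x; rewrite mul0r.
apply: ae_IR; [exact: (l0 k).2.1|exact: measurable_cst|].
apply: aeS av => x qv; apply: (mulfI (expf_neq0 2 vn0)); rewrite mulr0.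
have w := W0 x; rewrite /wronskian /v /rcst in w.
(* Expansion of [f] in the orthogonal basis [v], [J v]; every term but the first contains the
   Wronskian. *)
have -> : (v0 ^+ 2 + v1 ^+ 2) ^+ 2 * Q f f x =
   (f false x * v0 + f true x * v1) ^+ 2 * Q v v x +
   (f false x * v1 - f true x * v0) *
   (p x * v1 * (v1 * (f false x * v1 - f true x * v0) + 2 * v0 * (f false x * v0 + f true x * v1))
    + q x * (2 * (v1 ^+ 2 - v0 ^+ 2) * (f false x * v0 + f true x * v1) - 2 * v0 * v1 * (f false x * v1 - f true x * v0))
    + r x * v0 * (v0 * (f false x * v1 - f true x * v0) - 2 * v1 * (f false x * v0 + f true x * v1))).
  by rewrite /Submission.Q /v /rcst; ring.
by rewrite w mul0r addr0 -/v in qv *; rewrite qv mulr0.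
Qed.

End General.

(** * Existence and a priori bounds for the inhomogeneous system *)

Section ComplexSystem.
Context {R : realType}.
Local Notation mu := (@lebesgue_measure R).
Context (p q r : R -> R).
Context (Hc : coeff p q r).
Local Notation Q := (Q p q r).
Local Notation QQ := (QQ p q r).
Local Notation solves := (solves p q r).
Local Notation csolves := (csolves p q r).

(** The entries of [J H], since the system reads [f' = J H g]. [zcoef] is the real matrix of
    multiplication by [x + i y]; together they form a real system in four unknowns. *)
Let hcoef (c d : bool) (t : R) : R :=
  if c then (if d then q t else p t) else (if d then - r t else - q t).
Let zcoef (x y : R) (k l : bool) : R :=
  if k == l then x else if k then y else - y.

Lemma csystem_exists (x y : R) (U : @cvec R) (C : bool -> bool -> R) :
  (forall k c, measurable_fun [set: R] (U k c)) -> (forall k, lint (Q (U k) (U k))) ->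
  exists F, csolves F (clin 1 (zmul x y F) U) /\ forall k c, F k c 0 = C k c.
Proof.
move=> mU iU.
pose A (i j : bool * bool) (t : R) := hcoef i.2 j.2 t * zcoef x y i.1 j.1.
pose b (i : bool * bool) (t : R) := hcoef i.2 false t * U i.1 false t + hcoef i.2 true t * U i.1 true t.
have mh c d : measurable_fun [set: R] (hcoef c d).
  case: c; case: d; rewrite /hcoef /=.
  - exact: coeff_mq Hc.
  - exact: coeff_mp Hc.
  - by apply: measurableT_comp => //; exact: coeff_mr Hc.
  - by apply: measurableT_comp => //; exact: coeff_mq Hc.
have hb c d t : `|hcoef c d t| <= 1.
  case: c; case: d; rewrite /hcoef ?normrN.
  - exact: q_bound Hc t.
  - exact: p_bound Hc t.
  - exact: r_bound Hc t.
  - exact: q_bound Hc t.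
have zb k l : `|zcoef x y k l| <= `|x| + `|y|.
  rewrite /zcoef; have := normr_ge0 x; have := normr_ge0 y.
  by case: eqP => _; [|case: k; rewrite ?normrN]; lra.
have mA i j : measurable_fun [set: R] (A i j).
  by apply: measurable_funM; [exact: mh|exact: measurable_cst].
have AK i j t : `|A i j t| <= 1 * (`|x| + `|y|) by rewrite normrM ler_pM.
have ib i : lint (b i).
  have [h0 h1] := lint_Hg Hc (mU i.1) (iU i.1).
  case: i h0 h1 => k c /= h0 h1; rewrite /b /=; case: c; rewrite /hcoef //.
  have := lintN h0; congr lint; apply/funext => t; ring.
have [F HF] := linear_ode (fun i => C i.1 i.2) mA AK ib.
exists (fun k c => F (k, c)); split; last by move=> k c; have [] := HF (k, c).
have rhsE k c t : ode_rhs A b F (k, c) t =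
   hcoef c false t * clin 1 (zmul x y (fun k c => F (k, c))) U k false t +
   hcoef c true t * clin 1 (zmul x y (fun k c => F (k, c))) U k true t.
  rewrite /ode_rhs (eq_bigr (fun j => A (k, c) (j.1, j.2) t * F (j.1, j.2) t)); last by case.
  rewrite -(pair_bigA _ (fun l d => A (k, c) (l, d) t * F (l, d) t)) /=.
  rewrite !big_bool /= /A /b /= /clin /rlin /zmul /zcoef.
  by case: k => /=; ring.
move=> k; split.
  apply: (eq_prim (HF (k, false)).1) => // t; rewrite rhsE /hcoef; ring.
by apply: (eq_prim (HF (k, true)).1) => // t; rewrite rhsE.
Qed.

Lemma QQ_zmul x y F t : QQ (zmul x y F) (zmul x y F) t = (x ^+ 2 + y ^+ 2) * QQ F F t.
Proof. by rewrite /Submission.QQ /Submission.Q /zmul; ring. Qed.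

Lemma QQ_clin1_le F U t : QQ (clin 1 F U) (clin 1 F U) t <= 2 * QQ F F t + 2 * QQ U U t.
Proof.
have := QQ_ge0 Hc (clin (-1) F U) t; rewrite !QQ_lin2; lra.
Qed.

Lemma lint_QQ F G : (forall k c, continuous (F k c)) ->
  (forall k c, continuous (G k c)) -> lint (QQ F G).
Proof.
move=> cF cG; have [ip_ iq ir] := lint_pqr Hc.
have iM w (a b : R -> R) : lint w -> continuous a -> continuous b -> lint (fun t => w t * (a t * b t)).
  move=> iw ca cb.
  have -> : (fun t => w t * (a t * b t)) = fun t => a t * (b t * w t).
    by apply/funext => t; ring.
  by apply: lint_contM => //; exact: lint_contM.
have iQ k : lint (Q (F k) (G k)).
  have -> : Q (F k) (G k) = fun t => p t * (F k false t * G k false t) +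
      q t * (F k false t * G k true t) + q t * (F k true t * G k false t) +
      r t * (F k true t * G k true t) by apply/funext => t; rewrite /Submission.Q; ring.
  by do 3?apply: lintD; apply: iM.
by apply: lintD.
Qed.

Lemma lint_QQ_clin F U : (forall k c, measurable_fun [set: R] (F k c)) -> lint (QQ F F) ->
  (forall k c, measurable_fun [set: R] (U k c)) -> lint (QQ U U) ->
  lint (QQ (clin 1 F U) (clin 1 F U)).
Proof.
move=> mF iF mU iU.
apply: (lint_le _ (lintD (lintZ 2 iF) (lintZ 2 iU))).
  apply: measurable_funD; apply: (measurable_Q Hc) => c;
  by apply: measurable_funD => //; apply: measurable_funM.
by move=> t; rewrite ger0_norm ?QQ_clin1_le// QQ_ge0.
Qed.

Lemma lint_QQ_Q F k : (forall k c, measurable_fun [set: R] (F k c)) -> lint (QQ F F) ->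
  lint (Q (F k) (F k)).
Proof.
move=> mF iF; apply: (lint_le _ iF); first exact: (measurable_Q Hc).
move=> t; rewrite ger0_norm ?Q_ge0// /Submission.QQ; have := Q_ge0 Hc (F false) t; have := Q_ge0 Hc (F true) t.
by case: k; lra.
Qed.

(** On [[-X, X]] a solution stays within a controlled distance of its initial value, so the form of
    that constant vector is bounded by the data, and positive definiteness bounds the vector. [D] is
    uniform in [F] and [U], as compactness requires. *)
Lemma initial_value_bound X l x y B : 0 < X -> 0 < l ->
  (forall v0 v1, l * (v0 ^+ 2 + v1 ^+ 2) <= itg (- X) X (Q (rcst v0 v1) (rcst v0 v1))) ->
  exists D, forall F U, (forall k c, measurable_fun [set: R] (U k c)) -> lint (QQ U U) ->
    csolves F (clin 1 (zmul x y F) U) ->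
    itg (- X) X (QQ F F) <= B -> itg (- X) X (QQ U U) <= B ->
    forall k c, `|F k c 0| <= D.
Proof.
move=> X0 l0 Hl.
(* [B2] bounds the form of [z F + U], and [B3] the squared initial value; the final [1 + B3] avoids
   a square root. *)
pose B2 := 2 * (x ^+ 2 + y ^+ 2) * B + 2 * B.
pose B3 := (2 * B + 2 * (2 * X * B2) * (2 * X)) / l.
exists (1 + B3) => F U mU iU sF FB UB k c.
have cF k' c' : continuous (F k' c') by exact: solves_cont (sF k').
have mF k' c' : measurable_fun [set: R] (F k' c') by exact: continuous_measurable_fun.
have iF : lint (QQ F F) by exact: lint_QQ.
have cz k' c' : continuous (zmul x y F k' c').
  by case: k' => t; rewrite /zmul; [apply: cvgD|apply: cvgB]; apply: cvgM; (exact: cvg_cst || exact: cF).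
pose G := clin 1 (zmul x y F) U.
have mz k' c' : measurable_fun [set: R] (zmul x y F k' c') by exact: continuous_measurable_fun.
have mG k' c' : measurable_fun [set: R] (G k' c').
  by apply: measurable_funD => //; apply: measurable_funM.
have iz : lint (QQ (zmul x y F) (zmul x y F)) by exact: lint_QQ.
have iG : lint (QQ G G) by exact: lint_QQ_clin.
have XX : - X <= X by lra.
have GB : itg (- X) X (QQ G G) <= B2.
  apply: (@le_trans _ _ (itg (- X) X (fun t => 2 * (x ^+ 2 + y ^+ 2) * QQ F F t + 2 * QQ U U t))).
    apply: le_itg => //; first by apply: lintD; apply: lintZ.
    by move=> t _; apply: le_trans (QQ_clin1_le _ _ _) _; rewrite QQ_zmul; lra.
  rewrite itgD; [|exact: lintZ|exact: lintZ].
  rewrite itgZ// itgZ// /B2 lerD//; last by lra.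
  by rewrite ler_wpM2l// mulr_ge0// addr_ge0// sqr_ge0.
have iGk := lint_QQ_Q k mG iG.
have iFk := lint_QQ_Q k mF iF.
have GkB a b : - X <= a -> a <= b -> b <= X -> itg a b (Q (G k) (G k)) <= B2.
  move=> Xa ab bX; apply: le_trans GB.
  have h : itg a b (Q (G k) (G k)) <= itg a b (QQ G G).
    apply: le_itg => // t _; rewrite /Submission.QQ; have := Q_ge0 Hc (G false) t; have := Q_ge0 Hc (G true) t.
    by case: k {iGk iFk} => *; lra.
  apply: (le_trans h); rewrite (itg_cat iG Xa (le_trans ab bX)) (itg_cat iG ab bX).
  have := itg_ge0 (fun t (_ : - X <= t <= a) => QQ_ge0 Hc G t).
  have := itg_ge0 (fun t (_ : b <= t <= X) => QQ_ge0 Hc G t).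
  lra.
have B20 : 0 <= B2 by have := GkB X X XX (lexx _) (lexx _); rewrite itg_pt.
have dist t : - X <= t <= X ->
   (F k false t - F k false 0) ^+ 2 + (F k true t - F k true 0) ^+ 2 <= 2 * X * B2.
  move=> /andP[Xt tX]; have [t0|t0] := leP 0 t.
    apply: le_trans (solves_dist Hc (mG k) iGk (sF k) t0) _.
    rewrite subr0 -!mulrA ler_pM2l//.
    apply: ler_pM => //; last by apply: GkB => //; lra.
    by apply: itg_ge0 => s _; exact: Q_ge0.
  rewrite -(sqrrN (F k false t - _)) -(sqrrN (F k true t - _)) !opprB.
  apply: le_trans (solves_dist Hc (mG k) iGk (sF k) (ltW t0)) _.
  rewrite sub0r -!mulrA ler_pM2l//.
  apply: ler_pM => //; [lra| |lra|by apply: GkB => //; lra].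
  by apply: itg_ge0 => s _; exact: Q_ge0.
pose v0 := F k false 0; pose v1 := F k true 0.
have pt t : - X <= t <= X -> Q (rcst v0 v1) (rcst v0 v1) t <= 2 * Q (F k) (F k) t + 2 * (2 * X * B2).
  move=> Xt; have := dist t Xt; rewrite -/v0 -/v1 => D2.
  pose w : rvec := fun c t => F k c t - rcst v0 v1 c t.
  have Qw : Q w w t <= (F k false t - v0) ^+ 2 + (F k true t - v1) ^+ 2.
    rewrite -subr_ge0; apply: le_trans (form_ge0 Hc t (- w true t) (w false t)) _.
    have e : p t = 1 - r t by have := coeff_tr Hc t; lra.
    by rewrite le_eqVlt; apply/orP; left; apply/eqP; rewrite /Submission.Q /w /rcst e; ring.
  have h := Q_ge0 Hc (fun c t => w c t + F k c t) t.
  have : Q (rcst v0 v1) (rcst v0 v1) t = 2 * Q (F k) (F k) t + 2 * Q w w t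
     - Q (fun c t => w c t + F k c t) (fun c t => w c t + F k c t) t.
    by rewrite /Submission.Q /w; ring.
  by lra.
have : l * (v0 ^+ 2 + v1 ^+ 2) <= 2 * B + 2 * (2 * X * B2) * (2 * X).
  apply: le_trans (Hl v0 v1) _.
  apply: (@le_trans _ _ (itg (- X) X (fun t => 2 * Q (F k) (F k) t + 2 * (2 * X * B2)))).
    apply: le_itg; [exact: lint_Qcst Hc v0 v1|by apply: lintD; [exact: lintZ|exact: lint_cst]|].
    exact: pt.
  rewrite itgD; [|exact: lintZ|exact: lint_cst].
  rewrite itgZ// itg_cst// opprK.
  have -> : X + X = 2 * X by ring.
  rewrite lerD2r ler_pM2l//.
  apply: le_trans FB; apply: le_itg => // t _; rewrite /Submission.QQ.
  have := Q_ge0 Hc (F false) t; have := Q_ge0 Hc (F true) t.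
  by case: k {iGk iFk GkB dist v0 v1 pt} => *; lra.
rewrite mulrC -ler_pdivlMr// -/B3 => vB.
have aux (u : R) : u ^+ 2 <= B3 -> `|u| <= 1 + B3.
  move=> uB; rewrite ler_norml; have := sqr_ge0 (u - 1); have := sqr_ge0 (u + 1).
  by have := sqr_ge0 u => *; apply/andP; split; nra.
by apply: aux; have := sqr_ge0 v0; have := sqr_ge0 v1; rewrite /v0 /v1 in vB *; case: c => *; lra.
Qed.

End ComplexSystem.

Section Superposition.
Context {R : realType}.
Context (p q r : R -> R).
Context (Hc : coeff p q r).
Local Notation QQ := (QQ p q r).
Local Notation csolves := (csolves p q r).

Definition czero : @cvec R := fun _ _ _ => 0.

(** [F] plus the sum of the [C j * T j], nested so that the lemmas on [clin] apply term by term. The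
    four indices are the real components of an initial value. *)
Definition superpose (T : bool * bool -> @cvec R) (F : cvec) (C : bool * bool -> R) : cvec :=
  clin (C (true, true)) (clin (C (true, false)) (clin (C (false, true))
    (clin (C (false, false)) F (T (false, false))) (T (false, true)))
    (T (true, false))) (T (true, true)).

Lemma superposeE T F C k c t :
  superpose T F C k c t = F k c t + \sum_j C j * T j k c t.
Proof.
rewrite (eq_bigr (fun j => C (j.1, j.2) * T (j.1, j.2) k c t)); last by case.
rewrite -(pair_bigA _ (fun l d => C (l, d) * T (l, d) k c t)) /= !big_bool /=.
by rewrite /superpose /clin /rlin; ring.
Qed.

Lemma csolves_superpose T F C x y U :
  (forall j, csolves (T j) (clin 1 (zmul x y (T j)) czero)) ->
  csolves F (clin 1 (zmul x y F) U) ->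
  csolves (superpose T F C) (clin 1 (zmul x y (superpose T F C)) U).
Proof.
move=> sT sF.
have := csolves_lin (C (true, true)) (csolves_lin (C (true, false))
  (csolves_lin (C (false, true)) (csolves_lin (C (false, false)) sF (sT (false, false)))
  (sT (false, true))) (sT (true, false))) (sT (true, true)).
rewrite -/(superpose T F C); congr csolves.
apply/funext => k; apply/funext => c; apply/funext => t.
by rewrite /superpose /clin /rlin /zmul /czero; case: k; ring.
Qed.

Lemma csolves_zero x y : csolves czero (clin 1 (zmul x y czero) czero).
Proof.
move=> k; split; apply: (eq_prim (prim_cst 0)) => t //;
by rewrite /clin /rlin /zmul /czero; case: k; ring.
Qed.

Lemma QQ_zero t : QQ czero czero t = 0.
Proof. by rewrite /Submission.QQ /Submission.Q /czero; ring. Qed.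

Lemma QQ_clin_le s F G t : QQ (clin s F G) (clin s F G) t <= 2 * QQ F F t + 2 * s ^+ 2 * QQ G G t.
Proof.
have := QQ_ge0 Hc (clin (- s) F G) t; rewrite !QQ_lin2; lra.
Qed.

(** Each of the four nested sums doubles the bound, hence 16. *)
Lemma QQ_superpose_le T C e t : (forall j, `|C j| <= e) ->
  QQ (superpose T czero C) (superpose T czero C) t <=
  16 * e ^+ 2 * (QQ (T (false, false)) (T (false, false)) t + QQ (T (false, true)) (T (false, true)) t
    + QQ (T (true, false)) (T (true, false)) t + QQ (T (true, true)) (T (true, true)) t).
Proof.
move=> Ce; rewrite /superpose.
have Ce2 j : C j ^+ 2 <= e ^+ 2 by rewrite -real_normK ?num_real// ler_sqr ?nnegrE// (le_trans _ (Ce j)).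
have P j : 0 <= QQ (T j) (T j) t by exact: QQ_ge0.
have PC j : C j ^+ 2 * QQ (T j) (T j) t <= e ^+ 2 * QQ (T j) (T j) t by rewrite ler_wpM2r.
have PE j : 0 <= e ^+ 2 * QQ (T j) (T j) t by rewrite mulr_ge0// sqr_ge0.
set F1 := clin (C (false, false)) czero _; set F2 := clin (C (false, true)) F1 _.
set F3 := clin (C (true, false)) F2 _.
have h1 := QQ_clin_le (C (false, false)) czero (T (false, false)) t.
have h2 := QQ_clin_le (C (false, true)) F1 (T (false, true)) t.
have h3 := QQ_clin_le (C (true, false)) F2 (T (true, false)) t.
have h4 := QQ_clin_le (C (true, true)) F3 (T (true, true)) t.
rewrite QQ_zero in h1.
have := PC (false, false); have := PC (false, true); have := PC (true, false); have := PC (true, true).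
have := PE (false, false); have := PE (false, true); have := PE (true, false); have := PE (true, true).
rewrite -/F1 in h1; rewrite -/F2 in h2; rewrite -/F3 in h3.
lra.
Qed.

End Superposition.

(** * A priori bounds off the half-line *)

Section Resolvent.
Context {R : realType}.
Local Notation mu := (@lebesgue_measure R).
Context (phi : R -> R).
Context (phi_mono : forall x y, x <= y -> phi y <= phi x).
Context (alpha : R).
Context (phi_range : forall x, alpha <= phi x <= alpha + pi).
Local Notation p := (pP phi).
Local Notation q := (qP phi).
Local Notation r := (rP phi).
Local Notation Q := (Q p q r).
Local Notation QQ := (QQ p q r).
Local Notation csolves := (csolves p q r).
Local Notation L2c := (L2c p q r).
Local Notation relR := (relR p q r).
Local Notation ip := (ip p q r).
Local Notation degenerate := (degenerate p q r).
Let Hc : coeff p q r := coeffP phi_mono.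

Lemma interior_or_degenerate : (exists c, alpha < phi c < alpha + pi) \/ degenerate.
Proof.
have [h|h] := pselect (exists c, alpha < phi c < alpha + pi); [by left|right].
(* Orthogonal to [e_alpha], hence in the kernel of [P_phi] when [phi] takes only the values [alpha]
   and [alpha + pi]. *)
exists (- sin alpha), (cos alpha); split.
  by rewrite sqrrN addrC cos2Dsin2 oner_neq0.
apply: aeT => x; rewrite Q_phi /uphi /rcst.
have e : - sin alpha * cos (phi x) + cos alpha * sin (phi x) = sin (phi x - alpha) by rewrite sinB; ring.
rewrite e; have [pa|pa] : phi x = alpha \/ phi x = alpha + pi.
  have /andP[h1 h2] := phi_range x.
  have [->|n1] := eqVneq (phi x) alpha; first by left.
  have [->|n2] := eqVneq (phi x) (alpha + pi); first by right.
  by case: h; exists x; rewrite !lt_neqAle h1 h2 n2 eq_sym n1.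
  by rewrite pa subrr sin0 mulr0.
by rewrite pa addrC addKr sinpi mulr0.
Qed.

Lemma relR_pos F G : relR F G -> 0 <= ip F G.
Proof.
move=> h; have [lF lG _] := h.
have [[c Hi]|d] := interior_or_degenerate; last first.
  by rewrite (ip_zero Hc lF lG)// (degenerate_trivial Hc d h).
have [F0 [l0 s0 e0]] := relR_core Hc h.
rewrite (ip_split Hc)// !e0//.
by apply: addr_ge0; apply: (positivity_line phi_mono phi_range Hi).
Qed.

Lemma amgm_im F U (s t : R) : 0 < s ->
  `|Q (F false) (U true) t - Q (U false) (F true) t| <= s / 2 * QQ F F t + (2 * s)^-1 * QQ U U t.
Proof.
move=> s0; apply: le_trans (ler_normB _ _) _.
have := Q_amgm Hc (F false) (U true) t s0; have := Q_amgm Hc (F true) (U false) t s0.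
by rewrite (Q_sym _ _ _ (F true)) /Submission.QQ; lra.
Qed.

Lemma amgm_re F U (s t : R) : 0 < s ->
  `|QQ F U t| <= s / 2 * QQ F F t + (2 * s)^-1 * QQ U U t.
Proof.
move=> s0; apply: le_trans (ler_normD _ _) _.
have := Q_amgm Hc (F false) (U false) t s0; have := Q_amgm Hc (F true) (U true) t s0.
by rewrite /Submission.QQ; lra.
Qed.

Lemma Q_shift_im x y F U t : let G := clin 1 (zmul x y F) U in
  Q (F false) (G true) t - Q (G false) (F true) t =
  y * QQ F F t + (Q (F false) (U true) t - Q (U false) (F true) t).
Proof. by rewrite /= /Submission.QQ /Submission.Q /clin /rlin /zmul; ring. Qed.

Lemma QQ_shift x F U t : QQ F (clin 1 (zmul x 0 F) U) t = x * QQ F F t + QQ F U t.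
Proof. by rewrite /Submission.QQ /Submission.Q /clin /rlin /zmul; ring. Qed.

Let bound_arith (s A U W : R) : 0 < s -> `|W| <= s / 2 * A + (2 * s)^-1 * U ->
  s * A <= `|W| -> A <= s ^- 2 * U.
Proof.
move=> s0 h1 h2; rewrite ler_pdivlMl ?exprn_gt0//.
have := ler_wpM2l (ltW s0) (le_trans h2 h1).
have -> : s * (s / 2 * A + (2 * s)^-1 * U) = (s ^+ 2 * A + U) / 2 by field; rewrite lt0r_neq0.
by rewrite mulrA -expr2; lra.
Qed.

(* The imaginary part of the form gives the bound when [y != 0], its positivity
   when [x < 0]; both arguments also apply on a bounded interval with boundary
   conditions in the kernel of [H], with the same constant. *)
Lemma resolvent_bound x y : (y != 0) || (x < 0) -> exists K, 0 <= K /\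
  (forall F U, L2c F -> L2c U -> relR F (clin 1 (zmul x y F) U) -> ip F F <= K * ip U U) /\
  (forall F U X, (exists2 c, alpha < phi c < alpha + pi & - X <= c <= X) ->
     lint (QQ U U) -> (forall k c, measurable_fun [set: R] (U k c)) ->
     csolves F (clin 1 (zmul x y F) U) ->
     (forall k, uphi phi (F k) (- X) = 0 /\ uphi phi (F k) X = 0) ->
     itg (- X) X (QQ F F) <= K * itg (- X) X (QQ U U)).
Proof.
have normsq (s : R) : 0 <= s ^- 2 by rewrite invr_ge0 sqr_ge0.
have lintQ F (U : cvec) : (forall k c, continuous (F k c)) ->
    (forall k c, measurable_fun [set: R] (U k c)) -> lint (QQ F F) -> lint (QQ U U) ->
    [/\ lint (QQ F U) & lint (fun t => Q (F false) (U true) t - Q (U false) (F true) t)].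
  move=> cF mU iF iU.
  have mF k c : measurable_fun [set: R] (F k c) by exact: continuous_measurable_fun.
  have iB := lintD (lintZ (1 / 2) iF) (lintZ (2 * 1)^-1 iU).
  split; apply: (lint_le _ iB).
  - by apply: measurable_funD; exact: (measurable_Q Hc).
  - by move=> t; exact: amgm_re.
  - by apply: measurable_funB; exact: (measurable_Q Hc).
  - by move=> t; exact: amgm_im.
have [y0|y0] := eqVneq y 0.
  rewrite y0 /= => x0.
  have s0 : 0 < - x by lra.
  exists ((- x) ^- 2); split => //; split => [F U lF lU h|F U X [c Hi /andP[c1 c2]] iU mU sF bc].
    have lz := L2c_zmul Hc x 0 lF; have lG := L2c_lin Hc 1 lz lU.
    apply: (@bound_arith (- x) _ _ (ip F U)) => //.
      rewrite /ip -IRZ; last exact: iR_QQ.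
      rewrite -IRZ; last exact: iR_QQ.
      rewrite -IRD; try by apply: iRZ; exact: iR_QQ.
      have iFU := iR_QQ Hc lF lU.
      apply: le_trans (le_normr_Rintegral _ _) _ => //; first exact: iFU.2.
      apply: IR_le; [exact: iR_norm|by apply: iRD; apply: iRZ; exact: iR_QQ|].
      by move=> t; exact: amgm_re.
    have := relR_pos h.
    have -> : ip F (clin 1 (zmul x 0 F) U) = x * ip F F + ip F U.
      rewrite /ip -IRZ; last exact: iR_QQ.
      rewrite -IRD; [|by apply: iRZ; exact: iR_QQ|exact: iR_QQ].
      by congr IR; apply/funext => t; exact: QQ_shift.
    by have := ler_norm (ip F U); lra.
  have cF k d : continuous (F k d) by exact: solves_cont (sF k).
  have iF : lint (QQ F F) by exact: lint_QQ.
  have [iFU _] := lintQ F U cF mU iF iU.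
  apply: (@bound_arith (- x) _ _ (itg (- X) X (QQ F U))) => //.
    apply: le_trans (itg_norm _ _ iFU) _.
    rewrite -itgZ// -itgZ// -itgD; [|exact: lintZ|exact: lintZ].
    apply: le_itg; [exact: lint_norm|by apply: lintD; exact: lintZ|].
    by move=> t _; exact: amgm_re.
  have P k := positivity_bvp phi_mono phi_range Hi (sF k) c1 c2 (bc k).1 (bc k).2.
  have : 0 <= itg (- X) X (QQ F (clin 1 (zmul x 0 F) U)).
    by rewrite itgD ?addr_ge0//; exact: lint_Q_solves.
  have -> : QQ F (clin 1 (zmul x 0 F) U) = fun t => x * QQ F F t + QQ F U t.
    by apply/funext => t; exact: QQ_shift.
  rewrite itgD ?itgZ//; last exact: lintZ.
  by have := ler_norm (itg (- X) X (QQ F U)); lra.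
move=> _; have s0 : 0 < `|y| by rewrite normr_gt0.
exists (`|y| ^- 2); split => //; split => [F U lF lU h|F U X [c Hi /andP[c1 c2]] iU mU sF bc].
  have lz := L2c_zmul Hc x y lF; have lG := L2c_lin Hc 1 lz lU.
  have iD := iRB (iR_Q Hc (lF false) (lU true)) (iR_Q Hc (lU false) (lF true)).
  apply: (@bound_arith `|y| _ _ (IR (fun t => Q (F false) (U true) t - Q (U false) (F true) t))) => //.
    rewrite /ip -IRZ; last exact: iR_QQ.
    rewrite -IRZ; last exact: iR_QQ.
    rewrite -IRD; try by apply: iRZ; exact: iR_QQ.
    apply: le_trans (le_normr_Rintegral _ _) _ => //; first exact: iD.2.
    apply: IR_le; [exact: iR_norm|by apply: iRD; apply: iRZ; exact: iR_QQ|].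
    by move=> t; exact: amgm_im.
  have := relR_im Hc h.
  set G := clin 1 (zmul x y F) U in h lG *.
  have -> : Q (F true) (G false) = Q (G false) (F true) by apply/funext => t; exact: Q_sym.
  move=> /esym/eqP; rewrite -subr_eq0 -(IRB (iR_Q Hc (lF false) (lG true)) (iR_Q Hc (lG false) (lF true))).
  have -> : (fun t => Q (F false) (G true) t - Q (G false) (F true) t) =
     fun t => y * QQ F F t + (Q (F false) (U true) t - Q (U false) (F true) t).
    by apply/funext => t; exact: Q_shift_im.
  rewrite (IRD (iRZ y (iR_QQ Hc lF lF)) iD).
  rewrite IRZ; last exact: iR_QQ.
  rewrite addr_eq0 => /eqP e.
  by rewrite -[X in _ <= X]normrN -e normrM (ger0_norm (ip_ge0 Hc F)).
have cF k d : continuous (F k d) by exact: solves_cont (sF k).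
have iF : lint (QQ F F) by exact: lint_QQ.
have [_ iD] := lintQ F U cF mU iF iU.
apply: (@bound_arith `|y| _ _ (itg (- X) X (fun t => Q (F false) (U true) t - Q (U false) (F true) t))) => //.
  apply: le_trans (itg_norm _ _ iD) _.
  rewrite -itgZ// -itgZ// -itgD; [|exact: lintZ|exact: lintZ].
  apply: le_itg; [exact: lint_norm|by apply: lintD; exact: lintZ|].
  by move=> t _; exact: amgm_im.
have pW := prim_wronskian (sF false) (sF true).
(* Two vectors orthogonal to the same [e_phi] are parallel, so the boundary condition kills the
   Wronskian at both ends. *)
have W0 t : uphi phi (F false) t = 0 -> uphi phi (F true) t = 0 -> wronskian (F false) (F true) t = 0.
  rewrite /uphi /wronskian => e1 e2.
  rewrite -[LHS]mul1r -(cos2Dsin2 (phi t)).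
  transitivity (cos (phi t) * ((F false false t * cos (phi t) + F false true t * sin (phi t)) * F true true t
      - F false true t * (F true false t * cos (phi t) + F true true t * sin (phi t)))
    + sin (phi t) * (F false false t * (F true false t * cos (phi t) + F true true t * sin (phi t))
      - F true false t * (F false false t * cos (phi t) + F false true t * sin (phi t)))).
    ring.
  by rewrite e1 e2; ring.
have XX : - X <= X by exact: le_trans c2.
have := pW.2 _ _ XX.
have [b1 b2] := bc false; have [b3 b4] := bc true.
rewrite W0// W0// subrr.
have -> : (fun t => Q (F false) (clin 1 (zmul x y F) U true) t - Q (clin 1 (zmul x y F) U false) (F true) t) =
    fun t => y * QQ F F t + (Q (F false) (U true) t - Q (U false) (F true) t).
  by apply/funext => t; exact: Q_shift_im.
rewrite (itgD _ _ (lintZ y iF) iD) itgZ// => /esym/eqP; rewrite addr_eq0 => /eqP e.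
rewrite -[X in _ <= X]normrN -e normrM (ger0_norm (itg_ge0 _))//.
by move=> t _; exact: QQ_ge0.
Qed.

End Resolvent.

(** * Surjectivity by truncation and compactness *)

Section Surjectivity.
Context {R : realType}.
Local Notation mu := (@lebesgue_measure R).
Context (phi : R -> R).
Context (phi_mono : forall x y, x <= y -> phi y <= phi x).
Context (alpha : R).
Context (phi_range : forall x, alpha <= phi x <= alpha + pi).
Local Notation p := (pP phi).
Local Notation q := (qP phi).
Local Notation r := (rP phi).
Local Notation Q := (Q p q r).
Local Notation QQ := (QQ p q r).
Local Notation csolves := (csolves p q r).
Local Notation L2c := (L2c p q r).
Local Notation relR := (relR p q r).
Local Notation ip := (ip p q r).
Local Notation degenerate := (degenerate p q r).
Let Hc : coeff p q r := coeffP phi_mono.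

Lemma uphi_superpose T F C k t :
  uphi phi (superpose T F C k) t = uphi phi (F k) t + \sum_j uphi phi (T j k) t * C j.
Proof.
rewrite /uphi !superposeE !mulrDl !mulr_suml addrACA -big_split /=.
by congr (_ + _); apply: eq_bigr => j _; ring.
Qed.

(* Cluster point of the solutions of boundary value problems on growing intervals. *)
Lemma resolvent_solution x y U : (y != 0) || (x < 0) -> ~ degenerate -> L2c U ->
  exists F, L2c F /\ relR F (clin 1 (zmul x y F) U).
Proof.
move=> xy nd lU.
have [[c Hi]|//] := interior_or_degenerate phi_range.
have [K [K0 [_ HK]]] := resolvent_bound phi_mono phi_range xy.
have [X [l [X0 l0 Hl]]] := nondegenerate_pd Hc nd.
have mU k d : measurable_fun [set: R] (U k d) by exact: (lU k).1.
have iUU : lint (QQ U U) by apply: iR_lint; exact: iR_QQ.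
have iU k : lint (Q (U k) (U k)) by apply: iR_lint; exact: (lU k).2.
have mz (k d : bool) : measurable_fun [set: R] (@czero R k d) by exact: measurable_cst.
have Qz k : Q (@czero R k) (czero k) = fun _ => 0.
  by apply/funext => t; rewrite /Submission.Q /czero; ring.
have iz k : lint (Q (@czero R k) (czero k)) by rewrite Qz; exact: lint_cst.
have QQz : QQ (@czero R) czero = fun _ => 0 by apply/funext => t; exact: QQ_zero.
have izz : lint (QQ (@czero R) czero) by rewrite QQz; exact: lint_cst.
(* A particular solution vanishing at 0 and, in [T], four fundamental solutions: the coefficients
   [C] of a superposition are its initial values. *)
have [Fp0 Fp0E] : exists Fp, csolves Fp (clin 1 (zmul x y Fp) U) /\ forall k d, Fp k d 0 = 0.
  exact: (csystem_exists Hc x y (fun _ _ => 0) mU iU).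
have HT (j : bool * bool) : exists T, csolves T (clin 1 (zmul x y T) czero) /\
    forall k d, T k d 0 = ((k, d) == j)%:R.
  exact: (csystem_exists Hc x y (fun k d => ((k, d) == j)%:R) mz iz).
have {HT}[T HT] := choice HT.
have sT j := (HT j).1.
have init F C k d : superpose T F C k d 0 = F k d 0 + C (k, d).
  rewrite superposeE; congr (_ + _); rewrite (bigD1 (k, d))//= (HT _).2 eqxx mulr1 big1 ?addr0// => j jn.
  by rewrite (HT _).2 eq_sym (negbTE jn) mulr0.
pose B := (K + 1) * ip U U.
have U0 := ip_ge0 Hc U.
have itgU a b : itg a b (QQ U U) <= ip U U.
  by apply: itg_le_IR; [exact: iR_QQ|exact: QQ_ge0].
(* [D] is for the right-hand side [U], [D'] for the homogeneous problem. [D'] need not be 0, but it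
   bounds every multiple of a homogeneous solution and so forces it to vanish. *)
have [D HD] := initial_value_bound Hc x y B X0 l0 Hl.
have [D' HD'] := initial_value_bound Hc x y 0 X0 l0 Hl.
have cS F : csolves F (clin 1 (zmul x y F) U) -> forall k d, continuous (F k d).
  by move=> s k d; exact: solves_cont (s k).
(* The boundary value problem on [[- n, n]] is solvable because the a priori
   bound makes its homogeneous version uniquely solvable. *)
have bvp (n : R) : X <= n -> `|c| <= n -> exists C,
    itg (- n) n (QQ (superpose T Fp0 C) (superpose T Fp0 C)) <= K * ip U U /\
    forall k d, `|C (k, d)| <= D.
  move=> Xn cn.
  have cn' : - n <= c <= n by rewrite -ler_norml.
  pose pt (s : bool) := if s then n else - n.
  pose M (i j : bool * bool) := uphi phi (T j i.1) (pt i.2).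
  have inj (C : bool * bool -> R) : (forall i, \sum_j M i j * C j = 0) -> forall j, C j = 0.
    move=> MC.
    have HC s j : `|s * C j| <= D'.
      pose F := superpose T (@czero R) (fun j => s * C j).
      have sF : csolves F (clin 1 (zmul x y F) czero).
        by apply: csolves_superpose => //; exact: csolves_zero.
      have bc k u : uphi phi (F k) (pt u) = 0.
        rewrite uphi_superpose {1}/uphi /czero !mul0r addr0 add0r.
        transitivity (s * \sum_j M (k, u) j * C j); last by rewrite MC mulr0.
        by rewrite mulr_sumr; apply: eq_bigr => i _; rewrite /M; ring.
      have := HK F czero n (ex_intro2 _ _ c Hi cn') izz mz sF; rewrite QQz.
      rewrite (_ : itg (- n) n (fun=> 0) = 0); last first.
        by rewrite itg_cst ?mul0r//; lra.
      rewrite mulr0 => Fn.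
      have {}Fn : itg (- n) n (QQ F F) <= 0.
        by apply: Fn => k; split; [exact: bc k false|exact: bc k true].
      case: j => k d.
      have <- : F k d 0 = s * C (k, d) by rewrite /F init /czero add0r.
      apply: (HD' F czero mz izz sF).
        apply: le_trans Fn; apply: itg_mono => //; [|exact: QQ_ge0|exact: ltW].
        by apply: lint_QQ => // k' d'; exact: solves_cont (sF k').
      by rewrite QQz itg_cst ?mul0r//; lra.
    move=> j; apply/eqP; apply: contraT => Cn.
    have := HC ((`|D'| + 1) / C j) j; rewrite divfK// => h.
    have := ler_norm (`|D'| + 1); have := ler_norm D'; lra.
  have [C HC] := linear_solvable inj (fun i => - uphi phi (Fp0 i.1) (pt i.2)).
  exists C; set F := superpose T Fp0 C.
  have sF : csolves F (clin 1 (zmul x y F) U).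
    by apply: csolves_superpose => //; exact: Fp0E.1.
  have bc k u : uphi phi (F k) (pt u) = 0.
    by rewrite uphi_superpose (HC (k, u)) /= subrr.
  have FB : itg (- n) n (QQ F F) <= K * ip U U.
    have := HK F U n (ex_intro2 _ _ c Hi cn') iUU mU sF.
    move=> /(_ (fun k => conj (bc k false) (bc k true))) /le_trans; apply.
    by rewrite ler_wpM2l.
  split => // k d.
  have <- : F k d 0 = C (k, d) by rewrite /F init Fp0E.2 add0r.
  apply: (HD F U mU iUU sF).
    apply: le_trans (_ : _ <= itg (- n) n (QQ F F)) _.
      apply: itg_mono => //; [|exact: QQ_ge0|exact: ltW].
      by apply: lint_QQ => //; exact: cS sF.
    by apply: (le_trans FB); rewrite /B mulrDl mul1r lerDl.
  by apply: (le_trans (itgU _ _)); rewrite /B mulrDl mul1r lerDr mulr_ge0.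
pose N0 : nat := (Num.truncn (X + `|c|)).+1.
have N0E : X + `|c| < N0%:R by exact: Num.Theory.truncnS_gt.
have bvpn (n : nat) : exists C,
    itg (- (N0 + n)%:R) (N0 + n)%:R (QQ (superpose T Fp0 C) (superpose T Fp0 C)) <= K * ip U U /\
    forall i, `|C i| <= D.
  have [||C [h1 h2]] := bvp (N0 + n)%:R.
  - by rewrite natrD; have := normr_ge0 c; have := ler0n R n; lra.
  - by rewrite natrD; have := ler0n R n; lra.
  - by exists C; split => // -[k d].
have {bvpn}[Cn HCn] := choice bvpn.
have [C HC] := bounded_cluster (fun n i => (HCn n).2 i).
pose F := superpose T Fp0 C.
have sF : csolves F (clin 1 (zmul x y F) U).
  by apply: csolves_superpose => //; exact: Fp0E.1.
have iF : lint (QQ F F) by apply: lint_QQ => //; exact: cS sF.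
(* On a fixed interval [F] is compared with a late truncated solution, which obeys the a priori
   bound on a larger interval; the difference has small coefficients. Since the bound is independent
   of [m], [F] is square integrable. *)
have FB (m : nat) : itg (- m%:R) m%:R (QQ F F) <= 2 * (K * ip U U) + 1.
  pose S t := QQ (T (false, false)) (T (false, false)) t + QQ (T (false, true)) (T (false, true)) t
    + QQ (T (true, false)) (T (true, false)) t + QQ (T (true, true)) (T (true, true)) t.
  have iS : lint S.
    have iT j : lint (QQ (T j) (T j)) by apply: lint_QQ => // k d; exact: solves_cont (sT j k).
    exact: (lintD (lintD (lintD (iT _) (iT _)) (iT _)) (iT _)).
  pose k := itg (- m%:R) m%:R S.
  have k0 : 0 <= k.
    apply: itg_ge0 => t _; have P j := QQ_ge0 Hc (T j) t.
    exact: (addr_ge0 (addr_ge0 (addr_ge0 (P _) (P _)) (P _)) (P _)).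
  (* The difference contributes [32 e^2 k], twice the bound of [QQ_superpose_le], and this is at
     most 1. *)
  pose e := (1 + 32 * k)^-1.
  have e0 : 0 < e by rewrite invr_gt0; lra.
  have e1 : e <= 1 by rewrite invf_le1; lra.
  have ek : 32 * e ^+ 2 * k <= 1.
    apply: (@le_trans _ _ (32 * e * k)).
      by apply: ler_wpM2r => //; apply: ler_wpM2l => //; rewrite expr2 ler_piMl// ltW.
    by rewrite /e mulrAC ler_pdivrMr; lra.
  have [n mn HCe] := HC e e0 m.
  pose Fn := superpose T Fp0 (Cn n).
  pose Dl := superpose T (@czero R) (fun j => C j - Cn n j).
  have FE : F = clin 1 Fn Dl.
    apply/funext => k'; apply/funext => d; apply/funext => t.
    rewrite /F /Fn /Dl /clin /rlin !superposeE /czero add0r mul1r -addrA -big_split/=.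
    by congr (_ + _); apply: eq_bigr => j _; ring.
  have sFn : csolves Fn (clin 1 (zmul x y Fn) U).
    by apply: csolves_superpose => //; exact: Fp0E.1.
  have iFn : lint (QQ Fn Fn) by apply: lint_QQ => //; exact: cS sFn.
  apply: (@le_trans _ _ (itg (- m%:R) m%:R (fun t => 2 * QQ Fn Fn t + 32 * e ^+ 2 * S t))).
    apply: le_itg => //; first by apply: lintD; apply: lintZ.
    move=> t _; rewrite FE; apply: le_trans (QQ_clin1_le Hc _ _ _) _.
    have := @QQ_superpose_le _ _ _ _ Hc T (fun j => C j - Cn n j) e t (fun j => ltW (HCe j)).
    by rewrite -/Dl -/(S t); lra.
  rewrite itgD; [|exact: lintZ|exact: lintZ].
  rewrite itgZ// itgZ// lerD// ler_pM2l//.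
  apply: le_trans (HCn n).1; apply: itg_mono => //; first exact: QQ_ge0.
  by rewrite ler_nat (leq_trans mn)// leq_addl.
have [iRF _] := iR_itg iF (QQ_ge0 Hc F) FB.
have lF : L2c F.
  move=> k; split; first by move=> d; apply: continuous_measurable_fun; exact: cS sF k d.
  apply: (iR_le _ iRF).
    by apply: (measurable_Q Hc) => d; apply: continuous_measurable_fun; exact: cS sF k d.
  move=> t; rewrite ger0_norm ?Q_ge0// /Submission.QQ.
  have := Q_ge0 Hc (F false) t; have := Q_ge0 Hc (F true) t.
  by case: k; lra.
exists F; split => //; split => //.
  by apply: L2c_lin => //; exact: L2c_zmul.
exists F; split => //; apply: aeT => t; rewrite QQ_lin2; lra.
Qed.

End Surjectivity.

(** * Non-negative form implies monotone phase *)

Section LebesguePoints.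
Context {R : realType}.
Local Notation mu := (@lebesgue_measure R).
Implicit Types (Z : R -> R) (a b x : R).

Lemma eq_itg_oo Z1 Z2 a b : lint Z1 -> lint Z2 ->
  (forall y, a < y < b -> Z1 y = Z2 y) -> itg a b Z1 = itg a b Z2.
Proof.
move=> i1 i2 E.
have oo Z : lint Z -> itg a b Z = \int[mu]_(y in `]a, b[%classic) Z y.
  move=> [_ iZ]; rewrite /itg -Rintegral_itv_bndo_bndc; last first.
    by apply: integrableS (iZ a b) => // y; rewrite /= !in_itv/= => /andP[-> /ltW].
  rewrite -Rintegral_itv_obnd_cbnd//.
  by apply: integrableS (iZ a b) => // y; rewrite /= !in_itv/= => /andP[/ltW -> /ltW].
rewrite !oo//; apply: eq_Rintegral => y; rewrite inE/= in_itv/=; exact: E.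
Qed.

Lemma iR_support Z a b : lint Z -> (forall y, ~~ (a <= y <= b) -> Z y = 0) ->
  iR Z /\ IR Z = itg a b Z.
Proof.
move=> [mZ iZ] Z0.
have ZE : Z \_ `[a, b] = Z.
  apply/funext => y; rewrite patchE; case: ifPn => //; rewrite notin_setE/= in_itv/= => h.
  by rewrite Z0//; apply/negP.
split.
  split => //; have := iZ a b; rewrite integrable_mkcond//.
  by rewrite restrict_EFin ZE.
by rewrite /itg Rintegral_mkcond ZE.
Qed.

(** One-sided, because the paths below start at [x] and use [H] only to its right. *)
Definition lpt Z x := forall e, 0 < e -> exists2 h0, 0 < h0 &
  forall h, 0 < h -> h < h0 -> itg x (x + h) (fun y => `|Z y - Z x|) <= e * h.

Lemma ae_lpt Z : lint Z -> {ae mu, forall x : R, lpt Z x}.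
Proof.
move=> iZ.
have lZ : locally_integrable [set: R] Z.
  split; [exact: iZ.1|exact: openT|move=> K _ cK].
  have [M [_ HM]] := compact_bounded cK.
  have Kab : K `<=` `[- (M + 1), M + 1]%classic.
    by move=> y /(HM (M + 1)) h; rewrite /= in_itv/= -ler_norml; apply: h; rewrite ltrDl.
  have /integrableP[_] := iZ.2 (- (M + 1)) (M + 1).
  apply: le_lt_trans; apply: ge0_subset_integral => //.
  - exact: compact_measurable.
  - apply/measurable_EFinP; apply: measurable_funTS.
    by apply: measurableT_comp => //; exact: iZ.1.
apply: aeS (lebesgue_differentiation lZ) => x Lx e e0.
(* [[x, x + h]] lies in the ball of radius [2 h], whose measure is [4 h]. *)
have e4 : (0 < e / 4)%R by lra.
have nS : nbhs (0%:E : \bar R) [set z : \bar R | (z < (e / 4)%:E)%E].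
  by apply: open_nbhs_nbhs; split; [exact: open_ereal_lt_ereal|rewrite /= lte_fin].
have : \forall t \near (0 : R)^'+, (davg Z x t < (e / 4)%:E)%E := Lx _ nS.
rewrite /at_right near_withinE => /nbhs_ballP[h1 /= h10 Hh].
exists (h1 / 2); first by lra.
move=> h h0 hh1.
have h2 : (0 < 2 * h)%R by lra.
have := Hh (2 * h)%R; rewrite /ball/= sub0r normrN gtr0_norm// => /(_ _ h2).
have hlt : (2 * h < h1)%R by lra.
move=> /(_ hlt); rewrite /davg /iavg lebesgue_measure_ball; last exact: ltW.
have h4 : (2 * h) *+ 2 = 4 * h by rewrite -mulr_natr; ring.
have h40 : 0 < 4 * h by lra.
rewrite h4 inver gt_eqF// lte_pdivrMl// -EFinM.
have -> : 4 * h * (e / 4) = e * h by field.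
move=> Hlt; rewrite -lee_fin; apply: le_trans (ltW Hlt).
have iD : lint (fun y => `|Z y - Z x|) by apply: lint_norm; apply: lintB => //; exact: lint_cst.
rewrite /itg /Rintegral fineK; last by apply: integrable_fin_num => //; exact: iD.2.
apply: ge0_subset_integral => //.
- exact: measurable_ball.
- by apply/measurable_EFinP; apply: measurable_funTS; exact: iD.1.
- move=> y; rewrite /= in_itv/= => /andP[xy yxh]; rewrite /ball/= ltr_norml; apply/andP; split; lra.
Qed.

End LebesguePoints.

(** * Paths with velocity in the range of the coefficient *)

Section Paths.
Context {R : realType}.
Local Notation mu := (@lebesgue_measure R).
Context (p q r : R -> R).
Context (Hc : coeff p q r).
Local Notation Q := (Q p q r).
Local Notation solves := (solves p q r).
Local Notation L2r := (L2r p q r).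

Definition Hg0 (g : @rvec R) x := p x * g false x + q x * g true x.
Definition Hg1 (g : @rvec R) x := q x * g false x + r x * g true x.

(* A planar path with velocity in the range of [H], travelled during [s, t],
   with total displacement [(d0, d1)] and twice the signed area [A] between
   the path and the origin. *)
Definition path s t d0 d1 A := exists (g : rvec) (F0 F1 : R -> R) M, [/\
  (forall c, measurable_fun [set: R] (g c)),
  (forall c y, `|g c y| <= M) /\ (forall c y, ~~ (s < y < t) -> g c y = 0),
  prim F0 (Hg0 g) /\ prim F1 (Hg1 g),
  (forall y, y <= s -> F0 y = 0 /\ F1 y = 0) /\
  (forall y, t <= y -> F0 y = d0 /\ F1 y = d1) &
  IR (fun y => F0 y * Hg1 g y - F1 y * Hg0 g y) = A].

Lemma path_area_iR s t g F0 F1 : (forall c y, ~~ (s < y < t) -> g c y = 0) ->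
  prim F0 (Hg0 g) -> prim F1 (Hg1 g) ->
  lint (fun y => F0 y * Hg1 g y - F1 y * Hg0 g y) /\
  iR (fun y => F0 y * Hg1 g y - F1 y * Hg0 g y) /\
  IR (fun y => F0 y * Hg1 g y - F1 y * Hg0 g y) =
    itg s t (fun y => F0 y * Hg1 g y - F1 y * Hg0 g y).
Proof.
move=> g0 p0 p1.
have iA : lint (fun y => F0 y * Hg1 g y - F1 y * Hg0 g y).
  by apply: lintB; apply: lint_contM; (exact: prim_cont p0 || exact: prim_cont p1 || exact: p0.1 || exact: p1.1).
split => //; apply: iR_support => // y sy.
have n : ~~ (s < y < t) by apply: contra sy => /andP[/ltW -> /ltW ->].
by rewrite /Hg0 /Hg1 !g0//; ring.
Qed.

Lemma path_zero s t : path s t 0 0 0.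
Proof.
exists (fun _ _ => 0), (fun=> 0), (fun=> 0), 0.
have P0 : prim (fun=> 0) (Hg0 (fun _ _ => 0)).
  by apply: (eq_prim (prim_cst 0)) => // y; rewrite /Hg0; ring.
have P1 : prim (fun=> 0) (Hg1 (fun _ _ => 0)).
  by apply: (eq_prim (prim_cst 0)) => // y; rewrite /Hg1; ring.
split => //.
- by split => // c y; rewrite normr0.
- have [_ [_ ->]] := path_area_iR (s := 0) (t := 0) (fun _ _ _ => erefl) P0 P1.
  exact: itg_pt.
Qed.

Lemma path_scale c s t d0 d1 A : path s t d0 d1 A -> path s t (c * d0) (c * d1) (c ^+ 2 * A).
Proof.
move=> [g [F0 [F1 [M [mg [gM g0] [p0 p1] [Fs Ft] AE]]]]].
exists (fun k y => c * g k y), (fun y => c * F0 y), (fun y => c * F1 y), (`|c| * M).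
split.
- by move=> k; exact: measurable_funM.
- by split => k y; [rewrite normrM ler_wpM2l|move=> /g0 ->; rewrite mulr0].
- split; [apply: (eq_prim (primZ c p0))|apply: (eq_prim (primZ c p1))] => y //;
  by rewrite /Hg0 /Hg1; ring.
- split => y h; [have [-> ->] := Fs y h|have [-> ->] := Ft y h] => //.
  by rewrite mulr0.
- have [_ [iA _]] := path_area_iR g0 p0 p1.
  rewrite -AE -IRZ//.
  by congr IR; apply/funext => y; rewrite /Hg0 /Hg1; ring.
Qed.

(** The second path is translated by the displacement of the first, which adds the cross product of
    the two displacements to the area. *)
Lemma path_cat a b c d0 d1 A e0 e1 B : a <= b -> b <= c ->
  path a b d0 d1 A -> path b c e0 e1 B ->
  path a c (d0 + e0) (d1 + e1) (A + B + (d0 * e1 - d1 * e0)).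
Proof.
move=> ab bc [g [F0 [F1 [M [mg [gM g0] [p0 p1] [Fs Ft] AE]]]]]
  [k [K0 [K1 [N [mk [kN k0] [q0 q1] [Ks Kt] BE]]]]].
exists (fun c y => g c y + k c y), (fun y => F0 y + K0 y), (fun y => F1 y + K1 y), (M + N).
have [_ [iA _]] := path_area_iR g0 p0 p1.
have [_ [iB _]] := path_area_iR k0 q0 q1.
have iK : iR (Hg0 k) /\ IR (Hg0 k) = e0.
  have [|h1 h2] := @iR_support _ (Hg0 k) b c q0.1.
    move=> y by_; have n : ~~ (b < y < c) by apply: contra by_ => /andP[/ltW -> /ltW ->].
    by rewrite /Hg0 !k0//; ring.
  by split => //; rewrite h2 -(q0.2 _ _ bc) (Kt _ (lexx _)).1 (Ks _ (lexx _)).1 subr0.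
have iK1 : iR (Hg1 k) /\ IR (Hg1 k) = e1.
  have [|h1 h2] := @iR_support _ (Hg1 k) b c q1.1.
    move=> y by_; have n : ~~ (b < y < c) by apply: contra by_ => /andP[/ltW -> /ltW ->].
    by rewrite /Hg1 !k0//; ring.
  by split => //; rewrite h2 -(q1.2 _ _ bc) (Kt _ (lexx _)).2 (Ks _ (lexx _)).2 subr0.
split.
- by move=> x; exact: measurable_funD.
- split => x y; first by rewrite (le_trans (ler_normD _ _))// lerD.
  move=> n; rewrite g0 ?k0 ?addr0//; apply: contra n => /andP[h1 h2].
    by rewrite (le_lt_trans ab h1) h2.
  by rewrite h1 (lt_le_trans h2 bc).
- split; [apply: (eq_prim (primD p0 q0))|apply: (eq_prim (primD p1 q1))] => y //;
  by rewrite /Hg0 /Hg1; ring.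
- split => y h.
    have [-> ->] := Fs y h; have [-> ->] := Ks y (le_trans h ab).
    by rewrite addr0.
  by have [-> ->] := Ft y (le_trans bc h); have [-> ->] := Kt y h.
- rewrite -AE -BE -iK.2 -iK1.2 -!IRZ; [|exact: iK.1|exact: iK1.1].
  rewrite -IRD// -IRB; [|exact: iRZ _ iK1.1|exact: iRZ _ iK.1].
  rewrite -IRD; [|exact: iRD|by apply: iRB; [exact: iRZ _ iK1.1|exact: iRZ _ iK.1]].
  congr IR; apply/funext => y; rewrite /Hg0 /Hg1; have [yb|yb] := leP b y.
    have n : ~~ (a < y < b) by rewrite negb_and -!leNgt yb orbT.
    by rewrite !g0//; have [-> ->] := Ft y yb; ring.
  have n : ~~ (b < y < c) by rewrite negb_and -!leNgt (ltW yb).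
  by rewrite !k0//; have [-> ->] := Ks y (ltW yb); ring.
Qed.

Context (form_pos : forall f g, L2r f -> L2r g -> solves f g -> 0 <= IR (Q f g)).

Lemma Q_euclid f y : `|Q f f y| <= f false y ^+ 2 + f true y ^+ 2.
Proof.
rewrite ger0_norm ?Q_ge0// -subr_ge0.
apply: le_trans (form_ge0 Hc y (- f true y) (f false y)) _.
have e : p y = 1 - r y by have := coeff_tr Hc y; lra.
by rewrite le_eqVlt; apply/orP; left; apply/eqP; rewrite /Submission.Q e; ring.
Qed.

Lemma closed_path_area s t A : path s t 0 0 A -> 0 <= A.
Proof.
move=> [g [F0 [F1 [M [mg [gM g0] [p0 p1] [Fs Ft] <-]]]]].
(* [f = J F]: the quarter turn converts [F' = H g] into [J f' = - H g], and the form becomes the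
   area density. *)
pose f : rvec := fun c y => if c then F0 y else - F1 y.
have out y : ~~ (s <= y <= t) -> [/\ F0 y = 0, F1 y = 0 & forall c, g c y = 0].
  move=> n; have n' : ~~ (s < y < t) by apply: contra n => /andP[/ltW -> /ltW ->].
  move: n; rewrite negb_and -!ltNge => /orP[/ltW h|/ltW h].
    by have [-> ->] := Fs y h; split => // c; rewrite g0.
  by have [-> ->] := Ft y h; split => // c; rewrite g0.
have cf c : continuous (f c).
  by case: c => y; [exact: prim_cont p0 y|apply: cvgN; exact: prim_cont p1 y].
have sf : solves f g.
  by split; [apply: (eq_prim (primN p1))|apply: (eq_prim p0)] => y.
have lf : L2r f.
  split; first by move=> c; exact: continuous_measurable_fun.
  have iQ : lint (Q f f).
    have [M0 HM0] := cont_bounded (cf false) s t; have [M1 HM1] := cont_bounded (cf true) s t.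
    apply: (lint_bounded_cst (K := (`|M0| ^+ 2 + `|M1| ^+ 2) + (`|M0| ^+ 2 + `|M1| ^+ 2))).
      by apply: (measurable_Q Hc) => c; exact: continuous_measurable_fun.
    move=> y; case: (boolP (s <= y <= t)) => [sy|/out[e0 e1 _]]; last first.
      have -> : Q f f y = 0 by rewrite /Submission.Q /f e0 e1; ring.
      by rewrite normr0; have := sqr_ge0 `|M0|; have := sqr_ge0 `|M1|; lra.
    apply: (le_trans (Q_euclid f y)).
    have a0 : f false y ^+ 2 <= `|M0| ^+ 2.
      by rewrite -real_normK ?num_real// ler_sqr ?nnegrE// (le_trans (HM0 _ sy)) ?ler_norm.
    have a1 : f true y ^+ 2 <= `|M1| ^+ 2.
      by rewrite -real_normK ?num_real// ler_sqr ?nnegrE// (le_trans (HM1 _ sy)) ?ler_norm.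
    by have := sqr_ge0 `|M0|; have := sqr_ge0 `|M1|; lra.
  apply: (iR_support iQ _).1 => y /out[e0 e1 _].
  by rewrite /Submission.Q /f e0 e1; ring.
have lg : L2r g.
  split => //.
  have iQ : lint (Q g g).
    apply: (lint_bounded_cst (K := M ^+ 2 + M ^+ 2)); first exact: (measurable_Q Hc).
    move=> y; apply: (le_trans (Q_euclid g y)).
    have a c : g c y ^+ 2 <= M ^+ 2.
      by rewrite -real_normK ?num_real// ler_sqr ?nnegrE// (le_trans _ (gM c y)).
    by apply: lerD.
  apply: (iR_support iQ _).1 => y /out[_ _ e].
  by rewrite /Submission.Q !e; ring.
have := form_pos lf lg sf; congr (0 <= IR _); apply/funext => y.
by rewrite /Submission.Q /Hg0 /Hg1 /f; ring.
Qed.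

(** Constant [g = d] on []x, x + h[] gives nearly a straight segment: displacement about [h H(x) d],
    and area small against [h^2] since the velocity hardly turns. *)
Lemma path_local x h d0 d1 (e : R) : 0 <= e -> 0 < h ->
  (forall Z, Z = p \/ Z = q \/ Z = r -> itg x (x + h) (fun y => `|Z y - Z x|) <= e * h) ->
  let L := `|d0| + `|d1| in
  exists a0 a1 A, [/\ path x (x + h) (h * a0) (h * a1) (h ^+ 2 * A),
    `|a0 - (p x * d0 + q x * d1)| <= L * e,
    `|a1 - (q x * d0 + r x * d1)| <= L * e &
    `|A| <= 4 * L ^+ 2 * e].
Proof.
move=> e_ge0 h0 HZ L.
have [ip_ iq ir] := lint_pqr Hc.
have xh : x <= x + h by lra.
pose g : rvec := fun c y => if x < y < x + h then (if c then d1 else d0) else 0.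
have mI : measurable [set y : R | x < y < x + h].
  have -> : [set y : R | x < y < x + h] = `]x, (x + h)[%classic.
    by apply/seteqP; split => y; rewrite /= in_itv.
  exact: measurable_itv.
have mg c : measurable_fun [set: R] (g c).
  rewrite /g; apply: measurable_fun_ifT; [|exact: measurable_cst|exact: measurable_cst].
  by apply: (measurable_fun_bool true); rewrite setTI.
have L0 : 0 <= L by rewrite addr_ge0.
have gL c y : `|g c y| <= L.
  rewrite /g /L; have := normr_ge0 d0; have := normr_ge0 d1.
  by case: ifP => _; rewrite ?normr0; case: c; lra.
have g0 c y : ~~ (x < y < x + h) -> g c y = 0 by rewrite /g => /negbTE ->.
pose c0 y := p y * d0 + q y * d1; pose c1 y := q y * d0 + r y * d1.
have ic0 : lint c0.
  have := lintD (lintZ d0 ip_) (lintZ d1 iq); congr lint; apply/funext => y; rewrite /c0; ring.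
have ic1 : lint c1.
  have := lintD (lintZ d0 iq) (lintZ d1 ir); congr lint; apply/funext => y; rewrite /c1; ring.
have iQg : lint (Q g g).
  apply: (lint_bounded_cst (K := L ^+ 2 + L ^+ 2)); first exact: (measurable_Q Hc).
  move=> y; apply: (le_trans (Q_euclid g y)).
  have a c : g c y ^+ 2 <= L ^+ 2.
    by rewrite -real_normK ?num_real// ler_sqr ?nnegrE.
  by apply: lerD.
have [iH1 iH0] := lint_Hg Hc mg iQg.
have [F0 pF0 F00] := prim_exists x 0 iH0.
have [F1 pF1 F10] := prim_exists x 0 iH1.
have E0 y : x < y < x + h -> Hg0 g y = c0 y by move=> xy; rewrite /Hg0 /g xy.
have E1 y : x < y < x + h -> Hg1 g y = c1 y by move=> xy; rewrite /Hg1 /g xy.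
have cst0 a b (Z : R -> R) : lint Z -> a <= b -> (forall y, a <= y <= b -> Z y = 0) -> itg a b Z = 0.
  by move=> iZ ab Zab; rewrite (eq_itg Zab) itg_cst// mul0r.
have left y : y <= x -> F0 y = 0 /\ F1 y = 0.
  move=> yx; have n z : y <= z <= x -> ~~ (x < z < x + h).
    by move=> /andP[_ zx]; rewrite negb_and -!leNgt zx.
  have := pF0.2 _ _ yx; have := pF1.2 _ _ yx; rewrite F00 F10 !cst0//.
  - by move=> ? ?; split; lra.
  - by move=> z /n nz; rewrite !g0//; ring.
  - by move=> z /n nz; rewrite !g0//; ring.
have right y : x + h <= y -> F0 y = F0 (x + h) /\ F1 y = F1 (x + h).
  move=> yx; have n z : x + h <= z <= y -> ~~ (x < z < x + h).
    by move=> /andP[zx _]; rewrite negb_and -!leNgt zx orbT.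
  have := pF0.2 _ _ yx; have := pF1.2 _ _ yx; rewrite !cst0//.
  - by move=> ? ?; split; lra.
  - by move=> z /n nz; rewrite !g0//; ring.
  - by move=> z /n nz; rewrite !g0//; ring.
have dp : itg x (x + h) (fun y => `|p y - p x|) <= e * h by apply: HZ; left.
have dq : itg x (x + h) (fun y => `|q y - q x|) <= e * h by apply: HZ; right; left.
have dr : itg x (x + h) (fun y => `|r y - r x|) <= e * h by apply: HZ; right; right.
have idf (Z : R -> R) : lint Z -> lint (fun y => `|Z y - Z x|).
  by move=> iZ; apply: lint_norm; apply: lintB => //; exact: lint_cst.
have dc (Z1 Z2 : R -> R) : lint Z1 -> lint Z2 -> itg x (x + h) (fun y => `|Z1 y - Z1 x|) <= e * h ->
    itg x (x + h) (fun y => `|Z2 y - Z2 x|) <= e * h ->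
    lint (fun y => Z1 y * d0 + Z2 y * d1) ->
    itg x (x + h) (fun y => `|Z1 y * d0 + Z2 y * d1 - (Z1 x * d0 + Z2 x * d1)|) <= L * e * h.
  move=> i1 i2 h1 h2 i12.
  apply: (@le_trans _ _ (itg x (x + h) (fun y => `|d0| * `|Z1 y - Z1 x| + `|d1| * `|Z2 y - Z2 x|))).
    apply: le_itg; [exact: (idf (fun y => Z1 y * d0 + Z2 y * d1))|by apply: lintD; apply: lintZ; exact: idf|].
    move=> y _; rewrite -!normrM (le_trans _ (ler_normD _ _))// le_eqVlt; apply/orP; left.
    by apply/eqP; congr (`|_|); ring.
  rewrite itgD; [|by apply: lintZ; exact: idf|by apply: lintZ; exact: idf].
  rewrite itgZ; last exact: idf.
  rewrite itgZ; last exact: idf.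
  by rewrite /L -mulrA mulrDl lerD// ler_wpM2l.
have D0 := dc _ _ ip_ iq dp dq ic0.
have D1 := dc _ _ iq ir dq dr ic1.
rewrite -/(c0 x) in D0; rewrite -/(c1 x) in D1.
have FE y : x <= y <= x + h -> F0 y = itg x y c0 /\ F1 y = itg x y c1.
  move=> /andP[xy yx].
  have s z : x < z < y -> x < z < x + h by move=> /andP[-> zy]; rewrite (lt_le_trans zy yx).
  split.
    have := pF0.2 _ _ xy; rewrite F00 subr0 => ->; apply: eq_itg_oo => // z /s; exact: E0.
  have := pF1.2 _ _ xy; rewrite F10 subr0 => ->; apply: eq_itg_oo => // z /s; exact: E1.
have rho (Z : R -> R) y : lint Z -> itg x (x + h) (fun z => `|Z z - Z x|) <= L * e * h ->
    x <= y <= x + h -> `|itg x y Z - (y - x) * Z x| <= L * e * h.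
  move=> iZ DZ /andP[xy yx]; apply: le_trans DZ.
  have -> : itg x y Z - (y - x) * Z x = itg x y (fun z => Z z - Z x).
    by rewrite itgB ?itg_cst//; [ring|exact: lint_cst].
  have iB : lint (fun z => Z z - Z x) by apply: lintB => //; exact: lint_cst.
  apply: le_trans (itg_norm _ _ iB) _.
  rewrite (itg_cat (idf _ iZ) xy yx) lerDl; exact: itg_ge0.
have cL y : `|c0 y| <= L /\ `|c1 y| <= L.
  have b1 := p_bound Hc y; have b2 := q_bound Hc y; have b3 := r_bound Hc y.
  by split; apply: le_trans (ler_normD _ _) _; rewrite /L !normrM;
    apply: lerD; rewrite ler_piMl.
have FL (Z : R -> R) y : lint Z -> (forall z, `|Z z| <= L) -> x <= y <= x + h -> `|itg x y Z| <= L * h.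
  move=> iZ ZL /andP[xy yx]; apply: le_trans (itg_norm _ _ iZ) _.
  apply: (@le_trans _ _ (itg x y (fun=> L))).
    by apply: le_itg => //; [exact: lint_norm|exact: lint_cst].
  by rewrite itg_cst// ler_wpM2l//; lra.
exists (F0 (x + h) / h), (F1 (x + h) / h), (IR (fun y => F0 y * Hg1 g y - F1 y * Hg0 g y) / h ^+ 2).
have hn : h != 0 by rewrite lt0r_neq0.
have xx : x <= x + h <= x + h by rewrite xh lexx.
have [iA [_ AE]] := path_area_iR g0 pF0 pF1.
split.
- exists g, F0, F1, L; split => //.
  + split => y; first exact: left.
    by move=> /right[-> ->]; rewrite !mulrA ![h * _]mulrC !mulfK.
  + by rewrite mulrA [_ * IR _]mulrC mulfK// expf_neq0.
- have [-> _] := FE _ xx; have := rho c0 _ ic0 D0 xx.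
  rewrite addrAC subrr add0r -/(c0 x) => H.
  have -> : itg x (x + h) c0 / h - c0 x = (itg x (x + h) c0 - h * c0 x) / h by field.
  by rewrite normrM normfV (gtr0_norm h0) ler_pdivrMr.
- have [_ ->] := FE _ xx; have := rho c1 _ ic1 D1 xx.
  rewrite addrAC subrr add0r -/(c1 x) => H.
  have -> : itg x (x + h) c1 / h - c1 x = (itg x (x + h) c1 - h * c1 x) / h by field.
  by rewrite normrM normfV (gtr0_norm h0) ler_pdivrMr.
- rewrite normrM normfV (ger0_norm (sqr_ge0 h)) ler_pdivrMr ?exprn_gt0// AE.
  have iB : lint (fun y => F0 y * c1 y - F1 y * c0 y).
    by apply: lintB; apply: lint_contM => //; (exact: prim_cont pF0 || exact: prim_cont pF1).
  rewrite (eq_itg_oo iA iB); last by move=> y xy; rewrite E0// E1.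
  apply: le_trans (itg_norm _ _ iB) _.
  have i0 := idf _ ic0; have i1 := idf _ ic1.
  apply: (@le_trans _ _ (itg x (x + h) (fun y => 2 * (L * (L * e * h)) +
      L * h * (`|c1 y - c1 x| + `|c0 y - c0 x|)))).
    apply: le_itg; [exact: lint_norm|by apply: lintD; [exact: lint_cst|apply: lintZ; exact: lintD]|].
    move=> y xy; have [-> ->] := FE y xy.
    have r0 := rho c0 y ic0 D0 xy; have r1 := rho c1 y ic1 D1 xy.
    have l0 := FL c0 y ic0 (fun z => (cL z).1) xy; have l1 := FL c1 y ic1 (fun z => (cL z).2) xy.
    have [k0 k1] := cL x.
    (* The leading parts [(y - x) * c0 x * c1 x] cancel: a straight segment from the origin sweeps
       no area. *)
    have -> : itg x y c0 * c1 y - itg x y c1 * c0 y =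
      (itg x y c0 - (y - x) * c0 x) * c1 x - (itg x y c1 - (y - x) * c1 x) * c0 x
      + (itg x y c0 * (c1 y - c1 x) - itg x y c1 * (c0 y - c0 x)) by ring.
    apply: le_trans (ler_normD _ _) _; apply: lerD.
      apply: le_trans (ler_normB _ _) _; rewrite !normrM.
      rewrite [X in _ <= X](_ : _ = L * e * h * L + L * e * h * L); last by ring.
      by apply: lerD; apply: ler_pM.
    apply: le_trans (ler_normB _ _) _; rewrite !normrM mulrDr; apply: lerD; exact: ler_wpM2r.
  rewrite itgD; [|exact: lint_cst|by apply: lintZ; exact: lintD].
  rewrite itg_cst// itgZ; last exact: lintD.
  rewrite itgD//.
  have -> : x + h - x = h by ring.
  have Lh : 0 <= L * h by rewrite mulr_ge0// ltW.
  have := ler_wpM2l Lh (lerD D1 D0) => H.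
  apply: le_trans (lerD (lexx _) H) _.
  by rewrite le_eqVlt; apply/orP; left; apply/eqP; ring.
Qed.

End Paths.

(** * Triangles and quadrilaterals in the limit *)

Section FourPoints.
Context {R : realType}.
Local Notation mu := (@lebesgue_measure R).

Lemma cvg_nonneg (u : nat -> R) (l : R) : (forall n, 0 <= u n) -> u @ \oo --> l -> 0 <= l.
Proof.
move=> u0 ul; rewrite leNgt; apply/negP => l0.
have nl : 0 < - l by lra.
move/cvgrPdist_lt: ul => /(_ _ nl)[n _ /(_ n (leqnn n))].
by have := u0 n; rewrite /= ltr_norml => ? /andP[? ?]; lra.
Qed.

Lemma cvg_harmonic_bound (u : nat -> R) (l K : R) :
  (forall n, `|u n - l| <= K * n.+1%:R^-1) -> u @ \oo --> l.
Proof.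
move=> H; apply/cvgrPdist_lt => e e0.
have K1 : 0 < `|K| + 1 by have := normr_ge0 K; lra.
near=> n.
rewrite distrC; apply: le_lt_trans (H n) _.
have n0 : 0 < (n.+1%:R : R)^-1 by rewrite invr_gt0.
apply: (@le_lt_trans _ _ ((`|K| + 1) * n.+1%:R^-1)).
  by rewrite ler_wpM2r// ?ltW//; have := ler_norm K; lra.
rewrite mulrC -ltr_pdivlMr//.
near: n; apply: near_infty_natSinv_lt (PosNum (divr_gt0 e0 K1)).
Unshelve. all: by end_near. Qed.

Definition crossp (a b : R * R) : R := a.1 * b.2 - a.2 * b.1.

(* The weights [c1], ..., [c4] solve [c1 a1 + c2 a2 + c3 a3 + c4 a4 = 0], so that
   the polygonal path with edges [ci ai] closes; the value is twice its area. *)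
Definition four_area (a1 a2 a3 a4 : R * R) (l m : R) : R :=
  let c1 := l * crossp a2 a3 in
  let c2 := l * crossp a3 a1 + m * crossp a3 a4 in
  let c3 := l * crossp a1 a2 + m * crossp a4 a2 in
  let c4 := m * crossp a2 a3 in
  c1 * c2 * crossp a1 a2 + c1 * c3 * crossp a1 a3 + c1 * c4 * crossp a1 a4 +
  c2 * c3 * crossp a2 a3 + c2 * c4 * crossp a2 a4 + c3 * c4 * crossp a3 a4.

Lemma four_area_l a1 a2 a3 a4 :
  four_area a1 a2 a3 a4 1 0 = crossp a1 a2 * crossp a2 a3 * crossp a3 a1.
Proof. by rewrite /four_area /crossp; ring. Qed.

Lemma four_area_m a1 a2 a3 a4 :
  four_area a1 a2 a3 a4 0 1 = crossp a2 a3 * crossp a3 a4 * crossp a4 a2.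
Proof. by rewrite /four_area /crossp; ring. Qed.

(** For two alternating lines the area is a multiple of [l * m], so both signs occur unless the
    lines coincide. *)
Lemma four_area_repeat a b c l m : crossp c a = 0 ->
  four_area a b c b l m = - 2 * l * m * crossp a b * crossp b c ^+ 2.
Proof.
move=> h.
have -> : four_area a b c b l m = - 2 * l * m * crossp a b * crossp b c ^+ 2
   + crossp c a * (l ^+ 2 * crossp a b * crossp b c).
  by rewrite /four_area /crossp; ring.
by rewrite h mul0r addr0.
Qed.

Section Coefficients.
Context (p q r : R -> R).
Context (Hc : coeff p q r).
Local Notation Q := (Q p q r).
Local Notation solves := (solves p q r).
Local Notation L2r := (L2r p q r).
Local Notation path := (path p q r).
Context (form_pos : forall f g, L2r f -> L2r g -> solves f g -> 0 <= IR (Q f g)).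

Definition good_pt x := [/\ lpt p x, lpt q x & lpt r x].

Lemma ae_good_pt : {ae mu, forall x : R, good_pt x}.
Proof.
have [ip_ iq ir] := lint_pqr Hc.
by apply: aeS (aeI (ae_lpt ip_) (aeI (ae_lpt iq) (ae_lpt ir))) => x [? [? ?]].
Qed.

Definition Hv x (d : R * R) : R * R := (p x * d.1 + q x * d.2, q x * d.1 + r x * d.2).

(** Ever shorter local paths at [x] are scaled up by [1 / h] and then rest until [y]. In the limit
    [[x, y]] contributes one straight edge [H(x) d]. *)
Lemma path_seq x y d : good_pt x -> x < y -> exists (a : nat -> R * R) (B : nat -> R),
  [/\ forall n, path x y (a n).1 (a n).2 (B n),
      (fun n => (a n).1) @ \oo --> (Hv x d).1,
      (fun n => (a n).2) @ \oo --> (Hv x d).2 & B @ \oo --> (0 : R)].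
Proof.
move=> [lp lq lr] xy; pose L := `|d.1| + `|d.2|.
have H (n : nat) : exists aB : (R * R) * R,
    [/\ path x y aB.1.1 aB.1.2 aB.2,
      `|aB.1.1 - (Hv x d).1| <= L * n.+1%:R^-1,
      `|aB.1.2 - (Hv x d).2| <= L * n.+1%:R^-1 &
      `|aB.2| <= 4 * L ^+ 2 * n.+1%:R^-1].
  have e0 : 0 < (n.+1%:R : R)^-1 by rewrite invr_gt0.
  have [h1 h10 H1] := lp _ e0; have [h2 h20 H2] := lq _ e0; have [h3 h30 H3] := lr _ e0.
  pose h := Num.min (Num.min h1 h2) (Num.min h3 (y - x)) / 2.
  have hm : 0 < Num.min (Num.min h1 h2) (Num.min h3 (y - x)).
    by rewrite !lt_min h10 h20 h30 subr_gt0.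
  have h0 : 0 < h by rewrite divr_gt0.
  have hlt : h < Num.min (Num.min h1 h2) (Num.min h3 (y - x)) by rewrite /h; lra.
  move: hlt; rewrite !lt_min => /andP[/andP[hh1 hh2] /andP[hh3 hxy]].
  have HZ Z : Z = p \/ Z = q \/ Z = r ->
      itg x (x + h) (fun z => `|Z z - Z x|) <= n.+1%:R^-1 * h.
    by move=> [->|[->|->]]; [exact: H1|exact: H2|exact: H3].
  have [a0 [a1 [A [P Pa0 Pa1 PA]]]] := path_local Hc d.1 d.2 (ltW e0) h0 HZ.
  exists ((a0, a1), A); split => //=.
  have hn : h != 0 by rewrite lt0r_neq0.
  have xh : x <= x + h by lra.
  have hy : x + h <= y by lra.
  have := path_cat xh hy (path_scale h^-1 P) (path_zero p q r (x + h) y).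
  by congr path; field.
have {H}[aB HaB] := choice H.
exists (fun n => (aB n).1), (fun n => (aB n).2); split.
- by move=> n; have [] := HaB n.
- by apply: (@cvg_harmonic_bound _ _ L) => n; have [] := HaB n.
- by apply: (@cvg_harmonic_bound _ _ L) => n; have [] := HaB n.
- by apply: (@cvg_harmonic_bound _ _ (4 * L ^+ 2)) => n; rewrite subr0; have [] := HaB n.
Qed.

Lemma four_points x1 x2 x3 x4 d1 d2 d3 d4 l m : x1 < x2 -> x2 < x3 -> x3 < x4 ->
  good_pt x1 -> good_pt x2 -> good_pt x3 -> good_pt x4 ->
  0 <= four_area (Hv x1 d1) (Hv x2 d2) (Hv x3 d3) (Hv x4 d4) l m.
Proof.
move=> x12 x23 x34 g1 g2 g3 g4.
have x45 : x4 < x4 + 1 by lra.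
have [a [A [Pa a1 a2 A0]]] := path_seq d1 g1 x12.
have [b [B [Pb b1 b2 B0]]] := path_seq d2 g2 x23.
have [c [C [Pc c1 c2 C0]]] := path_seq d3 g3 x34.
have [d [D [Pd d1' d2' D0]]] := path_seq d4 g4 x45.
(* The closing weights use the actual displacements, so that every path closes exactly; only the
   area passes to the limit. *)
pose k1 n := l * crossp (b n) (c n).
pose k2 n := l * crossp (c n) (a n) + m * crossp (c n) (d n).
pose k3 n := l * crossp (a n) (b n) + m * crossp (d n) (b n).
pose k4 n := m * crossp (b n) (c n).
pose u n := four_area (a n) (b n) (c n) (d n) l m +
  (k1 n ^+ 2 * A n + k2 n ^+ 2 * B n + k3 n ^+ 2 * C n + k4 n ^+ 2 * D n).
have u0 n : 0 <= u n.
  have P1 := path_cat (ltW x12) (ltW x23) (path_scale (k1 n) (Pa n)) (path_scale (k2 n) (Pb n)).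
  have P2 := path_cat (ltW (lt_trans x12 x23)) (ltW x34) P1 (path_scale (k3 n) (Pc n)).
  have P3 := path_cat (ltW (lt_trans (lt_trans x12 x23) x34)) (ltW x45) P2 (path_scale (k4 n) (Pd n)).
  apply: (closed_path_area Hc form_pos (s := x1) (t := x4 + 1)).
  move: P3; congr path.
  - by rewrite /k1 /k2 /k3 /k4 /crossp; ring.
  - by rewrite /k1 /k2 /k3 /k4 /crossp; ring.
  - by rewrite /u /four_area /k1 /k2 /k3 /k4 /crossp; ring.
have cD (v w : nat -> R) (V W : R) : v @ \oo --> V -> w @ \oo --> W ->
  (fun n => v n + w n) @ \oo --> V + W by move=> *; exact: cvgD.
have cM (v w : nat -> R) (V W : R) : v @ \oo --> V -> w @ \oo --> W ->
  (fun n => v n * w n) @ \oo --> V * W by move=> *; exact: cvgM.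
have cross_cvg (v w : nat -> R * R) (V W : R * R) : (fun n => (v n).1) @ \oo --> V.1 ->
   (fun n => (v n).2) @ \oo --> V.2 -> (fun n => (w n).1) @ \oo --> W.1 ->
   (fun n => (w n).2) @ \oo --> W.2 -> (fun n => crossp (v n) (w n)) @ \oo --> crossp V W.
  by move=> *; apply: cvgB; apply: cvgM.
have lc (v : nat -> R) (V s : R) : v @ \oo --> V -> (fun n => s * v n) @ \oo --> s * V.
  by move=> h; apply: cvgM => //; exact: cvg_cst.
have ab := cross_cvg _ _ _ _ a1 a2 b1 b2; have ac := cross_cvg _ _ _ _ a1 a2 c1 c2.
have ad := cross_cvg _ _ _ _ a1 a2 d1' d2'; have bc := cross_cvg _ _ _ _ b1 b2 c1 c2.
have bd := cross_cvg _ _ _ _ b1 b2 d1' d2'; have cd := cross_cvg _ _ _ _ c1 c2 d1' d2'.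
have ca := cross_cvg _ _ _ _ c1 c2 a1 a2; have db := cross_cvg _ _ _ _ d1' d2' b1 b2.
have K1 := lc _ _ l bc.
have K2 := cD _ _ _ _ (lc _ _ l ca) (lc _ _ m cd).
have K3 := cD _ _ _ _ (lc _ _ l ab) (lc _ _ m db).
have K4 := lc _ _ m bc.
have cv := cD _ _ _ _ (cD _ _ _ _ (cD _ _ _ _ (cD _ _ _ _ (cD _ _ _ _ (cD _ _ _ _ (cM _ _ _ _
  (cM _ _ _ _ K1 K2) ab) (cM _ _ _ _ (cM _ _ _ _ K1 K3) ac)) (cM _ _ _ _ (cM _ _ _ _ K1 K4) ad))
  (cM _ _ _ _ (cM _ _ _ _ K2 K3) bc)) (cM _ _ _ _ (cM _ _ _ _ K2 K4) bd)) (cM _ _ _ _ (cM _ _ _ _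
  K3 K4) cd)) (cD _ _ _ _ (cD _ _ _ _ (cD _ _ _ _ (cM _ _ _ _ (cM _ _ _ _ K1 K1) A0) (cM _ _ _ _
  (cM _ _ _ _ K2 K2) B0)) (cM _ _ _ _ (cM _ _ _ _ K3 K3) C0)) (cM _ _ _ _ (cM _ _ _ _ K4 K4) D0)).
have := cvg_nonneg u0 cv.
by rewrite !mulr0 !addr0.
Qed.

End Coefficients.

End FourPoints.

(** * Rank one and the direction of the coefficient *)

Section Direction.
Context {R : realType}.
Local Notation mu := (@lebesgue_measure R).

Lemma ae_dense (P : R -> Prop) a b : {ae mu, forall x : R, P x} -> a < b ->
  exists2 x, a < x < b & P x.
Proof.
move=> [N [mN N0 PN]] ab; apply: contrapT => h.
have abN : `]a, b[%classic `<=` N.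
  by move=> x; rewrite /= in_itv/= => xab; apply: PN => /= Px; apply: h; exists x.
have : (mu `]a, b[%classic <= mu N)%E by apply: le_measure => //; rewrite inE.
move: N0 => /= ->; rewrite lebesgue_measure_itv/= lte_fin ab -EFinB lee_fin.
by lra.
Qed.

Lemma ae_neq (a : R) : {ae mu, forall x : R, x <> a}.
Proof.
exists [set a]; split => //; first exact: lebesgue_measure_set1.
by move=> x /= /contrapT.
Qed.

Context (p q r : R -> R).
Context (Hc : coeff p q r).
Local Notation Q := (Q p q r).
Local Notation solves := (solves p q r).
Local Notation L2r := (L2r p q r).
Local Notation Hv := (Hv p q r).
Local Notation good_pt := (good_pt p q r).
Context (form_pos : forall f g, L2r f -> L2r g -> solves f g -> 0 <= IR (Q f g)).

Definition dirp x t := [/\ p x = cos t ^+ 2, q x = cos t * sin t & r x = sin t ^+ 2].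
Definition ee (t : R) : R * R := (cos t, sin t).

Lemma Hv_ee x t : dirp x t -> Hv x (ee t) = ee t.
Proof.
move=> [h1 h2 h3]; rewrite /Submission.Hv /ee /= h1 h2 h3; congr (_, _).
  by rewrite -[RHS]mulr1 -(cos2Dsin2 t); ring.
by rewrite -[RHS]mulr1 -(cos2Dsin2 t); ring.
Qed.

Lemma crossp_ee s t : crossp (ee s) (ee t) = sin (t - s).
Proof. by rewrite /crossp /ee /= sinB; ring. Qed.

Lemma dirpDpi x t : dirp x t -> dirp x (t + pi).
Proof. by move=> [h1 h2 h3]; split; rewrite ?cosDpi ?sinDpi ?sqrrN ?mulrNN. Qed.

(* At two points where [H] has full rank a triangle with prescribed edges, of
   either orientation, can be closed up. *)
Lemma rank_two_unique x y : good_pt x -> good_pt y ->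
  q x ^+ 2 < p x * r x -> q y ^+ 2 < p y * r y -> x = y.
Proof.
wlog xy : x y / x < y.
  by move=> H gx gy hx hy; case: (ltgtP x y) => // h; [exact: H|apply/esym; exact: H].
move=> gx gy hx hy; exfalso.
have x0lt : x - 1 < x by lra.
have y1lt : y < y + 1 by lra.
have [w /andP[_ wx] gw] := ae_dense (ae_good_pt Hc) x0lt.
(* [z] only occupies the fourth place, with edge 0. *)
have [z /andP[yz _] gz] := ae_dense (ae_good_pt Hc) y1lt.
have [d a0] : exists d, (Hv w d).1 ^+ 2 + (Hv w d).2 ^+ 2 != 0.
  have [p0|p0] := eqVneq (p w) 0.
    exists (0, 1); rewrite /Submission.Hv /= !mulr0 !mulr1 !add0r.
    have -> : r w = 1 by have := coeff_tr Hc w; lra.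
    by rewrite gt_eqF//; have := sqr_ge0 (q w); lra.
  exists (1, 0); rewrite /Submission.Hv /= !mulr0 !mulr1 !addr0 gt_eqF//.
  by have := sqr_ge0 (q w); have := exprn_even_gt0 (p w) (isT : ~~ odd 2); rewrite p0 orbT; lra.
have inv v (u : R * R) : q v ^+ 2 < p v * r v -> exists d', Hv v d' = u.
  move=> hv; have D0 : p v * r v - q v ^+ 2 != 0 by rewrite gt_eqF// subr_gt0.
  exists ((r v * u.1 - q v * u.2) / (p v * r v - q v ^+ 2),
          (p v * u.2 - q v * u.1) / (p v * r v - q v ^+ 2)).
  by case: u => u1 u2; rewrite /Submission.Hv /=; congr (_, _); field.
set a := Hv w d in a0.
(* The edges [a], [J a] and [a - J a] give the product [-|a|^6]; full rank at [x] and [y] provides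
   the last two. *)
have [d2 e2] := inv x (- a.2, a.1) hx.
have [d3 e3] := inv y (a.1 + a.2, a.2 - a.1) hy.
have := four_points Hc form_pos d d2 d3 (0, 0) 1 0 wx xy yz gw gx gy gz.
rewrite four_area_l e2 e3 -/a.
have -> : crossp a (- a.2, a.1) * crossp (- a.2, a.1) (a.1 + a.2, a.2 - a.1) *
   crossp (a.1 + a.2, a.2 - a.1) a = - (a.1 ^+ 2 + a.2 ^+ 2) ^+ 3.
  by rewrite /crossp /=; ring.
have a0' : 0 < a.1 ^+ 2 + a.2 ^+ 2 by rewrite lt_neqAle eq_sym a0 addr_ge0// sqr_ge0.
by have := exprn_gt0 3 a0'; lra.
Qed.

(** With trace 1, a vanishing determinant makes [H] a rank one projection. *)
Definition regular x := good_pt x /\ p x * r x = q x ^+ 2.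

Lemma ae_regular : {ae mu, forall x : R, regular x}.
Proof.
have [h|h] := pselect (exists2 x, good_pt x & q x ^+ 2 < p x * r x); last first.
  apply: aeS (ae_good_pt Hc) => x gx; split => //.
  apply/eqP; rewrite eq_le (coeff_det Hc) andbT leNgt; apply/negP => h'.
  by apply: h; exists x.
have [y gy hy] := h.
apply: aeS (aeI (ae_good_pt Hc) (ae_neq y)) => x [gx xy]; split => //.
apply/eqP; rewrite eq_le (coeff_det Hc) andbT leNgt; apply/negP => h'.
by apply: xy; exact: rank_two_unique.
Qed.

Lemma regular_dir x : regular x -> exists2 t, 0 <= t < pi & dirp x t.
Proof.
move=> [_ dt]; have p0 := coeff_p Hc x; have r0 := coeff_r Hc x; have t1 := coeff_tr Hc x.
have p1 : p x <= 1 by lra.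
have s1 : Num.sqrt (p x) <= 1 by rewrite -sqrtr1 ler_wsqrtr.
have s0 := sqrtr_ge0 (p x).
(* The cosine takes the sign of [q] because the sine is taken non-negative. The value [-1] is
   excluded: it would force [q = 0]. *)
pose c := if q x < 0 then - Num.sqrt (p x) else Num.sqrt (p x).
have c2 : c ^+ 2 = p x by rewrite /c; case: ifP => _; rewrite ?sqrrN sqr_sqrtr.
have c1 : -1 <= c <= 1 by rewrite /c; case: ifP => _; apply/andP; split; lra.
have cn1 : -1 < c.
  rewrite /c; case: ifP => [q0|_]; last by lra.
  rewrite ltrN2 lt_neqAle s1 andbT; apply/eqP => e.
  have p1' : p x = 1 by rewrite -(sqr_sqrtr p0) e expr1n.
  have r0' : r x = 0 by lra.
  by move: dt; rewrite r0' mulr0 => /esym/eqP; rewrite sqrf_eq0 => /eqP q0'; rewrite q0' ltxx in q0.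
exists (acos c).
  by rewrite acos_ge0// acos_ltpi//; move/andP: c1 => [_ ->]; rewrite cn1.
have sE : sin (acos c) = Num.sqrt (r x).
  by rewrite sin_acos// c2; congr Num.sqrt; lra.
split; rewrite ?acosK ?in_itv//= ?c2// sE ?sqr_sqrtr//.
have : q x ^+ 2 = (Num.sqrt (p x) * Num.sqrt (r x)) ^+ 2 by rewrite exprMn !sqr_sqrtr.
rewrite /c; case: ltP => q0 h.
  have : (- q x) ^+ 2 = (Num.sqrt (p x) * Num.sqrt (r x)) ^+ 2 by rewrite sqrrN.
  move/eqP; rewrite eqrXn2 ?mulr_ge0 ?sqrtr_ge0//; last by lra.
  by move=> /eqP; rewrite mulNr => <-; rewrite opprK.
by move/eqP: h; rewrite eqrXn2 ?mulr_ge0 ?sqrtr_ge0// => /eqP.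
Qed.

(* [alpha], a limit direction at [+oo], is the angle from which phases are measured. *)
Lemma limit_direction : exists alpha : R, forall e N, 0 < e ->
  exists x t, [/\ N < x, regular x, 0 <= t < pi, dirp x t & `|alpha - t| < e].
Proof.
have H (n : nat) : exists xt : R * R, [/\ n%:R < xt.1, regular xt.1, 0 <= xt.2 < pi & dirp xt.1 xt.2].
  have n1 : (n%:R : R) < n%:R + 1 by lra.
  have [x /andP[nx _] rx] := ae_dense ae_regular n1.
  by have [t t0 dt] := regular_dir rx; exists (x, t).
have {H}[xt Hxt] := choice H.
have tB n (_ : unit) : `|(xt n).2| <= pi.
  by have [_ _ /andP[t0 tpi] _] := Hxt n; rewrite ger0_norm// ltW.
have [l Hl] := bounded_cluster tB.
exists (l tt) => e N e0.
have [n nN Hn] := Hl e e0 (Num.truncn `|N|).+1.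
have [h1 h2 h3 h4] := Hxt n.
exists (xt n).1, (xt n).2; split => //; try exact: (Hn tt).
apply: lt_trans h1; apply: le_lt_trans (ler_norm N) _.
apply: lt_le_trans (Num.Theory.truncnS_gt _) _.
by rewrite ler_nat.
Qed.

End Direction.

(** * Construction of the decreasing phase *)

Section MonotonePhase.
Context {R : realType}.
Local Notation mu := (@lebesgue_measure R).
Context (p q r : R -> R).
Context (Hc : coeff p q r).
Local Notation Q := (Q p q r).
Local Notation solves := (solves p q r).
Local Notation L2r := (L2r p q r).
Local Notation Hv := (Hv p q r).
Local Notation good_pt := (good_pt p q r).
Local Notation regular := (regular p q r).
Local Notation dirp := (dirp p q r).
Context (form_pos : forall f g, L2r f -> L2r g -> solves f g -> 0 <= IR (Q f g)).

Context (alpha : R).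
Context (alpha_lim : forall e N, 0 < e ->
  exists x t, [/\ N < x, regular x, 0 <= t < pi, dirp x t & `|alpha - t| < e]).

Lemma alpha_range : 0 <= alpha <= pi.
Proof.
apply/andP; split; apply/ler_addgt0Pl => e e0;
  have [x [t [_ _ /andP[t0 tpi] _]]] := alpha_lim 0 e0;
  by rewrite ltr_norml => /andP[? ?]; lra.
Qed.

(** The fourth point is sent to [+oo] along directions tending to [alpha]; the area is continuous in
    the direction. *)
Lemma four_limit x1 x2 x3 t1 t2 t3 l m : x1 < x2 -> x2 < x3 ->
  regular x1 -> regular x2 -> regular x3 ->
  dirp x1 t1 -> dirp x2 t2 -> dirp x3 t3 ->
  0 <= four_area (ee t1) (ee t2) (ee t3) (ee alpha) l m.
Proof.
move=> x12 x23 [g1 _] [g2 _] [g3 _] d1 d2 d3.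
have H (n : nat) : exists t : R, 0 <= four_area (ee t1) (ee t2) (ee t3) (ee t) l m /\
    `|t - alpha| <= 1 * n.+1%:R^-1.
  have n0 : 0 < (n.+1%:R : R)^-1 by rewrite invr_gt0.
  have [x [t [x3x [gx _] _ dt h]]] := alpha_lim x3 n0.
  exists t; split; last by rewrite mul1r distrC ltW.
  rewrite -(Hv_ee d1) -(Hv_ee d2) -(Hv_ee d3) -(Hv_ee dt).
  exact: (four_points Hc form_pos).
have {H}[t Ht] := choice H.
have ta : t @ \oo --> alpha by apply: cvg_harmonic_bound => n; exact: (Ht n).2.
pose g s := four_area (ee t1) (ee t2) (ee t3) (ee s) l m.
have cg : {for alpha, continuous g}.
  have cu (s : R) : {for alpha, continuous (fun x => crossp (ee s) (ee x))}.
    rewrite /crossp /ee /=; apply: cvgB; apply: cvgM; try exact: cvg_cst.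
      exact: continuous_sin.
    exact: continuous_cos.
  have cD (v w : R -> R) : {for alpha, continuous v} -> {for alpha, continuous w} ->
    {for alpha, continuous (fun x => v x + w x)} by move=> *; exact: cvgD.
  have cM (v w : R -> R) : {for alpha, continuous v} -> {for alpha, continuous w} ->
    {for alpha, continuous (fun x => v x * w x)} by move=> *; exact: cvgM.
  have cc (k : R) : {for alpha, continuous (fun=> k)} by exact: cvg_cst.
  have u1 := cu t1; have u2 := cM _ _ (cc (-1)) (cu t2); have u3 := cu t3.
  pose K1 := l * crossp (ee t2) (ee t3); pose K4 := m * crossp (ee t2) (ee t3).
  have K2 := cD _ _ (cc (l * crossp (ee t3) (ee t1))) (cM _ _ (cc m) (cu t3)).
  have K3 := cD _ _ (cc (l * crossp (ee t1) (ee t2))) (cM _ _ (cc m) u2).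
  have ext (v w : R -> R) : {for alpha, continuous v} -> v =1 w -> {for alpha, continuous w}.
    by move=> cv /funext <-.
  apply: (ext _ _ (cD _ _ (cD _ _ (cD _ _ (cD _ _ (cD _ _
    (cM _ _ K2 (cc (K1 * crossp (ee t1) (ee t2))))
    (cM _ _ K3 (cc (K1 * crossp (ee t1) (ee t3)))))
    (cM _ _ (cc (K1 * K4)) u1))
    (cM _ _ (cM _ _ K2 K3) (cc (crossp (ee t2) (ee t3)))))
    (cM _ _ K2 (cM _ _ (cc K4) (cu t2))))
    (cM _ _ K3 (cM _ _ (cc K4) u3)))) => s.
  by rewrite /g /four_area /K1 /K4 /crossp /=; ring.
apply: (@cvg_nonneg _ (fun n => g (t n)) (g alpha)); first by move=> n; exact: (Ht n).1.
by apply: continuous_cvg.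
Qed.

Let psi_exists x : exists t, regular x -> alpha <= t < alpha + pi /\ dirp x t.
Proof.
have [rx|nx] := pselect (regular x); last by exists 0.
have [t /andP[t0 tpi] dt] := regular_dir Hc rx.
have /andP[a0 ap] := alpha_range.
have [ta|ta] := leP alpha t.
  by exists t => _; split => //; apply/andP; split => //; lra.
by exists (t + pi) => _; split; [apply/andP; split; lra|exact: dirpDpi].
Qed.

Let psi := projT1 (choice psi_exists).

Let psiP x : regular x -> alpha <= psi x < alpha + pi /\ dirp x (psi x).
Proof. exact: (projT2 (choice psi_exists) x). Qed.

Let sin_psi x : regular x -> psi x != alpha -> 0 < sin (psi x - alpha).
Proof.
move=> rx n; have [/andP[h1 h2] _] := psiP rx.
have {}h1 : alpha < psi x by rewrite lt_neqAle eq_sym n.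
by apply: sin_gt0_pi; apply/andP; split; lra.
Qed.

Let earlier x : exists2 w, w < x & regular w.
Proof.
have lt : x - 1 < x by lra.
by have [w /andP[_ wx] rw] := ae_dense (ae_regular Hc form_pos) lt; exists w.
Qed.

(** The triangle with edges at [x], at [y] and at [+oo]; the earlier point [w] gets weight 0. *)
Let triple x y : x < y -> regular x -> regular y ->
  0 <= sin (psi y - psi x) * sin (alpha - psi y) * sin (psi x - alpha).
Proof.
move=> xy rx ry; have [w wx rw] := earlier x.
have := four_limit 0 1 wx xy rw rx ry (psiP rw).2 (psiP rx).2 (psiP ry).2.
by rewrite four_area_m !crossp_ee.
Qed.

Let sin_swap (s t : R) : sin (s - t) = - sin (t - s).
Proof. by rewrite -sinN opprB. Qed.

Let psi_decr x y : x < y -> regular x -> regular y -> psi x != alpha -> psi y != alpha ->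
  psi y <= psi x.
Proof.
move=> xy rx ry nx ny; rewrite leNgt; apply/negP => h.
have := triple xy rx ry; rewrite (sin_swap alpha).
have sx := sin_psi rx nx; have sy := sin_psi ry ny.
have [/andP[x1 x2] _] := psiP rx; have [/andP[y1 y2] _] := psiP ry.
have s0 : 0 < sin (psi y - psi x) by apply: sin_gt0_pi; apply/andP; split; lra.
have := mulr_gt0 (mulr_gt0 s0 sy) sx; rewrite mulrN mulNr; lra.
Qed.

(** The triangles [x, y, z] and [x, z, +oo] give opposite signs for [sin (psi x - psi z)], so [x]
    and [z] share a direction. Then [x, y, z, +oo] alternates between two lines, as in
    [four_area_repeat], and [m = 1], [m = -1] contradict each other. *)
Let no_return x y z : x < y -> y < z -> regular x -> regular y -> regular z ->
  psi x != alpha -> psi y = alpha -> psi z != alpha -> False.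
Proof.
move=> xy yz rx ry rz nx ey nz.
have sx := sin_psi rx nx; have sz := sin_psi rz nz.
have F l m := four_limit l m xy yz rx ry rz (psiP rx).2 (psiP ry).2 (psiP rz).2.
have t1 := F 1 0; rewrite four_area_l !crossp_ee ey in t1.
have t2 := triple (lt_trans xy yz) rx rz.
rewrite (sin_swap alpha (psi x)) in t1; rewrite (sin_swap alpha (psi z)) (sin_swap (psi z)) in t2.
have sxz := mulr_gt0 sx sz.
have s0 : sin (psi x - psi z) = 0.
  have e1 : 0 <= - (sin (psi x - alpha) * sin (psi z - alpha)) * sin (psi x - psi z) by move: t1; rewrite mulNr.
  have e2 : 0 <= (sin (psi x - alpha) * sin (psi z - alpha)) * sin (psi x - psi z).
    by apply: le_trans t2 _; rewrite le_eqVlt; apply/orP; left; apply/eqP; ring.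
  move: e1; rewrite mulNr oppr_ge0 => e1.
  have /eqP : sin (psi x - alpha) * sin (psi z - alpha) * sin (psi x - psi z) = 0.
    by apply/eqP; rewrite eq_le e1 e2.
  by rewrite mulf_eq0 gt_eqF//= => /eqP.
have h := F 1 1; rewrite ey in h.
rewrite four_area_repeat in h; last by rewrite crossp_ee.
have h' := F 1 (-1); rewrite ey in h'.
rewrite four_area_repeat in h'; last by rewrite crossp_ee.
rewrite !crossp_ee (sin_swap alpha) in h h'.
have sz2 : 0 < sin (psi z - alpha) ^+ 2 by rewrite exprn_gt0.
have := mulr_gt0 sx sz2; lra.
Qed.

(** The direction [alpha] is also [alpha + pi]. It is labelled [alpha + pi] as long as another
    direction is still to come, and [alpha] afterwards; [no_return] makes this consistent with a
    decreasing phase. *)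
Let phi0 x : R := if psi x == alpha then
   (if pselect (exists y, [/\ x < y, regular y & psi y != alpha]) then alpha + pi else alpha)
  else psi x.

Let phi0_range x : regular x -> alpha <= phi0 x <= alpha + pi.
Proof.
move=> rx; rewrite /phi0; have := pi_ge0 R; have [/andP[h1 h2] _] := psiP rx.
by case: ifP => _; [case: pselect => _ /=|]; move=> *; apply/andP; split; lra.
Qed.

Let phi0_dir x : regular x -> dirp x (phi0 x).
Proof.
move=> rx; have [_ d] := psiP rx; rewrite /phi0.
by case: eqP => [e|//]; case: pselect => _ /=; rewrite -e //; exact: dirpDpi.
Qed.

Let phi0_decr x y : x < y -> regular x -> regular y -> phi0 y <= phi0 x.
Proof.
move=> xy rx ry; have /andP[_ yp] := phi0_range ry; have /andP[xa _] := phi0_range rx.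
have [ex|nx] := eqVneq (psi x) alpha.
  have [h|h] := pselect (exists y, [/\ x < y, regular y & psi y != alpha]).
    have -> : phi0 x = alpha + pi by rewrite /phi0 ex eqxx; case: pselect.
    exact: yp.
  have ey : psi y = alpha.
    by apply/eqP; apply: contraT => ny; case: h; exists y.
  have -> : phi0 y = alpha.
    rewrite /phi0 ey eqxx; case: pselect => [[z [yz rz nz]]|//].
    by case: h; exists z; split => //; exact: lt_trans yz.
  exact: xa.
have -> : phi0 x = psi x by rewrite /phi0 (negbTE nx).
have [ey|ny] := eqVneq (psi y) alpha; last by rewrite /phi0 (negbTE ny) psi_decr.
rewrite /phi0 ey eqxx; case: pselect => [[z [yz rz nz]]|_ /=].
  by case: (no_return xy yz rx ry rz nx ey nz).
by have [/andP[]] := psiP rx.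
Qed.

Lemma monotone_phase_aux : exists phi : R -> R,
  [/\ forall x y, x <= y -> phi y <= phi x,
      forall x, alpha <= phi x <= alpha + pi &
      {ae mu, forall x : R, dirp x (phi x)}].
Proof.
(* The supremum over later regular points extends [phi0] to the whole line, decreasing, and
   unchanged at regular points. *)
pose S x : set R := [set phi0 y | y in [set y | x <= y /\ regular y]].
have Sn x : S x !=set0.
  have lt : x < x + 1 by lra.
  have [y /andP[xy _] ry] := ae_dense (ae_regular Hc form_pos) lt.
  by exists (phi0 y), y => //; split => //; exact: ltW.
have Sub x : ubound (S x) (alpha + pi).
  by move=> _ [y [_ ry] <-]; have /andP[] := phi0_range ry.
have hS x : has_sup (S x) by split => //; exists (alpha + pi).
exists (fun x => sup (S x)); split.
- move=> x y xy; apply: ge_sup => // _ [z [yz rz] <-].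
  by apply: sup_upper_bound => //; exists z => //; split => //; exact: le_trans yz.
- move=> x; apply/andP; split; last exact: ge_sup.
  have [_ [y [xy ry] _]] := Sn x; have /andP[h _] := phi0_range ry.
  by apply: (le_trans h); apply: sup_upper_bound => //; exists y.
- apply: aeS (ae_regular Hc form_pos) => x rx.
  suff -> : sup (S x) = phi0 x by exact: phi0_dir.
  apply/eqP; rewrite eq_le; apply/andP; split.
    apply: ge_sup => // _ [y [xy ry] <-].
    have [<-//|n] := eqVneq x y.
    by apply: phi0_decr => //; rewrite lt_neqAle n.
  by apply: sup_upper_bound => //; exists x.
Qed.

End MonotonePhase.

Theorem monotone_phase (R : realType) (p q r : R -> R) : coeff p q r ->
  (forall f g, L2r p q r f -> L2r p q r g -> solves p q r f g -> 0 <= IR (Q p q r f g)) ->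
  exists (alpha : R) (phi : R -> R),
  [/\ forall x y, x <= y -> phi y <= phi x,
      forall x, alpha <= phi x <= alpha + pi &
      {ae @lebesgue_measure R, forall x : R, dirp p q r x (phi x)}].
Proof.
move=> Hc pos; have [alpha Ha] := limit_direction Hc pos.
by exists alpha; exact: (monotone_phase_aux Hc pos Ha).
Qed.

(** * Resolvent set and positivity *)

Section AbstractPositivity.
Context {R : realType}.
Context (p q r : R -> R).
Context (Hc : coeff p q r).
Local Notation L2c := (L2c p q r).
Local Notation relR := (relR p q r).
Local Notation ip := (ip p q r).
Implicit Types (F G U V W : @cvec R).

Definition domR F := exists G, relR F G.
Definition closR U := L2c U /\ forall e, 0 < e ->
  exists2 D, domR D & ip (clin (-1) U D) (clin (-1) U D) < e.
Definition opR F G := [/\ relR F G, closR F & closR G].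

Lemma ip_eq U V W : L2c U -> L2c V -> L2c W ->
  ip (clin (-1) U V) (clin (-1) U V) = 0 -> ip U W = ip V W.
Proof.
move=> lU lV lW h; have := ip_zero Hc (L2c_lin Hc (-1) lU lV) lW h.
by rewrite (ip_lin Hc)//; lra.
Qed.

Lemma domR_closR F : domR F -> closR F.
Proof.
move=> dF; have [G [lF _ _]] := dF; split => // e e0; exists F => //.
by rewrite (ip_lin2 Hc)//; lra.
Qed.

Lemma closR_lin t U V : closR U -> closR V -> closR (clin t U V).
Proof.
move=> [lU hU] [lV hV]; split; first exact: L2c_lin.
move=> e e0; pose e' := e / (4 * (1 + t ^+ 2)).
have t2 : 0 < 1 + t ^+ 2 by have := sqr_ge0 t; lra.
have e'0 : 0 < e' by rewrite divr_gt0// mulr_gt0.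
have [D [G rD] hD] := hU _ e'0; have [D' [G' rD'] hD'] := hV _ e'0.
exists (clin t D D'); first by exists (clin t G G'); exact: relR_lin.
have [lD _ _] := rD; have [lD' _ _] := rD'.
set X := clin (-1) U D in hD; set Y := clin (-1) V D' in hD'.
have lX : L2c X by exact: L2c_lin.
have lY : L2c Y by exact: L2c_lin.
have -> : clin (-1) (clin t U V) (clin t D D') = clin t X Y.
  by apply/funext => k; apply/funext => c; apply/funext => x; rewrite /X /Y /clin /rlin; ring.
clearbody X Y; have := ip_ge0 Hc (clin (- t) X Y); rewrite !(ip_lin2 Hc)// => h.
have : t ^+ 2 * ip Y Y <= t ^+ 2 * e' by rewrite ler_wpM2l ?sqr_ge0// ltW.
have : e = 4 * (e' + t ^+ 2 * e') by rewrite /e'; field; rewrite lt0r_neq0.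
have : 0 <= t ^+ 2 * e' by rewrite mulr_ge0 ?sqr_ge0// ltW.
lra.
Qed.

Lemma opR_lin t F G F' G' : opR F G -> opR F' G' -> opR (clin t F F') (clin t G G').
Proof.
by move=> [r1 f1 g1] [r2 f2 g2]; split; [exact: relR_lin|exact: closR_lin|exact: closR_lin].
Qed.

(** [clin t G F] is [(S + t) F], and the bound is on squared norms. *)
Definition negative_resolvent (t : R) :=
  (forall U, closR U -> exists F G, opR F G /\
     let V := clin (-1) (clin t G F) U in ip V V = 0) /\
  exists C, forall F G, opR F G -> ip F F <= C * ip (clin t G F) (clin t G F).

Context (resH : forall t, 0 < t -> negative_resolvent t).

(* The bounded symmetric operator [(S + t)^-1] is non-negative: otherwise the
   infimum [m < 0] of its form would be an approximate eigenvalue, although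
   [t - 1 / m] is minus a point of the resolvent set. *)
Lemma resolvent_form_ge0 t F G : 0 < t -> opR F G -> 0 <= ip F (clin t G F).
Proof.
move=> t0 opFG; rewrite leNgt; apply/negP => neg.
have [surj [C0 HC0]] := resH t0.
pose C := `|C0|.
have HC U W : opR U W -> ip U U <= C * ip (clin t W U) (clin t W U).
  move=> h; apply: le_trans (HC0 _ _ h) _.
  by rewrite ler_wpM2r ?(ip_ge0 Hc)// ler_norm.
have L2op U W : opR U W -> [/\ L2c U, L2c W & L2c (clin t W U)].
  by move=> [[lU lW _] _ _]; split => //; exact: L2c_lin.
have low U W : opR U W -> - ((C + 1) / 2) * ip (clin t W U) (clin t W U) <= ip U (clin t W U).
  move=> h; have [lU lW lV] := L2op _ _ h; have := HC _ _ h; have := ip_amgm Hc lU lV.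
  by rewrite ler_norml => /andP[? _]; lra.
(* The Rayleigh quotients of [(S + t)^-1] at [v = (S + t) U]; [low] bounds them from below. *)
pose S := [set s : R | exists U W, [/\ opR U W, 0 < ip (clin t W U) (clin t W U) &
   s = ip U (clin t W U) / ip (clin t W U) (clin t W U)]].
have vpos U W : opR U W -> ip U (clin t W U) != 0 -> 0 < ip (clin t W U) (clin t W U).
  move=> h n; rewrite lt_neqAle (ip_ge0 Hc) andbT eq_sym; apply: contra n => /eqP e.
  have [lU lW lV] := L2op _ _ h; rewrite (ip_sym p q r U).
  by rewrite (ip_zero Hc lV lU e).
have SF : S (ip F (clin t G F) / ip (clin t G F) (clin t G F)).
  by exists F, G; split => //; apply: vpos => //; rewrite lt_eqF.
have hS : has_inf S.
  split; first by exists (ip F (clin t G F) / ip (clin t G F) (clin t G F)).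
  by exists (- ((C + 1) / 2)) => _ [U [W [h v ->]]]; rewrite ler_pdivlMr// low.
pose m := inf S.
have m0 : m < 0.
  apply: le_lt_trans (ge_inf _ SF) _; first by case: hS.
  by rewrite pmulr_llt0// invr_gt0; apply: vpos => //; rewrite lt_eqF.
have mle U W : opR U W -> m * ip (clin t W U) (clin t W U) <= ip U (clin t W U).
  move=> h; have [v0|v0] := eqVneq (ip (clin t W U) (clin t W U)) 0.
    have [lU lW lV] := L2op _ _ h.
    by rewrite v0 mulr0 (ip_sym p q r U) (ip_zero Hc lV lU v0).
  have vp : 0 < ip (clin t W U) (clin t W U) by rewrite lt_neqAle eq_sym v0 (ip_ge0 Hc).
  by rewrite -ler_pdivlMr//; apply: ge_inf; [case: hS|exists U, W].
(* Then [w = U - m v] is [- m (S + tau) U], and [tau > 0] as [m < 0]; the resolvent at [- tau]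
   bounds [v] by [w]. *)
pose tau := t - m^-1.
have mi0 : m^-1 < 0 by rewrite invr_lt0.
have tau0 : 0 < tau by rewrite /tau; lra.
have [_ [D0 HD0]] := resH tau0.
pose D := `|D0|.
pose K := (2 + 2 * (tau - t) ^+ 2 * D) / m ^+ 2.
have m2 : 0 < m ^+ 2 by rewrite exprn_even_gt0 //= lt_eqF.
have D_ge0 : 0 <= (tau - t) ^+ 2 * D by apply: mulr_ge0; [exact: sqr_ge0|exact: normr_ge0].
have K0 : 0 < K by rewrite divr_gt0//; lra.
pose w U W : cvec := clin (- m) U (clin t W U).
have wK U W : opR U W -> ip (clin t W U) (clin t W U) <= K * ip (w U W) (w U W).
  move=> h; have [lU lW lV] := L2op _ _ h.
  have lT : L2c (clin tau W U) by exact: L2c_lin.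
  have ew : ip (w U W) (w U W) = m ^+ 2 * ip (clin tau W U) (clin tau W U).
    have mn : m != 0 by rewrite lt_eqF.
    rewrite /w !(ip_lin2 Hc)// (ip_sym p q r U (clin _ _ _)) (ip_lin Hc)// /tau.
    by field.
  have hD : ip U U <= D * ip (clin tau W U) (clin tau W U).
    apply: le_trans (HD0 _ _ h) _.
    by rewrite ler_wpM2r ?(ip_ge0 Hc)// ler_norm.
  have -> : clin t W U = clin (- (tau - t)) (clin tau W U) U.
    by apply/funext => k; apply/funext => c; apply/funext => x; rewrite /clin /rlin; ring.
  rewrite ew /K mulrA divfK ?gt_eqF//.
  have := ip_ge0 Hc (clin (tau - t) (clin tau W U) U).
  rewrite !(ip_lin2 Hc (_ : _) lT lU)//.
  have : (tau - t) ^+ 2 * ip U U <= (tau - t) ^+ 2 * (D * ip (clin tau W U) (clin tau W U)).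
    by rewrite ler_wpM2l// sqr_ge0.
  by rewrite sqrrN; lra.
(* Write [A] for [(S + t)^-1]. The form of [A - m] lies between 0 and [C2], so [w = (A - m) v]
   satisfies [|w|^2 <= C2 <(A - m) v, v>], shown with the test vector [v - w / C2]. For [v] with
   quotient within [K^-1 / (2 C2)] of [m] this contradicts [|v|^2 <= K |w|^2]. *)
pose C2 := (C + 1) / 2 - m.
have C0_ge0 : 0 <= C by exact: normr_ge0.
have C20 : 0 < C2 by rewrite /C2; lra.
have Ke : 0 < K^-1 / (2 * C2) by rewrite divr_gt0 ?invr_gt0// mulr_gt0.
have [_ [U [W [h vp ->]]] Hs] := inf_adherent Ke hS.
rewrite -/m ltr_pdivrMr// in Hs.
have [lU lW lV] := L2op _ _ h.
set v := clin t W U in vp Hs lV.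
have cw : closR (w U W).
  by have [_ cU cW] := h; apply: closR_lin => //; exact: closR_lin.
have [lw _] := cw.
have [U' [W' [h' E]]] := surj _ cw; rewrite /= in E.
have [lU' lW' lV'] := L2op _ _ h'.
set v' := clin t W' U' in lV' E.
have e1 Z : L2c Z -> ip v' Z = ip (w U W) Z by move=> lZ; exact: ip_eq.
have ww : ip v' v' = ip (w U W) (w U W) by rewrite e1// (ip_sym p q r _ v') e1.
have sym : ip U' v = ip U v'.
  have [r1 _ _] := h; have [r2 _ _] := h'.
  rewrite /v /v' !(ip_sym p q r _ (clin _ _ _)) !(ip_lin Hc)// (ip_sym p q r U U').
  by rewrite (ip_sym p q r W' U) (relR_sym Hc r1 r2).
have op2 := opR_lin (- C2^-1) h h'.
have H := mle _ _ op2.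
have ev : clin t (clin (- C2^-1) W W') (clin (- C2^-1) U U') = clin (- C2^-1) v v'.
  by apply/funext => k; apply/funext => c; apply/funext => x; rewrite /v /v' /clin /rlin; ring.
rewrite ev in H.
have lvv : L2c (clin (- C2^-1) v v') by exact: L2c_lin.
have wv : ip (w U W) v' = ip U v' - m * ip v v'.
  by rewrite /w -/v (ip_lin Hc)//; ring.
have wv' : ip (w U W) v' = ip (w U W) (w U W) by rewrite (ip_sym p q r _ v') e1.
have uv' : ip U' v' <= (C + 1) / 2 * ip (w U W) (w U W).
  have := HC _ _ h'; have := ip_amgm Hc lU' lV'; rewrite -/v' ww ler_norml => /andP[_ ?].
  lra.
have kv := wK _ _ h; rewrite -/v in kv.
clear ev op2 e1; clearbody v v'.
rewrite (ip_lin2 Hc)// (ip_lin Hc)// !(ip_sym p q r _ (clin (- C2^-1) v v')) !(ip_lin Hc)// in H.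
rewrite (ip_sym p q r v U) (ip_sym p q r v' U) (ip_sym p q r v U') (ip_sym p q r v' U') sym in H.
rewrite ww in H.
set wn := ip (w U W) (w U W) in wv wv' uv' kv H.
have c2 : C2^-1 ^+ 2 * (ip U' v' - m * wn) <= C2^-1 * wn.
  rewrite expr2 -mulrA ler_pM2l ?invr_gt0// ler_pdivrMl//.
  by rewrite /C2; lra.
have H2 : 2 * C2^-1 * wn - C2^-1 ^+ 2 * (ip U' v' - m * wn) <= ip U v - m * ip v v.
  have e : wn = ip U v' - m * ip v v' by rewrite -wv' wv.
  rewrite {1}e; move: H; rewrite sqrrN.
  by lra.
have H3 : C2^-1 * wn < K^-1 / (2 * C2) * ip v v by lra.
have : K^-1 * ip v v <= wn by rewrite ler_pdivrMl.
rewrite -(ler_pM2l (_ : 0 < C2^-1)) ?invr_gt0// => H4.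
have : K^-1 / (2 * C2) * ip v v = (C2^-1 * (K^-1 * ip v v)) / 2 by field; rewrite !gt_eqF.
have : 0 < C2^-1 * (K^-1 * ip v v) by rewrite !mulr_gt0 ?invr_gt0.
lra.
Qed.

(** [(F, G)] need not lie in the graph of the operator, so [F] is approximated by
    [f = t (S + t)^-1 F] with [t = s^-2]. Its image is [g = t (F - f)]; symmetry and [<f, g> >= 0]
    give [t |F - f|^2 <= <G, f>]. Hence [<G, f> >= 0], and [F - f] is of order [s]. *)
Lemma form_nonneg F G : relR F G -> 0 <= ip F G.
Proof.
move=> rFG; have [lF lG _] := rFG.
pose M := (ip G G + ip F F) / 2.
have G0 := ip_ge0 Hc G; have F0 := ip_ge0 Hc F.
have M0 : 0 <= M by rewrite /M; lra.
suff H s : 0 < s -> - (s * (ip G G + M)) <= ip F G.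
  apply/ler_addgt0Pl => e e0.
  have d0 : 0 < ip G G + M + 1 by lra.
  have := H (e / (ip G G + M + 1)) (divr_gt0 e0 d0).
  have : e / (ip G G + M + 1) * (ip G G + M) <= e.
    by rewrite mulrAC ler_pdivrMr// ler_pM2l//; lra.
  lra.
move=> s0; pose t := s ^- 2; have t0 : 0 < t by rewrite invr_gt0 exprn_gt0.
have [surj _] := resH t0.
have cF : closR F by apply: domR_closR; exists G.
(* [clin (t - 1) F F] is [t F]. *)
have ctF : closR (clin (t - 1) F F) by exact: closR_lin.
have [f [g [opfg E]]] := surj _ ctF; rewrite /= in E.
have [rfg cf cg] := opfg; have [lf lg _] := rfg.
have ltF : L2c (clin (t - 1) F F) by have [] := ctF.
have ltg : L2c (clin t g f) by exact: L2c_lin.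
have e1 Z : L2c Z -> ip g Z = t * (ip F Z - ip f Z).
  move=> lZ; have := ip_eq ltg ltF lZ E; rewrite !(ip_lin Hc)//; lra.
have pos : 0 <= ip f g.
  apply/ler_addgt0Pl => e e0.
  pose u := e / (ip f f + 1).
  have f0 := ip_ge0 Hc f; have u0 : 0 < u by rewrite divr_gt0//; lra.
  have := resolvent_form_ge0 u0 opfg; rewrite (ip_sym p q r f) (ip_lin Hc)//.
  rewrite (ip_sym p q r g) => h.
  have : u * ip f f <= e by rewrite /u mulrAC ler_pdivrMr; [rewrite ler_pM2l//; lra|lra].
  lra.
rewrite (ip_sym p q r f) e1// in pos.
have sym : ip F g = ip G f by exact: relR_sym.
rewrite (ip_sym p q r F) e1// in sym.
pose d := ip F F - 2 * ip F f + ip f f.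
have d0 : 0 <= d.
  by have := ip_ge0 Hc (clin (-1) F f); rewrite (ip_lin2 Hc)// /d; lra.
have fF : ip f f <= ip F f by move: pos; rewrite pmulr_rge0// subr_ge0.
have fF2 : ip f f <= ip F F.
  by have := ip_amgm Hc lF lf; rewrite ler_norml => /andP[_ ?]; lra.
have td : t * d <= ip G f.
  by rewrite -sym (ip_sym p q r f F) /d; move: pos; lra.
have Gf : ip G f <= M.
  by have := ip_amgm Hc lG lf; rewrite ler_norml /M => /andP[_ ?]; lra.
have dM : d <= s ^+ 2 * M.
  have : t * d <= M by lra.
  by rewrite /t ler_pdivrMl ?exprn_gt0.
have Gf0 : 0 <= ip G f by apply: le_trans td; rewrite mulr_ge0// ltW.
have h1 := ip_ge0 Hc (clin s (clin (-1) F f) G).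
have lD : L2c (clin (-1) F f) by exact: L2c_lin.
rewrite (ip_lin2 Hc)// (ip_lin2 Hc (-1) lF lf) (ip_lin Hc)// (ip_sym p q r f G) in h1.
have h2 : 0 <= s * (s * M + 2 * (ip F G - ip G f) + s * ip G G).
  by move: h1; rewrite /d in dM; lra.
rewrite pmulr_rge0// in h2.
have sM : 0 <= s * M by rewrite mulr_ge0// ltW.
have sG : 0 <= s * ip G G by rewrite mulr_ge0// ltW.
by lra.
Qed.

End AbstractPositivity.

(** * Between vector-valued functions and their Borel components *)

Section Transfer.
Context {R : realType}.
Local Notation mu := (@lebesgue_measure R).
Local Notation leb := (@completed_lebesgue_measure R).
Local Notation lebR := (caratheodory_type (wlength (@idfun R))^*%mu).

(** Completeness: every subset of the exceptional null set is measurable. *)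
Lemma ae_lebesgue_measurable (f h : R -> R) : measurable_fun [set: R] h ->
  {ae mu, forall x : R, f x = h x} -> lebesgue_measurable f.
Proof.
move=> mh [N [mN N0 fN]] _ Y mY; rewrite setTI.
have fh x : ~ N x -> f x = h x by move=> nx; apply: contrapT => ne; apply: nx; exact: fN.
have -> : f @^-1` Y = ((h @^-1` Y) `&` ~` N) `|` (f @^-1` Y `&` N).
  apply/seteqP; split => x /=.
    by move=> Yf; have [Nx|Nx] := pselect (N x); [right|left; rewrite -fh].
  by move=> [[Yh /fh ->]|[]].
apply: measurableU.
  apply: completed_measurable; apply: measurableI; last exact: measurableC.
  by rewrite -[X in measurable X]setTI; exact: mh.
apply: negligible_sub_caratheodory; exists N; split; first exact: completed_measurable.
  exact: N0.
exact: subIsetr.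
Qed.

Lemma integral_representative (f h : R -> R) : measurable_fun [set: R] h ->
  {ae mu, forall x : R, f x = h x} ->
  (\int[leb]_x (f x)%:E = \int[mu]_x (h x)%:E)%E.
Proof.
move=> mh fh.
have mE : measurable_fun [set: R] (EFin \o h) by exact/measurable_EFinP.
rewrite -integral_completed//.
have h1 : measurable_fun [set: lebR] (EFin \o f : lebR -> \bar R).
  by apply/measurable_EFinP; exact: ae_lebesgue_measurable fh.
have h2 : measurable_fun [set: lebR] (EFin \o h : lebR -> \bar R).
  by apply/measurable_EFinP; exact: lebesgue_measurable_borel.
have h3 : ae_eq leb setT (EFin \o f : lebR -> \bar R) (EFin \o h).
  have /ae_completed := fh.
  by apply: (@filterS _ _ (ae_filter_ringOfSetsType leb)) => x /= -> _.
exact: (@ae_eq_integral _ lebR R leb setT _ _ measurableT h1 h2 h3).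
Qed.

Lemma Rintegral_representative (f h : R -> R) : measurable_fun [set: R] h ->
  {ae mu, forall x : R, f x = h x} -> \int[leb]_x f x = IR h.
Proof. by move=> mh fh; rewrite /Rintegral (integral_representative mh fh). Qed.

Lemma iR_finite (h : R -> R) : measurable_fun [set: R] h -> (forall x, 0 <= h x) ->
  iR h <-> (\int[mu]_x (h x)%:E < +oo)%E.
Proof.
move=> mh h0; split => [[_ /integrableP[_]]|hoo].
  by under eq_integral => x _ do rewrite /= ger0_norm//.
split => //; apply/integrableP; split; first exact/measurable_EFinP.
by under eq_integral => x _ do rewrite /= ger0_norm//.
Qed.

Lemma integral_eq0_ae (h : R -> R) : measurable_fun [set: R] h -> (forall x, 0 <= h x) ->
  (\int[mu]_x (h x)%:E = 0)%E <-> {ae mu, forall x : R, h x = 0}.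
Proof.
move=> mh h0; split => [i0|ae0].
  have iRh : iR h by apply/iR_finite => //; rewrite i0.
  by apply: IR_eq0 => //; rewrite /IR /Rintegral i0.
have iz : iR (fun _ : R => 0 : R) by split; [exact: measurable_cst|exact: integrable0].
rewrite IR_fin; last exact: ae_iR iz ae0.
by rewrite (ae_IR mh (measurable_cst _) ae0) /IR /Rintegral integral0.
Qed.

Lemma AC_cont (F : R -> R) : (forall a b, abs_continuous a b F) -> continuous F.
Proof.
move=> ac x; apply/cvgrPdist_lt => e e0.
have [d d0 Hd] := ac (x - 1) (x + 1) e e0.
near=> t.
have xt1 : `|x - t| < 1 by near: t; exact: (@nbhsx_ballx _ R).
have xtd : `|x - t| < d by near: t; exact: (@nbhsx_ballx _ R).
have one (u v : R) : u < v -> x - 1 <= u -> v <= x + 1 -> v - u < d -> `|F v - F u| < e.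
  move=> uv xu vx vud.
  have := Hd 1%N (fun=> u) (fun=> v); rewrite !big_ord1; apply => //.
  by apply/trivIsetP => i j _ _; rewrite !ord1 eqxx.
move: xt1; rewrite ltr_norml => /andP[? ?].
case: (ltgtP x t) => [xt|tx|->]; last by rewrite subrr normr0.
  by rewrite distrC; apply: one => //; [lra|lra|rewrite distrC gtr0_norm in xtd; lra].
by apply: one => //; [lra|lra|rewrite gtr0_norm in xtd; lra].
Unshelve. all: by end_near. Qed.

Definition c2i (c : bool) : 'I_2 := if c then lift ord0 ord0 else ord0.
Definition i2c (i : 'I_2) : bool := i != ord0.

Lemma c2iK c : i2c (c2i c) = c.
Proof. by case: c. Qed.

Lemma i2cK i : c2i (i2c i) = i.
Proof. by apply/val_inj; case: i => -[|[|]]. Qed.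

Definition cpt (k : bool) (z : R[i]) : R := if k then complex.Im z else complex.Re z.

Definition crep (f : R -> 'cV[R[i]]_2) (F : @cvec R) : Prop :=
  (forall k c, measurable_fun [set: R] (F k c)) /\
  {ae mu, forall x : R, forall k c, cpt k (f x (c2i c) 0) = F k c x}.

Definition r2c (F : @cvec R) (x : R) : 'cV[R[i]]_2 :=
  \col_i (F false (i2c i) x +i* F true (i2c i) x).

Lemma cpt_r2c F x k c : cpt k (r2c F x (c2i c) 0) = F k c x.
Proof. by rewrite /r2c mxE c2iK; case: k. Qed.

Lemma crep_r2c F : (forall k c, measurable_fun [set: R] (F k c)) -> crep (r2c F) F.
Proof. by move=> mF; split => //; apply: aeT => x k c; exact: cpt_r2c. Qed.

Lemma vmeasurable_r2c F : (forall k c, measurable_fun [set: R] (F k c)) -> vmeasurable (r2c F).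
Proof.
move=> mF i; rewrite -(i2cK i); split; apply: lebesgue_measurable_borel.
  have -> : (fun x => complex.Re (r2c F x (c2i (i2c i)) 0)) = F false (i2c i).
    by apply/funext => x; exact: (cpt_r2c F x false).
  exact: mF.
have -> : (fun x => complex.Im (r2c F x (c2i (i2c i)) 0)) = F true (i2c i).
  by apply/funext => x; exact: (cpt_r2c F x true).
exact: mF.
Qed.

Lemma ae_forall_bool (P : bool -> R -> Prop) :
  (forall b, {ae mu, forall x : R, P b x}) -> {ae mu, forall x : R, forall b, P b x}.
Proof. by move=> H; apply: aeS (aeI (H true) (H false)) => x [? ?] []. Qed.

Lemma crep_exists f : vmeasurable f -> exists F, crep f F.
Proof.
move=> mf.
have H (kc : bool * bool) : exists h, measurable_fun [set: R] h /\
    {ae mu, forall x : R, cpt kc.1 (f x (c2i kc.2) 0) = h x}.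
  have [m1 m2] := mf (c2i kc.2).
  by case: kc m1 m2 => -[] c m1 m2; [have [h mh e] := borel_representative m2|have [h mh e] := borel_representative m1];
    exists h.
have [h Hh] := choice H.
exists (fun k c => h (k, c)); split; first by move=> k c; exact: (Hh (k, c)).1.
by apply: ae_forall_bool => k; apply: ae_forall_bool => c; exact: (Hh (k, c)).2.
Qed.

Lemma crep_sub f g F G : crep f F -> crep g G -> crep (f \- g) (clin (-1) F G).
Proof.
move=> [mF eF] [mG eG]; split.
  by move=> k c; apply: measurable_funD => //; apply: measurable_funM.
apply: aeS (aeI eF eG) => x [h1 h2] k c; rewrite /clin /rlin -h1 -h2 !mxE.
by rewrite /cpt; case: k; case: (f x _ _) => a b; case: (g x _ _) => a' b' /=; ring.
Qed.

Lemma crep_shift x y f g F G : crep f F -> crep g G ->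
  crep (Defs.shift (x +i* y) f g) (clin (-1) G (zmul x y F)).
Proof.
move=> [mF eF] [mG eG]; split.
  move=> k c; apply: measurable_funD => //; apply: measurable_funM => //.
  by case: k; [apply: measurable_funD|apply: measurable_funB]; apply: measurable_funM.
apply: aeS (aeI eF eG) => t [h1 h2] k c; rewrite /clin /rlin /zmul -h2 -!h1 /Defs.shift !mxE.
by rewrite /cpt; case: k; case: (f t _ _) => a b; case: (g t _ _) => a' b' /=; ring.
Qed.

Context (H : R -> 'M[R]_2).
Context (p q r : R -> R).
Context (Hc : coeff p q r).
Definition Hrep := {ae mu, forall x : R, [/\ H x ord0 ord0 = p x,
  H x ord0 (lift ord0 ord0) = q x, H x (lift ord0 ord0) ord0 = q x &
  H x (lift ord0 ord0) (lift ord0 ord0) = r x]}.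
Context (hrep : Hrep).
Local Notation Q := (Q p q r).
Local Notation QQ := (QQ p q r).
Local Notation L2c := (L2c p q r).
Local Notation relR := (relR p q r).
Local Notation ip := (ip p q r).
Local Notation csolves := (csolves p q r).

Lemma formH_rep f g F G : crep f F -> crep g G ->
  {ae mu, forall x : R, complex.Re (formH H f g x) = QQ F G x}.
Proof.
move=> [mF eF] [mG eG]; apply: aeS (aeI hrep (aeI eF eG)) => x [[h1 h2 h3 h4] [f1 g1]].
rewrite /Submission.QQ /Submission.Q -!f1 -!g1 /formH /cplxH.
rewrite mxE big_ord_recl big_ord1 !mxE !big_ord_recl !big_ord0 !mxE h1 h2 h3 h4 /cpt /=.
case: (f x ord0 0) => a b; case: (f x (lift ord0 ord0) 0) => c d.
case: (g x ord0 0) => a' b'; case: (g x (lift ord0 ord0) 0) => c' d' /=.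
by ring.
Qed.

Lemma measurable_QQ F G : (forall k c, measurable_fun [set: R] (F k c)) ->
  (forall k c, measurable_fun [set: R] (G k c)) -> measurable_fun [set: R] (QQ F G).
Proof. by move=> mF mG; apply: measurable_funD; exact: (measurable_Q Hc). Qed.

Lemma sqnormH_rep f F : crep f F -> sqnormH H f = (\int[mu]_x (QQ F F x)%:E)%E.
Proof.
move=> rf; apply: integral_representative; first by apply: measurable_QQ; exact: rf.1.
exact: formH_rep.
Qed.

Lemma normH_rep f F : crep f F -> normH H f = Num.sqrt (ip F F).
Proof.
move=> rf; rewrite /normH /innerH /=; congr Num.sqrt.
apply: Rintegral_representative; first by apply: measurable_QQ; exact: rf.1.
exact: formH_rep.
Qed.

Lemma L2c_iR F : (forall k c, measurable_fun [set: R] (F k c)) -> iR (QQ F F) -> L2c F.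
Proof.
move=> mF iF k; split => //; apply: (iR_le _ iF); first exact: (measurable_Q Hc).
move=> x; rewrite ger0_norm ?Q_ge0// /Submission.QQ.
have := Q_ge0 Hc (F false) x; have := Q_ge0 Hc (F true) x.
by case: k; lra.
Qed.

Lemma L2H_rep f F : vmeasurable f -> crep f F -> L2H H f <-> L2c F.
Proof.
move=> mf rf; rewrite /L2H (sqnormH_rep rf).
have mQ : measurable_fun [set: R] (QQ F F) by apply: measurable_QQ; exact: rf.1.
have h := iR_finite mQ (QQ_ge0 Hc F).
split => [[_ /h iF]|lF]; first by apply: L2c_iR => //; exact: rf.1.
by split => //; apply/h; exact: iR_QQ.
Qed.

Lemma eqH_rep f g F G : crep f F -> crep g G ->
  eqH H f g <-> {ae mu, forall x : R, QQ (clin (-1) F G) (clin (-1) F G) x = 0}.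
Proof.
move=> rf rg; have rfg := crep_sub rf rg; rewrite /eqH (sqnormH_rep rfg).
apply: integral_eq0_ae; last exact: (QQ_ge0 Hc).
by apply: measurable_QQ; exact: rfg.1.
Qed.

Lemma derive_eq_rep (g : R -> 'cV[R[i]]_2) (G : @cvec R) x (v : 'cV[R[i]]_2) :
  (forall k c, cpt k (g x (c2i c) 0) = G k c x) ->
  [/\ H x ord0 ord0 = p x, H x ord0 (lift ord0 ord0) = q x,
      H x (lift ord0 ord0) ord0 = q x & H x (lift ord0 ord0) (lift ord0 ord0) = r x] ->
  Jmx *m v = - (cplxH H x *m g x) <->
   forall k, cpt k (v (c2i false) 0) = - (q x * G k false x + r x * G k true x) /\
             cpt k (v (c2i true) 0) = p x * G k false x + q x * G k true x.
Proof.
move=> gG [h1 h2 h3 h4].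
have E i : (Jmx *m v) i 0 = if i2c i then v (c2i false) 0 else - v (c2i true) 0.
  rewrite mxE big_ord_recl big_ord1 !mxE -(i2cK i); case: (i2c i) => /=.
    by rewrite mul1r mul0r addr0.
  by rewrite mul0r add0r mulN1r.
have E' i : (- (cplxH H x *m g x)) i 0 = if i2c i
    then - ((q x)%:C * g x (c2i false) 0 + (r x)%:C * g x (c2i true) 0)
    else - ((p x)%:C * g x (c2i false) 0 + (q x)%:C * g x (c2i true) 0).
  rewrite mxE mxE big_ord_recl big_ord1 !mxE -(i2cK i).
  by case: (i2c i); rewrite /= ?h1 ?h2 ?h3 ?h4.
split => [e k|e].
  have := congr1 (fun M : 'cV_2 => M (c2i true) 0) e.
  have := congr1 (fun M : 'cV_2 => M (c2i false) 0) e.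
  rewrite !E !E' !c2iK => e0 e1.
  have {}e0 : v (c2i true) 0 = (p x)%:C * g x (c2i false) 0 + (q x)%:C * g x (c2i true) 0.
    by apply: oppr_inj.
  rewrite e0 e1 -!gG /cpt.
  by case: k; case: (g x (c2i false) 0) => a b; case: (g x (c2i true) 0) => a' b' /=; split; ring.
apply/matrixP => i j; rewrite (ord1 j) E E'.
have eC (z w : R[i]) : (forall k, cpt k z = cpt k w) -> z = w.
  by case: z => a b; case: w => a' b' h; have := h false; have := h true; rewrite /cpt /= => -> ->.
case: (i2c i); apply: eC => k; have [e1 e2] := e k.
  rewrite e1 -!gG /cpt.
  by case: k {e1 e2}; case: (g x (c2i false) 0) => a b; case: (g x (c2i true) 0) => a' b' /=; ring.
have : cpt k (- v (c2i true) 0) = - (p x * G k false x + q x * G k true x).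
  by rewrite -e2 /cpt; case: k {e1 e2}; case: (v _ _).
move=> ->; rewrite -!gG /cpt.
by case: k {e1 e2}; case: (g x (c2i false) 0) => a b; case: (g x (c2i true) 0) => a' b' /=; ring.
Qed.

End Transfer.

Section Correspondence.
Context {R : realType}.
Local Notation mu := (@lebesgue_measure R).
Local Notation leb := (@completed_lebesgue_measure R).
Context (H : R -> 'M[R]_2) (p q r : R -> R).
Context (Hc : coeff p q r).
Context (hrep : Hrep H p q r).
Local Notation Q := (Q p q r).
Local Notation QQ := (QQ p q r).
Local Notation L2c := (L2c p q r).
Local Notation relR := (relR p q r).
Local Notation ip := (ip p q r).
Local Notation csolves := (csolves p q r).
Local Notation domR := (domR p q r).
Local Notation closR := (closR p q r).
Local Notation opR := (opR p q r).

(** [AC_prim] turns the almost everywhere derivative into an integral identity; [lint_Hg] provides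
    the local integrability. *)
Lemma relS_relR f g F G : crep f F -> crep g G -> relS H f g -> relR F G.
Proof.
move=> rf rg [Lf Lg [f0 [mf0 ef0 ac df]]].
have lF : L2c F by apply/(L2H_rep Hc hrep Lf.1 rf).
have lG : L2c G by apply/(L2H_rep Hc hrep Lg.1 rg).
pose F0 : cvec := fun k c x => cpt k (f0 x (c2i c) 0).
have acF k c a b : abs_continuous a b (F0 k c).
  by have [h1 h2] := ac (c2i c) a b; case: k; [exact: h2|exact: h1].
have rf0 : crep f0 F0.
  split; last by apply: aeT.
  by move=> k c; apply: continuous_measurable_fun; apply: AC_cont.
split => //; exists F0; split; last exact/(eqH_rep Hc hrep rf rf0).
have D : {ae mu, forall x : R, forall k,
    is_derive x (1 : R) (F0 k false) (- (q x * G k false x + r x * G k true x)) /\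
    is_derive x (1 : R) (F0 k true) (p x * G k false x + q x * G k true x)}.
  move/ae_completed: df => df; apply: aeS (aeI df (aeI rg.2 hrep)) => x [[v dv ev] [gx hx]] k.
  have /(_ k) [e1 e2] := (derive_eq_rep v gx hx).1 ev.
  rewrite -e1 -e2; have [a1 a2] := dv (c2i false); have [b1 b2] := dv (c2i true).
  by rewrite /cpt /F0; case: k {e1 e2}.
move=> k.
have [i1 i2] := lint_Hg Hc (lG k).1 (iR_lint (lG k).2).
by split; apply: AC_prim => //; [exact: lintN|apply: aeS D => x /(_ k) []|apply: aeS D => x /(_ k) []].
Qed.

Lemma relR_relS f g F G : vmeasurable f -> vmeasurable g -> crep f F -> crep g G ->
  relR F G -> relS H f g.
Proof.
move=> mf mg rf rg [lF lG [F0 [s0 e0]]]; split.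
- exact/(L2H_rep Hc hrep mf rf).
- exact/(L2H_rep Hc hrep mg rg).
have mF0 k c : measurable_fun [set: R] (F0 k c).
  by apply: continuous_measurable_fun; exact: solves_cont (s0 k).
have rf0 := crep_r2c mF0.
have reE i : (fun x => complex.Re (r2c F0 x i 0)) = F0 false (i2c i).
  by apply/funext => x; rewrite -{1}(i2cK i); exact: (cpt_r2c F0 x false).
have imE i : (fun x => complex.Im (r2c F0 x i 0)) = F0 true (i2c i).
  by apply/funext => x; rewrite -{1}(i2cK i); exact: (cpt_r2c F0 x true).
exists (r2c F0); split.
- exact: vmeasurable_r2c.
- exact/(eqH_rep Hc hrep rf rf0).
- move=> i a b; rewrite reE imE; have [a1 a2] := s0 false; have [b1 b2] := s0 true.
  by case: (i2c i); split; apply: prim_AC; eassumption.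
have D : {ae mu, forall x : R, forall k,
    is_derive x (1 : R) (F0 k false) (- (q x * G k false x + r x * G k true x)) /\
    is_derive x (1 : R) (F0 k true) (p x * G k false x + q x * G k true x)}.
  apply: ae_forall_bool => k; have [a1 a2] := s0 k.
  by apply: aeS (aeI (prim_ae_derive a1) (prim_ae_derive a2)) => x [].
apply/ae_completed; apply: aeS (aeI D (aeI rg.2 hrep)) => x [Dx [gx hx]].
pose V : cvec := fun k c x =>
  if c then p x * G k false x + q x * G k true x
  else - (q x * G k false x + r x * G k true x).
exists (r2c V x).
  move=> i; rewrite reE imE; have := cpt_r2c V x false (i2c i).
  have := cpt_r2c V x true (i2c i); rewrite i2cK /cpt => -> ->.
  have [a1 a2] := Dx false; have [b1 b2] := Dx true.
  by rewrite /V; case: (i2c i).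
by apply/(derive_eq_rep _ gx hx) => k; rewrite !cpt_r2c.
Qed.

Lemma domS_domR f F : crep f F -> domS H f -> domR F.
Proof.
move=> rf [g h]; have [_ [mg _] _] := h; have [G rg] := crep_exists mg.
by exists G; exact: relS_relR h.
Qed.

Lemma domR_domS F : domR F -> domS H (r2c F).
Proof.
move=> [G h]; have [lF lG _] := h; exists (r2c G).
have mF k c : measurable_fun [set: R] (F k c) by exact: (lF k).1.
have mG k c : measurable_fun [set: R] (G k c) by exact: (lG k).1.
by apply: (relR_relS _ _ _ _ h); [exact: vmeasurable_r2c|exact: vmeasurable_r2c|exact: crep_r2c|exact: crep_r2c].
Qed.

Lemma domS_vmeasurable f : domS H f -> vmeasurable f.
Proof. by move=> [g [[]]]. Qed.

Lemma sqrt_lt_sqr (a e : R) : 0 <= a -> 0 < e -> (Num.sqrt a < e) = (a < e ^+ 2).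
Proof. by move=> a0 e0; rewrite -{1}(ger0_norm (ltW e0)) -sqrtr_sqr ltr_sqrt// exprn_gt0. Qed.

Lemma closS_closR f F : crep f F -> closure_domS H f -> closR F.
Proof.
move=> rf [Lf h]; split; first exact/(L2H_rep Hc hrep Lf.1 rf).
move=> e e0; have se0 : 0 < Num.sqrt e by rewrite sqrtr_gt0.
have [d dd hd] := h _ se0; have [D rd] := crep_exists (domS_vmeasurable dd).
exists D; first exact: domS_domR dd.
by move: hd; rewrite (normH_rep Hc hrep (crep_sub rf rd)) ltr_sqrt.
Qed.

Lemma closR_closS f F : vmeasurable f -> crep f F -> closR F -> closure_domS H f.
Proof.
move=> mf rf [lF h]; split; first exact/(L2H_rep Hc hrep mf rf).
move=> e e0; have [D dD hD] := h _ (exprn_gt0 2 e0).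
have mD k c : measurable_fun [set: R] (D k c) by have [G [lD _ _]] := dD; exact: (lD k).1.
exists (r2c D); first exact: domR_domS.
rewrite (normH_rep Hc hrep (crep_sub rf (crep_r2c mD))) sqrt_lt_sqr//.
exact: ip_ge0.
Qed.

Lemma opS_opR f g F G : crep f F -> crep g G -> opS H f g -> opR F G.
Proof.
move=> rf rg [h1 h2 h3]; split; [exact: relS_relR h1|exact: closS_closR h2|exact: closS_closR h3].
Qed.

Lemma opR_opS f g F G : vmeasurable f -> vmeasurable g -> crep f F -> crep g G ->
  opR F G -> opS H f g.
Proof.
move=> mf mg rf rg [h1 h2 h3].
by split; [exact: relR_relS h1|exact: closR_closS h2|exact: closR_closS h3].
Qed.

Lemma eqH_ip f g F G : L2c F -> L2c G -> crep f F -> crep g G ->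
  eqH H f g <-> ip (clin (-1) F G) (clin (-1) F G) = 0.
Proof.
move=> lF lG rf rg.
have l := L2c_lin Hc (-1) lF lG; have i := iR_QQ Hc l l.
rewrite (eqH_rep Hc hrep rf rg); split=> [h|h].
  rewrite /Submission.ip (ae_IR i.1 (measurable_cst _) h) /IR /Rintegral.
  by rewrite integral0.
by apply: IR_eq0 => // x; exact: QQ_ge0.
Qed.

End Correspondence.

(** * Entries of the coefficient and limits of the phase *)

Section Coefficients.
Context {R : realType}.
Local Notation mu := (@lebesgue_measure R).

Lemma psd2_entries (A : 'M[R]_2) : A^T = A -> psd2 A ->
  [/\ 0 <= A ord0 ord0, 0 <= A (lift ord0 ord0) (lift ord0 ord0),
      A (lift ord0 ord0) ord0 = A ord0 (lift ord0 ord0) &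
      A ord0 (lift ord0 ord0) ^+ 2 <= A ord0 ord0 * A (lift ord0 ord0) (lift ord0 ord0)].
Proof.
move=> sA pA.
set a := A ord0 ord0; set b := A ord0 _; set d := A _ _.
have ba : A (lift ord0 ord0) ord0 = b by rewrite -{1}sA mxE.
have form (s t : R) : 0 <= a * s ^+ 2 + 2 * b * s * t + d * t ^+ 2.
  have := pA (\col_i (if i == 0 then s else t)).
  rewrite !mxE big_ord_recl big_ord1 !mxE !big_ord_recl !big_ord0 !mxE /= ba -/a -/b -/d.
  by move=> h; apply: le_trans h _; rewrite le_eqVlt; apply/orP; left; apply/eqP; ring.
(* The last two values are [d] and [a] times the determinant. If that is negative, [a = d = 0], and
   the vector [(b, -1)] gives [- 2 b^2 < 0]. *)
have a0 := form 1 0; have d0 := form 0 1; have h1 := form d (- b); have h2 := form b (- a).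
have {}a0 : 0 <= a by lra.
have {}d0 : 0 <= d by lra.
split => //; rewrite leNgt; apply/negP => lt; pose e := b ^+ 2 - a * d.
have e0 : 0 < e by rewrite subr_gt0.
have {}h1 : d * e <= 0 by rewrite /e; lra.
have {}h2 : a * e <= 0 by rewrite /e; lra.
rewrite pmulr_lle0// in h1; rewrite pmulr_lle0// in h2.
have := form b (-1); have := mulr_ge0 a0 d0; have := sqr_ge0 b.
have -> : a = 0 by lra.
have -> : d = 0 by lra.
by rewrite /e in e0; nra.
Qed.

Lemma coefficient_representative (H : R -> 'M[R]_2) : coefficient_fun H ->
  exists p q r, coeff p q r /\ Hrep H p q r.
Proof.
move=> [mH /ae_completed aH].
have [a ma ea] := borel_representative (mH ord0 ord0).
have [b mb eb] := borel_representative (mH ord0 (lift ord0 ord0)).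
have [d md ed] := borel_representative (mH (lift ord0 ord0) (lift ord0 ord0)).
pose good x := (0 <= a x) && ((0 <= d x) && ((a x + d x == 1) && (b x ^+ 2 <= a x * d x))).
have mgood : measurable_fun [set: R] good.
  apply: measurable_and; first exact: measurable_fun_ler.
  apply: measurable_and; first exact: measurable_fun_ler.
  apply: measurable_and; first by apply: measurable_fun_eqr => //; exact: measurable_funD.
  by apply: measurable_fun_ler; [exact: measurable_funX|exact: measurable_funM].
have agood : {ae mu, forall x : R, [/\ good x, H x ord0 ord0 = a x,
    H x ord0 (lift ord0 ord0) = b x, H x (lift ord0 ord0) ord0 = b x &
    H x (lift ord0 ord0) (lift ord0 ord0) = d x]}.
  apply: aeS (aeI aH (aeI ea (aeI eb ed))) => x [[s /(psd2_entries s)[h1 h2 h3 h4] t] [e1 [e2 e3]]].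
  rewrite h3 e2; split => //; rewrite /good -e1 -e2 -e3 h1 h2 h4 andbT /=.
  by move: t; rewrite /mxtrace big_ord_recl big_ord1 => ->.
(* The default off the good set is the projection with entries [1, 0, 0], which keeps the trace
   equal to 1. *)
exists (fun x => if good x then a x else 1), (fun x => if good x then b x else 0),
  (fun x => if good x then d x else 0); split.
  split; try by apply: measurable_fun_ifT => //; exact: measurable_cst.
  - by move=> x; case: ifP => [/and4P[]|_].
  - by move=> x; case: ifP => [/and4P[]|_].
  - by move=> x; case: ifP => [/and4P[_ _ /eqP]|_] //; rewrite addr0.
  - by move=> x; case: ifP => [/and4P[]|_] //; rewrite expr0n mulr0.
by apply: aeS agood => x [-> -> -> -> ->].
Qed.

Lemma nonincreasing_limits (phi : R -> R) (m M : R) :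
  (forall x y, x <= y -> phi y <= phi x) -> (forall x, m <= phi x <= M) ->
  exists a b : R, [/\ phi x @[x --> -oo] --> a, phi x @[x --> +oo] --> b & a - b <= M - m].
Proof.
move=> mono bd.
have c1 : cvg (phi (- x) @[x --> +oo]).
  apply/cvg_ex; eexists; apply: nondecreasing_cvgr; first by move=> x y xy; apply: mono; rewrite lerN2.
  by exists M => _ [x _ <-]; case/andP: (bd (- x)).
have c2 : cvg (- phi x @[x --> +oo]).
  apply/cvg_ex; eexists; apply: nondecreasing_cvgr; first by move=> x y xy; rewrite lerN2 mono.
  by exists (- m) => _ [x _ <-]; rewrite lerN2; case/andP: (bd x).
exists (lim (phi (- x) @[x --> +oo])), (- lim (- phi x @[x --> +oo])); split.
- by apply/cvgNy_compNP.
- apply: cvg_trans (cvgN c2); apply: near_eq_cvg; apply: nearW => x.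
  by rewrite /= opprK.
rewrite opprK lerD//.
  by apply: limr_le => //; apply: nearW => x; case/andP: (bd (- x)).
by apply: limr_le => //; apply: nearW => x; rewrite lerN2; case/andP: (bd x).
Qed.

Lemma nonincreasing_between (phi : R -> R) (a b : R) :
  (forall x y, x <= y -> phi y <= phi x) ->
  phi x @[x --> -oo] --> a -> phi x @[x --> +oo] --> b -> forall x, b <= phi x <= a.
Proof.
move=> mono ca cb x; apply/andP; split.
  rewrite -(cvg_lim _ cb)//; apply: limr_le; first by apply/cvg_ex; exists b.
  by near=> y; apply: mono; near: y; exact: (nbhs_pinfty_ge (num_real x)).
rewrite -(cvg_lim _ ca)//; apply: limr_ge; first by apply/cvg_ex; exists a.
by near=> y; apply: mono; near: y; exact: (nbhs_ninfty_le (num_real x)).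
Unshelve. all: by end_near. Qed.

Lemma PmxE (t : R) : [/\ Pmx t ord0 ord0 = cos t ^+ 2,
  Pmx t ord0 (lift ord0 ord0) = cos t * sin t,
  Pmx t (lift ord0 ord0) ord0 = cos t * sin t &
  Pmx t (lift ord0 ord0) (lift ord0 ord0) = sin t ^+ 2].
Proof.
by rewrite /Pmx /evec !mxE !big_ord1 !mxE /=; split => //; rewrite mulrC.
Qed.

End Coefficients.

(** * The resolvent set in terms of representatives *)

Section Directions.
Context {R : realType}.
Local Notation mu := (@lebesgue_measure R).
Local Notation leb := (@completed_lebesgue_measure R).
Context (H : R -> 'M[R]_2) (p q r : R -> R).
Context (Hc : coeff p q r).
Context (hrep : Hrep H p q r).
Local Notation Q := (Q p q r).
Local Notation QQ := (QQ p q r).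
Local Notation L2c := (L2c p q r).
Local Notation relR := (relR p q r).
Local Notation ip := (ip p q r).
Local Notation closR := (closR p q r).
Local Notation opR := (opR p q r).

Lemma closR_measurable F : closR F -> forall k c, measurable_fun [set: R] (F k c).
Proof. by move=> [lF _] k c; exact: (lF k).1. Qed.

Lemma opS_reps f g : opS H f g -> exists F G, [/\ crep f F, crep g G & opR F G].
Proof.
move=> h; have [[[mf _] [mg _] _] _ _] := h.
have [F rF] := crep_exists mf; have [G rG] := crep_exists mg.
by exists F, G; split => //; exact: (opS_opR Hc hrep rF rG h).
Qed.

Lemma opR_r2c F G : opR F G -> opS H (r2c F) (r2c G).
Proof.
move=> h; have [_ cF cG] := h.
have mF := closR_measurable cF; have mG := closR_measurable cG.
by apply: (opR_opS Hc hrep _ _ _ _ h);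
  [exact: vmeasurable_r2c|exact: vmeasurable_r2c|exact: crep_r2c|exact: crep_r2c].
Qed.

Lemma L2c_shift (x y : R) F G : opR F G -> L2c (clin (-1) G (zmul x y F)).
Proof. by move=> [[lF lG _] _ _]; apply: L2c_lin => //; exact: L2c_zmul. Qed.

Lemma clin_negative t (F G : @cvec R) : clin (-1) G (zmul (- t) 0 F) = clin t G F.
Proof.
by apply/funext => -[]; apply/funext => c; apply/funext => s; rewrite /clin /rlin /zmul; ring.
Qed.

Lemma resolvent_set_negative t : resolvent_set H ((- t) +i* 0) -> negative_resolvent p q r t.
Proof.
move=> [surj _ [C HC]]; split => [U cU|].
  have mU := closR_measurable cU; have [lU _] := cU.
  have [f [g [h e]]] := surj _ (closR_closS Hc hrep (vmeasurable_r2c mU) (crep_r2c mU) cU).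
  have [F [G [rF rG hFG]]] := opS_reps h; exists F, G; split => //=.
  rewrite -(clin_negative t F G); apply/(eqH_ip Hc hrep _ lU (crep_shift (- t) 0 rF rG) (crep_r2c mU)) => //.
  exact: L2c_shift.
exists (C ^+ 2) => F G h; have [_ cF cG] := h.
have mF := closR_measurable cF; have mG := closR_measurable cG.
have := HC _ _ (opR_r2c h).
rewrite (normH_rep Hc hrep (crep_r2c mF)).
rewrite (normH_rep Hc hrep (crep_shift (- t) 0 (crep_r2c mF) (crep_r2c mG))) clin_negative.
set v := ip (clin t G F) _; have v0 : 0 <= v by exact: ip_ge0.
have u0 : 0 <= ip F F by exact: ip_ge0.
move=> le; rewrite -(sqr_sqrtr u0) -{1}(sqr_sqrtr v0) -exprMn.
rewrite lerXn2r// nnegrE; first exact: sqrtr_ge0.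
by apply: le_trans le; exact: sqrtr_ge0.
Qed.

Lemma spectrum_form_ge0 : spectrum H `<=` [set (t%:C : R[i]) | t in `[0, +oo[%classic] ->
  forall f g, L2r p q r f -> L2r p q r g -> solves p q r f g -> 0 <= IR (Q f g).
Proof.
move=> sp f g lf lg sfg.
have resH t : 0 < t -> negative_resolvent p q r t.
  move=> t0; apply: resolvent_set_negative; apply: contrapT => nr.
  have [s /=] := sp _ nr; rewrite in_itv /= andbT => s0 [e].
  by move: s0; rewrite e; lra.
have l0 : L2r p q r (fun _ _ => 0).
  split; first by move=> c; exact: measurable_cst.
  have -> : Q (fun _ _ => 0) (fun _ _ => 0) = fun t => 0.
    by apply/funext => t; rewrite /Submission.Q; ring.
  by split; [exact: measurable_cst|exact: integrable0].
(* A real pair is tested as a complex pair with imaginary part 0. *)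
pose E (h : rvec) : @cvec R := fun k => if k then fun _ _ => 0 else h.
have := @form_nonneg _ _ _ _ Hc resH (E f) (E g).
have -> : ip (E f) (E g) = IR (Q f g).
  by rewrite /Submission.ip; congr IR; apply/funext => t; rewrite /Submission.QQ /E /Submission.Q; ring.
apply; split; [by case|by case|exists (E f); split].
  case => //; rewrite /E; split; apply: (eq_prim (prim_cst 0)) => // t; ring.
by apply: aeT => t; rewrite /Submission.QQ /clin /rlin /Submission.Q; ring.
Qed.

Lemma relR_zmul x y F G : relR F G -> relR (zmul x y F) (zmul x y G).
Proof.
move=> [lF lG [F0 [s0 a0]]]; split; [exact: L2c_zmul|exact: L2c_zmul|exists (zmul x y F0); split].
  move=> k; have [a1 a2] := s0 false; have [b1 b2] := s0 true; case: k; split.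
  - by apply: (eq_prim (primD (primZ x b1) (primZ y a1))) => t //; rewrite /zmul; ring.
  - by apply: (eq_prim (primD (primZ x b2) (primZ y a2))) => t //; rewrite /zmul; ring.
  - by apply: (eq_prim (primB (primZ x a1) (primZ y b1))) => t //; rewrite /zmul; ring.
  - by apply: (eq_prim (primB (primZ x a2) (primZ y b2))) => t //; rewrite /zmul; ring.
apply: aeS a0 => t e.
have -> : clin (-1) (zmul x y F) (zmul x y F0) = zmul x y (clin (-1) F F0).
  by apply/funext => -[]; apply/funext => c; apply/funext => s; rewrite /clin /rlin /zmul; ring.
by rewrite QQ_zmul e mulr0.
Qed.

Lemma degenerate_closR U : degenerate p q r -> closR U -> ip U U = 0.
Proof.
move=> nd [lU hU]; apply/eqP; rewrite eq_le (ip_ge0 Hc) andbT.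
apply/ler_addgt0Pl => e e0; rewrite addr0; have [D [G rD] hD] := hU _ e0.
have [lD _ _] := rD; have d0 := degenerate_trivial Hc nd rD.
move: hD; rewrite (ip_lin2 Hc)// (ip_sym p q r U) (ip_zero Hc lD lU d0) d0.
by move=> h; apply: ltW; lra.
Qed.

Lemma resolvent_set_intro x y K : 0 <= K ->
  (forall F U, L2c F -> L2c U -> relR F (clin 1 (zmul x y F) U) -> ip F F <= K * ip U U) ->
  (forall U, ~ degenerate p q r -> L2c U -> exists F, L2c F /\ relR F (clin 1 (zmul x y F) U)) ->
  resolvent_set H (x +i* y).
Proof.
move=> K0 HK sol.
have bound F G : relR F G ->
    ip F F <= K * ip (clin (-1) G (zmul x y F)) (clin (-1) G (zmul x y F)).
  move=> h; have [lF lG _] := h; apply: HK => //; first by apply: L2c_lin => //; exact: L2c_zmul.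
  have -> : clin 1 (zmul x y F) (clin (-1) G (zmul x y F)) = G => //.
  by apply/funext => k; apply/funext => c; apply/funext => t; rewrite /clin /rlin; ring.
split.
- move=> u cu; have [[mu_ _] _] := cu; have [U rU] := crep_exists mu_.
  have cU := closS_closR Hc hrep rU cu; have [lU hU] := cU.
  suff [F [G [h e]]] : exists F G, opR F G /\
      ip (clin (-1) (clin (-1) G (zmul x y F)) U) (clin (-1) (clin (-1) G (zmul x y F)) U) = 0.
    exists (r2c F), (r2c G); split; first exact: opR_r2c.
    have [_ cF cG] := h.
    have mF := closR_measurable cF; have mG := closR_measurable cG.
    by apply/(eqH_ip Hc hrep (L2c_shift x y h) lU (crep_shift x y (crep_r2c mF) (crep_r2c mG)) rU).
  have [dg|nd] := pselect (degenerate p q r).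
    (* All elements of the closure have norm 0, so the zero pair solves the equation up to null
       functions; it is obtained as 0 times any pair of the relation. *)
    have [D [G rD] _] := hU 1 ltr01.
    pose Z : @cvec R := zmul 0 0 D.
    have r0 : relR Z (zmul 0 0 G) by exact: relR_zmul.
    have e0 : zmul 0 0 G = Z.
      by apply/funext => -[]; apply/funext => c; apply/funext => t; rewrite /Z /zmul; ring.
    rewrite e0 in r0; have cZ : closR Z by apply: (domR_closR Hc); exists Z.
    exists Z, Z; split => //; have [lZ _ _] := r0.
    have -> : clin (-1) (clin (-1) Z (zmul x y Z)) U = clin (-1) Z U.
      by apply/funext => -[]; apply/funext => c; apply/funext => t; rewrite /clin /rlin /Z /zmul; ring.
    by apply: degenerate_closR => //; exact: closR_lin.
  have [F [lF h]] := sol U nd lU; exists F, (clin 1 (zmul x y F) U).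
  have cF : closR F by apply: (domR_closR Hc); eexists; exact: h.
  (* [z F] lies in the domain and [U] in its closure, so the right-hand side selects the operator
     part of the relation. *)
  have cG : closR (clin 1 (zmul x y F) U).
    apply: closR_lin => //; apply: (domR_closR Hc); eexists; exact: relR_zmul h.
  split => //.
  have -> : clin (-1) (clin (-1) (clin 1 (zmul x y F) U) (zmul x y F)) U = zmul 0 0 U.
    by apply/funext => -[]; apply/funext => c; apply/funext => t; rewrite /clin /rlin /zmul; ring.
  rewrite /Submission.ip (_ : QQ _ _ = fun=> 0) ?/IR ?/Rintegral ?integral0//.
  by apply/funext => t; rewrite QQ_zmul; ring.
- move=> f1 g1 f2 g2 o1 o2 e.
  have [F1 [G1 [rf1 rg1 h1]]] := opS_reps o1; have [F2 [G2 [rf2 rg2 h2]]] := opS_reps o2.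
  have /(eqH_ip Hc hrep (L2c_shift x y h1) (L2c_shift x y h2)
    (crep_shift x y rf1 rg1) (crep_shift x y rf2 rg2)) {}e := e.
  have [r1 _ _] := h1; have [r2 _ _] := h2; have [lF1 _ _] := r1; have [lF2 _ _] := r2.
  apply/(eqH_ip Hc hrep lF1 lF2 rf1 rf2); apply/eqP; rewrite eq_le (ip_ge0 Hc) andbT.
  have := bound _ _ (relR_lin Hc (-1) r1 r2).
  have -> : clin (-1) (clin (-1) G1 G2) (zmul x y (clin (-1) F1 F2)) =
    clin (-1) (clin (-1) G1 (zmul x y F1)) (clin (-1) G2 (zmul x y F2)).
    by apply/funext => -[]; apply/funext => c; apply/funext => t; rewrite /clin /rlin /zmul; ring.
  by rewrite e mulr0.
exists (Num.sqrt K) => f g o; have [F [G [rf rg [h _ _]]]] := opS_reps o.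
rewrite (normH_rep Hc hrep rf) (normH_rep Hc hrep (crep_shift x y rf rg)) -sqrtrM//.
by apply: ler_wsqrtr; exact: bound.
Qed.

End Directions.

Theorem theorem1p2 (R : realType) (H : R -> 'M[R]_2) (hH : coefficient_fun H) :
  spectrum H `<=` [set (t%:C : R[i]) | t in `[0, +oo[%classic] <->
  exists phi : R -> R,
    [/\ (forall x y : R, x <= y -> phi y <= phi x),
        (exists phi_minfty phi_pinfty : R,
          [/\ phi x @[x --> -oo] --> phi_minfty,
              phi x @[x --> +oo] --> phi_pinfty &
              phi_minfty - phi_pinfty <= pi]) &
        {ae @completed_lebesgue_measure R, forall x : R, H x = Pmx (phi x)}].
Proof.
split.
  have [p [q [r [Hc hrep]]]] := coefficient_representative hH.
  move=> /(spectrum_form_ge0 Hc hrep) pos.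
  have [alpha [phi [mono range ephi]]] := monotone_phase Hc pos.
  have [a [b [ca cb ab]]] := nonincreasing_limits mono range.
  exists phi; split => //; first by exists a, b; split => //; lra.
  apply/ae_completed; apply: aeS (aeI ephi hrep) => x [[-> -> ->] [h1 h2 h3 h4]].
  have [e1 e2 e3 e4] := PmxE (phi x).
  apply/matrixP => i j; rewrite -(i2cK i) -(i2cK j).
  by case: (i2c i); case: (i2c j); rewrite /= ?h1 ?h2 ?h3 ?h4 ?e1 ?e2 ?e3 ?e4.
move=> [phi [mono [a [b [ca cb ab]]] /ae_completed eH]].
(* The limit at [+oo] serves as [alpha]. *)
have range x : b <= phi x <= b + pi.
  by have /andP[-> h] := nonincreasing_between mono ca cb x; lra.
have hrep : Hrep H (pP phi) (qP phi) (rP phi).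
  by apply: aeS eH => x ->; have [e1 e2 e3 e4] := PmxE (phi x); split.
move=> [x y] nres; have [xy|xy] := boolP ((y != 0) || (x < 0)).
  case: nres; have [K [K0 [HK _]]] := resolvent_bound mono range xy.
  apply: (resolvent_set_intro (coeffP mono) hrep K0 HK) => U nd lU.
  exact: (resolvent_solution mono range xy nd lU).
move: xy; rewrite negb_or negbK -leNgt => /andP[/eqP -> x0].
by exists x => //=; rewrite in_itv /= x0.
Qed.
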